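(* Let $G$ be a compact metrizable abelian group with dual group $\Gamma$, let $\Lambda\subset\Gamma$, and let $X$ and $Y$ be Banach spaces such that: (i) $X$ is separable; (ii) $X^*$ and $Y$ have type I-$\Lambda$-RNP (resp. type II-$\Lambda$-RNP); (iii) $L(X,Y)=K(X,Y)$. Then $K(X,Y)$ has type I-$\Lambda$-RNP (resp. type II-$\Lambda$-RNP).
   Context: $L(X,Y)$ (resp. $K(X,Y)$) denotes the Banach space of all bounded (resp. compact) linear operators from $X$ into $Y$. $\mathcal{B}(G)$ is the Borel $\sigma$-algebra of $G$, $\lambda$ the normalized Haar measure on $G$, and $\Gamma$ the (countable discrete) dual group of $G$. For a Banach space $E$: $L^p(G,E)$ is the Bochner space over $(G,\mathcal{B}(G),\lambda)$; $M(G,E)$ is the space of $E$-valued countably additive measures on $\mathcal{B}(G)$ of bounded variation; $M^\infty(G,E)=\{\mu\in M(G,E): |\mu|\le C\lambda \text{ for some } C>0\}$, where $|\mu|$ is the variation of $\mu$. For $f\in L^1(G,E)$ and $\mu\in M(G,E)$, $\hat f(\gamma)=\int_G \bar\gamma f\,d\lambda$ and $\hat\mu(\gamma)=\int_G\bar\gamma\,d\mu$ for $\gamma\in\Gamma$. $L^p_\Lambda(G,E)$, $M_\Lambda(G,E)$, $M^\infty_\Lambda(G,E)$ are the sets of those elements of $L^p(G,E)$, $M(G,E)$, $M^\infty(G,E)$ whose Fourier transform vanishes at every $\gamma\notin\Lambda$, and $M_{\Lambda,ac}(G,E)=\{\mu\in M_\Lambda(G,E): \mu \text{ is absolutely continuous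 with respect to }\lambda\}$. A function $f\in L^1(G,E)$ is identified with the measure $A\mapsto\int_A f\,d\lambda$. $E$ has type I-$\Lambda$-RNP if $M^\infty_\Lambda(G,E)=L^\infty_\Lambda(G,E)$, and type II-$\Lambda$-RNP if $M_{\Lambda,ac}(G,E)=L^1_\Lambda(G,E)$. *)

(* Defs.v *)
From HB Require Import structures.
From mathcomp Require Import all_boot all_order all_algebra.
From mathcomp Require Import complex.
From mathcomp Require Import all_classical all_reals all_analysis.

Set Implicit Arguments.
Unset Strict Implicit.
Unset Printing Implicit Defensive.

Import Order.TTheory GRing.Theory Num.Theory.
Import numFieldNormedType.Exports.

Local Open Scope classical_set_scope.
Local Open Scope complex_scope.
Local Open Scope ring_scope.

(* Norms of a normed module over R[i] take their values in R[i]; [nrm] is the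
   same norm as an element of R (see [nrmE]). *)
Definition nrm (R : realType) (V : normedZmodType R[i]) (x : V) : R :=
  complex.Re `|x|.

Section nrm_theory.
Context {R : realType} {V : normedZmodType R[i]}.
Implicit Types x y : V.

Lemma nrmE x : (nrm x)%:C = `|x|.
Proof. by rewrite /nrm RRe_real// normr_real. Qed.

Lemma nrm_ge0 x : 0 <= nrm x.
Proof. by rewrite -lecR nrmE; exact: normr_ge0. Qed.

Lemma nrmD x y : nrm (x + y) <= nrm x + nrm y.
Proof. by rewrite -lecR rmorphD/= !nrmE ler_normD. Qed.

Lemma nrm0 : nrm (0 : V) = 0.
Proof. by rewrite /nrm normr0. Qed.

Lemma nrm_eq0 x : nrm x = 0 -> x = 0.
Proof. by move=> x0; apply/eqP; rewrite -normr_eq0 -nrmE x0. Qed.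

End nrm_theory.

Lemma nrmZ (R : realType) (V : normedModType R[i]) (a : R[i]) (x : V) :
  nrm (a *: x) = nrm a * nrm x.
Proof. by apply: complexI; rewrite rmorphM/= !nrmE normrZ. Qed.

Section bounded_operators.
Context {R : realType} (X Y : normedModType R[i]).

Definition bounded_linear : {pred X -> Y} := mem
  [set f | linear f /\ exists M : R, forall x, nrm (f x) <= M * nrm x].

Lemma bounded_linear_submod : submod_closed bounded_linear.
Proof.
split.
  rewrite inE; split=> [a x y|]; first by rewrite /= scaler0 addr0.
  by exists 0 => x; rewrite nrm0 mul0r.
move=> a f g; rewrite !inE => -[fl [M fM]] [gl [N gN]]; split.
  move=> b x y /=.
  have -> z : (a *: f + g) z = a *: f z + g z by [].
  rewrite fl gl !scalerDr !scalerA [b * a]mulrC -!addrA; congr (_ + _).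
  by rewrite !addrA; congr (_ + _); rewrite addrC.
exists (nrm a * M + N) => x.
rewrite (le_trans (nrmD _ _))// mulrDl lerD// nrmZ -mulrA.
by rewrite ler_wpM2l// nrm_ge0.
Qed.

HB.instance Definition _ :=
  GRing.isSubmodClosed.Build _ _ bounded_linear bounded_linear_submod.

Record bounded_op := BoundedOp {
  bop_fun :> X -> Y ;
  bop_mem : bop_fun \in bounded_linear }.

HB.instance Definition _ := [isSub for bop_fun].
HB.instance Definition _ := [Choice of bounded_op by <:].
HB.instance Definition _ := [SubChoice_isSubLmodule of bounded_op by <:].

Definition opnorm (T : bounded_op) : R :=
  sup [set nrm (T x) | x in [set x : X | nrm x <= 1]].

Lemma bop_linear (T : bounded_op) : linear T.
Proof. by case: T => f /= /[!inE] -[]. Qed.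

Lemma bop_linear0 (T : bounded_op) : T 0 = 0.
Proof. by have := bop_linear T (-1) 0 0; rewrite !scaleN1r !addNr. Qed.

Lemma bop_linearZ (T : bounded_op) a x : T (a *: x) = a *: T x.
Proof. by have := bop_linear T a x 0; rewrite bop_linear0 !addr0. Qed.

Lemma opnorm_has_sup (T : bounded_op) :
  has_sup [set nrm (T x) | x in [set x : X | nrm x <= 1]].
Proof.
split; first by exists (nrm (T 0)), 0 => //=; rewrite nrm0.
case: T => f /= /[!inE] -[fl [M fM]]; exists `|M| => _ [x /= x1 <-].
rewrite (le_trans (fM x))// (le_trans (ler_norm _))// normrM.
by rewrite (ger0_norm (nrm_ge0 x)) ler_piMr.
Qed.

Lemma opnorm_ge (T : bounded_op) x : nrm x <= 1 -> nrm (T x) <= opnorm T.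
Proof. by move=> x1; apply: (sup_upper_bound (opnorm_has_sup T)); exists x. Qed.

Lemma opnorm_le (T : bounded_op) c :
  (forall x, nrm x <= 1 -> nrm (T x) <= c) -> opnorm T <= c.
Proof.
move=> Tc; apply: sup_le_ub; first by case: (opnorm_has_sup T).
by move=> _ [x /= x1 <-]; exact: Tc.
Qed.

Lemma opnorm_ge0 T : 0 <= opnorm T.
Proof. by rewrite (le_trans (nrm_ge0 (T 0)))// opnorm_ge// nrm0. Qed.

Lemma opnormD S T : opnorm (S + T) <= opnorm S + opnorm T.
Proof.
apply: opnorm_le => x x1.
by rewrite (le_trans (nrmD (S x) (T x)))// lerD// opnorm_ge.
Qed.

Lemma opnormZ_le a T : opnorm (a *: T) <= nrm a * opnorm T.
Proof.
apply: opnorm_le => x x1; have -> : (a *: T) x = a *: T x by [].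
by rewrite nrmZ ler_wpM2l ?nrm_ge0// opnorm_ge.
Qed.

Lemma opnormZ a T : opnorm (a *: T) = nrm a * opnorm T.
Proof.
apply/eqP; rewrite eq_le opnormZ_le/=.
have [->|a0] := eqVneq a 0; first by rewrite nrm0 mul0r opnorm_ge0.
have a0' : 0 < nrm a.
  by rewrite lt_neqAle nrm_ge0 andbT eq_sym; apply: contra_neq a0; exact: nrm_eq0.
rewrite -ler_pdivlMl//.
have := opnormZ_le a^-1 (a *: T); rewrite scalerA mulVf// scale1r => /le_trans.
apply; rewrite le_eqVlt; apply/predU1P; left; congr (_ * _).
by apply: complexI; rewrite fmorphV/= !nrmE normfV.
Qed.

Lemma opnorm_eq0 T : opnorm T = 0 -> T = 0.
Proof.
move=> T0; apply/val_inj/funext => x /=.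
have [->|x0] := eqVneq x 0; first by rewrite bop_linear0.
have nx0 : `|x| != 0 by rewrite normr_eq0.
have /opnorm_ge : nrm (`|x|^-1 *: x) <= 1.
  by rewrite -lecR nrmE normrZ normfV normr_id mulVf.
move=> /(_ T); rewrite T0 bop_linearZ => Tx.
have /nrm_eq0/eqP : nrm (`|x|^-1 *: T x) = 0.
  by apply/eqP; rewrite eq_le Tx nrm_ge0.
by rewrite scaler_eq0 invr_eq0 (negbTE nx0)/= => /eqP.
Qed.

Let norm (T : bounded_op) : R[i] := (opnorm T)%:C.

Let normD S T : norm (S + T) <= norm S + norm T.
Proof. by rewrite /norm -rmorphD lecR; exact: opnormD. Qed.

Let normZ a T : norm (a *: T) = `|a| * norm T.
Proof. by rewrite /norm opnormZ rmorphM/= nrmE. Qed.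

Let norm_eq0 T : norm T = 0 -> T = 0.
Proof. by move=> /complexI; exact: opnorm_eq0. Qed.

HB.instance Definition _ :=
  Lmodule_isNormed.Build R[i] bounded_op normD normZ norm_eq0.

Definition is_compact_op : {pred bounded_op} := mem
  [set T : bounded_op | precompact (T @` [set x | `|x| <= 1])].

Lemma is_compact_op_submod : submod_closed is_compact_op.
Proof.
have hY : hausdorff_space Y := @norm_hausdorff _ Y.
split.
  rewrite inE; exists [set 0]; last first.
    by split; [|apply: compact_closed => //]; exact: compact_set1.
  by move=> _ [x _ <-].
move=> a S T; rewrite !inE => -[A SA [cA _]] [B TB [cB _]].
pose h (z : Y * Y) := a *: z.1 + z.2.
have cAB : compact (h @` (A `*` B)).
  apply: continuous_compact; last exact: compact_setX.
  apply: continuous_subspaceT => z; apply: cvgD; last exact: cvg_snd.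
  by apply: cvgZr; exact: cvg_fst.
exists (h @` (A `*` B)); last by split=> //; exact: compact_closed.
move=> _ [x x1 <-]; exists (S x, T x) => //.
by split; [apply: SA; exists x|apply: TB; exists x].
Qed.

HB.instance Definition _ :=
  GRing.isSubmodClosed.Build _ _ is_compact_op is_compact_op_submod.

Record compact_op := CompactOp {
  cop_bop :> bounded_op ;
  cop_mem : cop_bop \in is_compact_op }.

HB.instance Definition _ := [isSub for cop_bop].
HB.instance Definition _ := [Choice of compact_op by <:].
HB.instance Definition _ := [SubChoice_isSubLmodule of compact_op by <:].

Let cnorm (T : compact_op) : R[i] := `|val T|.

Let cnormD S T : cnorm (S + T) <= cnorm S + cnorm T.
Proof. exact: ler_normD. Qed.

Let cnormZ a T : cnorm (a *: T) = `|a| * cnorm T.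
Proof. exact: normrZ. Qed.

Let cnorm_eq0 T : cnorm T = 0 -> T = 0.
Proof. by move=> /normr0_eq0 T0; exact: val_inj. Qed.

HB.instance Definition _ :=
  Lmodule_isNormed.Build R[i] compact_op cnormD cnormZ cnorm_eq0.

End bounded_operators.

Arguments is_compact_op {R X Y}.

Definition separable (T : topologicalType) : Prop :=
  exists2 D : set T, countable D & dense D.

Definition metrizable (R : realType) (T : topologicalType) : Prop :=
  exists d : T -> T -> R,
    [/\ forall x y, d x y = 0 <-> x = y,
        forall x y, d x y = d y x,
        forall x y z, d x z <= d x y + d y z &
        forall x A, nbhs x A <->
          exists2 e : R, 0 < e & [set y | d x y < e] `<=` A].

Section vector_measures.
Context {d : measure_display} {T : measurableType d} {R : realType}.
Context {E : normedModType R[i]}.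
Implicit Types (mu : set T -> E) (P : probability T R) (A : set T).

Definition simple_fun (V : Type) (s : T -> V) : Prop :=
  finite_set (range s) /\ forall v, measurable (s @^-1` [set v]).

(* An E-valued measure is represented by a function on all sets, of which only
   the values on measurable sets are meaningful. *)
Definition countably_additive mu : Prop :=
  forall F : (set T)^nat, (forall n, measurable (F n)) ->
    trivIset setT F ->
    \sum_(0 <= i < n) mu (F i) @[n --> \oo] --> mu (\bigcup_n F n).

Definition variation mu A : \bar R :=
  ereal_sup [set x | exists n (F : (set T)^nat),
    [/\ forall i, measurable (F i), trivIset `I_n F,
        \bigcup_(i in `I_n) F i = A &
        x = (\sum_(0 <= i < n) nrm (mu (F i)))%:E]].

Definition bv_measures : set (set T -> E) :=
  [set mu | countably_additive mu /\ (variation mu setT < +oo)%E].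

Definition bv_measures_infty P : set (set T -> E) :=
  [set mu | bv_measures mu /\
    exists2 C : R, 0 < C &
      forall A, measurable A -> (variation mu A <= C%:E * P A)%E].

Definition abs_continuous P mu : Prop :=
  forall A, measurable A -> P A = 0%E -> mu A = 0.

(* Integral of a bounded scalar function against a vector measure of bounded
   variation, through uniform approximation by simple functions. *)
Definition simple_integral_vm mu (s : T -> R[i]) : E :=
  \sum_(a \in range s) a *: mu (s @^-1` [set a]).

Definition is_integral_vm mu (phi : T -> R[i]) (v : E) : Prop :=
  exists s : (T -> R[i])^nat,
    [/\ forall n, simple_fun (s n),
        forall e : R, 0 < e ->
          \forall n \near \oo, forall x, nrm (phi x - s n x) < e &
        simple_integral_vm mu (s n) @[n --> \oo] --> v].

Definition integral_vm mu (phi : T -> R[i]) : E :=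
  xget 0 [set v | is_integral_vm mu phi v].

(* Measurability with respect to the completion of P, as in the definition of
   the Bochner integral. The library integrals of norms below are lower
   integrals, hence take the expected value on such functions. *)
Definition strongly_measurable P (f : T -> E) : Prop :=
  exists s : (T -> E)^nat,
    (forall n, simple_fun (s n)) /\
    {ae P, forall x, s n x @[n --> \oo] --> f x}.

Definition simple_integral P (s : T -> E) : E :=
  \sum_(v \in range s) (fine (P (s @^-1` [set v])))%:C *: v.

Definition is_bochner_integral P (f : T -> E) (v : E) : Prop :=
  strongly_measurable P f /\
  exists s : (T -> E)^nat,
    [/\ forall n, simple_fun (s n),
        (\int[P]_x (nrm (f x - s n x))%:E)%E @[n --> \oo] --> 0%E &
        simple_integral P (s n) @[n --> \oo] --> v].

Definition bochner_integral P A (f : T -> E) : E :=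
  xget 0 [set v | is_bochner_integral P (patch (fun=> 0) A f) v].

Definition bochner_space P (p : \bar R) : set (T -> E) :=
  [set f | strongly_measurable P f /\
           (Lnorm P p (fun x => (nrm (f x))%:E) < +oo)%E].

(* F seen as a set of measures, f being identified with A |-> \int_A f dP. *)
Definition densities P (F : set (T -> E)) : set (set T -> E) :=
  [set mu | exists2 f, F f &
     forall A, measurable A -> mu A = bochner_integral P A f].

End vector_measures.

Definition borel (G : topologicalZmodType) : Type := G.

Section borel_instances.
Variable G : topologicalZmodType.

HB.instance Definition _ := Choice.on (borel G).
HB.instance Definition _ := isPointed.Build (borel G) (0 : G).

Let borelC (A : set (borel G)) : <<s @open G >> A -> <<s @open G >> (~` A).
Proof. by move=> oA; rewrite -setTD; exact: sigma_algebraCD. Qed.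

HB.instance Definition _ := @isMeasurable.Build (sigma_display (@open G))
  (borel G) <<s @open G >> (@sigma_algebra0 _ setT _) borelC
  (@sigma_algebra_bigcup _ setT _).

End borel_instances.

(* On a compact metrizable group every Borel probability measure is regular, so
   that translation invariance characterizes the normalized Haar measure. *)
Definition is_haar (R : realType) (G : topologicalZmodType)
    (lam : probability (borel G) R) : Prop :=
  forall (x : G) (A : set (borel G)), measurable A ->
    lam (+%R x @` A) = lam A.

Record character (R : realType) (G : topologicalZmodType) := Character {
  char_fun :> G -> R[i] ;
  char_continuous : continuous (char_fun : G -> R[i]^o) ;
  char_add : forall x y, char_fun (x + y) = char_fun x * char_fun y ;
  char_norm : forall x, `|char_fun x| = 1 }.

Section fourier.
Context {R : realType} {G : topologicalZmodType}.
Variable lam : probability (borel G) R.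
Context {E : normedModType R[i]}.
Implicit Types (mu : set (borel G) -> E) (f : borel G -> E).
Implicit Type gamma : character R G.

Definition fourier_vm mu gamma : E := integral_vm mu (fun x => (gamma x)^*).

Definition fourier f gamma : E :=
  bochner_integral lam setT (fun x => (gamma x)^* *: f x).

Variable Lam : set (character R G).

Definition bv_measures_spec : set (set (borel G) -> E) :=
  [set mu | bv_measures mu /\
            forall gamma, ~ Lam gamma -> fourier_vm mu gamma = 0].

Definition bv_measures_infty_spec : set (set (borel G) -> E) :=
  [set mu | bv_measures_infty lam mu /\
            forall gamma, ~ Lam gamma -> fourier_vm mu gamma = 0].

Definition bv_measures_ac_spec : set (set (borel G) -> E) :=
  [set mu | bv_measures_spec mu /\ abs_continuous lam mu].

Definition bochner_space_spec (p : \bar R) : set (borel G -> E) :=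
  [set f | bochner_space lam p f /\
           forall gamma, ~ Lam gamma -> fourier f gamma = 0].

End fourier.

Definition typeI_RNP (R : realType) (G : topologicalZmodType)
    (lam : probability (borel G) R) (Lam : set (character R G))
    (E : normedModType R[i]) : Prop :=
  bv_measures_infty_spec lam Lam =
  densities lam (@bochner_space_spec _ _ lam E Lam +oo%E).

Definition typeII_RNP (R : realType) (G : topologicalZmodType)
    (lam : probability (borel G) R) (Lam : set (character R G))
    (E : normedModType R[i]) : Prop :=
  bv_measures_ac_spec lam Lam =
  densities lam (@bochner_space_spec _ _ lam E Lam 1%E).

(* Main.v *)
Require Import Defs.
From HB Require Import structures.
From mathcomp Require Import all_boot all_order all_algebra.
From mathcomp Require Import complex finmap.
From mathcomp Require Import all_classical all_reals all_analysis.
From mathcomp Require Import measurable_realfun ess_sup_inf.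
From mathcomp Require Import lra.

Local Notation variation := Defs.variation.

(** The Radon-Nikodym property of K(X, Y) is obtained by building the density of a
K(X, Y)-valued measure mu pointwise.

For x in X the measure mu(.) x takes its values in Y, inherits the bounds and the
spectrum of mu, and so has a density f_x by the hypothesis on Y. Let x run through
the combinations, with coefficients in Q[i], of a dense sequence of X. For almost
every t, the map sending x to f_x(t) is linear and bounded on these countably many
combinations ([pointwise_bound_exists]): the integral of a supremum of finitely many
quotients |f_x| / |x| is at most the total variation of mu, because the variation is
superadditive and the variation of an indefinite integral is the integral of the norm
of the density ([density_integral_le_variation]). It extends to a bounded operator
f(t) from X to Y ([comb_extension]), which is compact since L(X, Y) = K(X, Y).

The remaining question is whether f is measurable for the operator norm, that is,
whether almost all its values lie in a separable subset of K(X, Y). Here the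
hypothesis on the dual of X enters: for a functional w on Y, the composition of w
with mu is a measure with values in the dual of X, and it has a density by
hypothesis. By uniqueness of densities this density is almost everywhere the
composition of w with f(t), so that these compositions stay in a separable set of
functionals. Only countably many w are needed to compute the norms of all differences
f(t) - f(t'), by the Hahn-Banach theorem ([norming_functional]) and because the
values f(t) x stay in a separable part of Y. A set of compact operators with these
two properties is separable ([compact_ops_separable]), by a quantitative version of
the argument that the adjoint of a compact operator is compact.

Once f is measurable, its norm is dominated by the integrable supremum above, and its
indefinite integral is mu because both agree after evaluation at a dense sequence
([op_density]). For type I the density is moreover essentially bounded
([densitiesy_intro]). The converse inclusion, that integrable functions with spectrum
in Lambda define measures with the required properties, holds over every complete
space ([densities1_sub], [densitiesy_sub]).

Completeness of the operator spaces is needed for the existence of the integrals; for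
K(X, Y) it comes from its equality with L(X, Y). *)

Import Order.TTheory GRing.Theory Num.Theory.
Import numFieldNormedType.Exports.

Local Open Scope classical_set_scope.
Local Open Scope complex_scope.
Local Open Scope ring_scope.

Set Implicit Arguments.
Unset Strict Implicit.
Unset Printing Implicit Defensive.

(** * Real-valued norms, limits and completeness *)

Section nrm_limits.
Context {R : realType}.

Lemma nrmN (V : normedZmodType R[i]) (x : V) : nrm (- x) = nrm x.
Proof. by rewrite /nrm normrN. Qed.

Lemma nrm_distC (V : normedZmodType R[i]) (x y : V) : nrm (x - y) = nrm (y - x).
Proof. by rewrite -nrmN opprB. Qed.

Lemma nrm_triangle (V : normedZmodType R[i]) (y x z : V) :
  nrm (x - z) <= nrm (x - y) + nrm (y - z).
Proof. by rewrite -[x - z](subrKA y) nrmD. Qed.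

Lemma nrmB_le (V : normedZmodType R[i]) (x y : V) : nrm x <= nrm y + nrm (x - y).
Proof. by rewrite -{1}(subrK y x) addrC nrmD. Qed.

Lemma nrmB (V : normedZmodType R[i]) (x y : V) : nrm (x - y) <= nrm x + nrm y.
Proof. by rewrite -(nrmN y) nrmD. Qed.

Lemma nrm_dist_dist (V : normedZmodType R[i]) (x y : V) :
  `|nrm x - nrm y| <= nrm (x - y).
Proof.
have h1 := nrmB_le x y; have h2 := nrmB_le y x.
by rewrite nrm_distC in h2; rewrite ler_norml; apply/andP; split; lra.
Qed.

Lemma nrm_sum (V : normedZmodType R[i]) (I : Type) (s : seq I) (P : pred I)
    (F : I -> V) :
  nrm (\sum_(i <- s | P i) F i) <= \sum_(i <- s | P i) nrm (F i).
Proof.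
elim/big_ind2 : _ => [|x a y b xa yb|//]; first by rewrite nrm0.
by rewrite (le_trans (nrmD _ _))// lerD.
Qed.

Lemma nrm_real (r : R) : nrm (r%:C : R[i]) = `|r|.
Proof. by rewrite /nrm normc_def /= expr0n addr0 sqrtr_sqr. Qed.

Lemma nrm_i : nrm ('i : R[i]) = 1.
Proof. by rewrite /nrm normc_def /= expr0n add0r expr1n sqrtr1. Qed.

Lemma nrmM (a b : R[i]) : nrm (a * b) = nrm a * nrm b.
Proof. by apply: complexI; rewrite rmorphM/= !nrmE normrM. Qed.

Lemma cvg_nrmP (V : normedModType R[i]) (u : nat -> V) (l : V) :
  u n @[n --> \oo] --> l <-> nrm (u n - l) @[n --> \oo] --> (0 : R).
Proof.
split=> [/cvgrPdist_lt|/cvgrPdist_lt] ul.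
  apply/cvgrPdist_lt => e e0.
  have : 0 < e%:C by rewrite ltcR.
  move=> /ul; apply: filterS => n.
  by rewrite sub0r normrN (ger0_norm (nrm_ge0 _)) -nrmE ltcR nrm_distC.
apply/cvgrPdist_lt => e e0.
have e0' : 0 < complex.Re e by rewrite -ltcR RRe_real// gtr0_real.
have := ul _ e0'; apply: filterS => n.
rewrite sub0r normrN (ger0_norm (nrm_ge0 _)) -nrmE => h.
by rewrite -(RRe_real (gtr0_real e0)) ltcR nrm_distC.
Qed.

Lemma nrm_squeeze (V : normedModType R[i]) (u : nat -> V) (l : V) (a : nat -> R) :
  (forall n, nrm (u n - l) <= a n) -> a n @[n --> \oo] --> (0 : R) ->
  u n @[n --> \oo] --> l.
Proof.
move=> ua a0; apply/cvg_nrmP.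
apply: (@squeeze_cvgr _ _ _ _ (cst 0) a) => //; last exact: cvg_cst.
by apply: nearW => n; rewrite nrm_ge0 ua.
Qed.

Lemma nrm_lim_unique (V : normedModType R[i]) (u : nat -> V) (l l' : V) :
  u n @[n --> \oo] --> l -> u n @[n --> \oo] --> l' -> l = l'.
Proof. by move=> ul ul'; apply: (cvg_unique _ ul ul'). Qed.

Lemma cvg0_mull (c : R) (a : nat -> R) :
  a n @[n --> \oo] --> (0 : R) -> c * a n @[n --> \oo] --> (0 : R).
Proof.
move=> a0; have : c * a n @[n --> \oo] --> c * 0 by apply: cvgM => //; exact: cvg_cst.
by rewrite mulr0.
Qed.

Lemma cvg_nrm (V : normedModType R[i]) (u : nat -> V) (l : V) :
  u n @[n --> \oo] --> l -> nrm (u n) @[n --> \oo] --> nrm l.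
Proof.
move=> /cvg_nrmP/cvgrPdist_lt ul; apply/cvgrPdist_lt => e /ul.
apply: filterS => n; rewrite sub0r normrN (ger0_norm (nrm_ge0 _)) nrm_distC.
exact: le_lt_trans (nrm_dist_dist _ _).
Qed.

Lemma cvg_scaler (V : normedModType R[i]) (a : nat -> R[i]^o) (b : R[i]^o)
    (u : nat -> V) (l : V) :
  a n @[n --> \oo] --> b -> u n @[n --> \oo] --> l ->
  a n *: u n @[n --> \oo] --> b *: l.
Proof. by move=> ab ul; exact: cvgZ. Qed.

End nrm_limits.

(** The form in which completeness is used: Bochner integrals and integrals
against vector measures are limits of Cauchy sequences. As a mere property it
passes from Y to the operator spaces. *)
Definition seq_complete (R : realType) (V : normedModType R[i]) : Prop :=
  forall u : nat -> V,
    (forall e : R, 0 < e -> exists N, forall m n, (N <= m)%N -> (N <= n)%N ->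
       nrm (u m - u n) < e) ->
    exists l : V, u n @[n --> \oo] --> l.

Section completeness.
Context {R : realType}.

Lemma complete_seq_complete (Y : completeNormedModType R[i]) :
  @seq_complete R Y.
Proof.
move=> u uc; suff : cvg (u @ \oo) by move=> h; exists (lim (u @ \oo)).
apply/cauchy_cvgP/cauchyP => e e0.
have e0' : 0 < complex.Re e by rewrite -ltcR RRe_real// gtr0_real.
have [N Nu] := uc _ e0'; exists (u N), N => //= n Nn.
rewrite /= -ball_normE /= -nrmE -(RRe_real (gtr0_real e0)) ltcR.
exact: Nu.
Qed.

Lemma nrm_ge_Re (a : R[i]) : `|complex.Re a| <= nrm a.
Proof. by rewrite -lecR nrmE normc_ge_Re. Qed.

Lemma nrm_ge_Im (a : R[i]) : `|complex.Im a| <= nrm a.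
Proof.
by rewrite -lecR nrmE; have := normc_ge_Re (a * 'i); rewrite ReiNIm normrN -!nrmE nrmM nrm_i mulr1.
Qed.

Lemma nrm_le_ReIm (a : R[i]) : nrm a <= `|complex.Re a| + `|complex.Im a|.
Proof.
rewrite {1}(complexE a) (le_trans (nrmD _ _))// nrmM !nrm_real.
by rewrite nrm_i mul1r.
Qed.

Lemma seq_complete_C : @seq_complete R (R[i]^o).
Proof.
move=> u uc.
have [f cf] : exists l : R, (fun n => complex.Re (u n)) @ \oo --> l.
  suff h : cvg ((fun n => complex.Re (u n)) @ \oo) by exists (lim ((fun n => complex.Re (u n)) @ \oo)).
  apply/cauchy_cvgP/cauchyP => e e0.
  have [N Nu] := uc _ e0; exists (complex.Re (u N)), N => //= n Nn.
  rewrite -ball_normE /=; apply: le_lt_trans (Nu N n _ _) => //.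
  by rewrite -raddfB; exact: nrm_ge_Re.
have [g cg] : exists l : R, (fun n => complex.Im (u n)) @ \oo --> l.
  suff h : cvg ((fun n => complex.Im (u n)) @ \oo) by exists (lim ((fun n => complex.Im (u n)) @ \oo)).
  apply/cauchy_cvgP/cauchyP => e e0.
  have [N Nu] := uc _ e0; exists (complex.Im (u N)), N => //= n Nn.
  rewrite -ball_normE /=; apply: le_lt_trans (Nu N n _ _) => //.
  by rewrite -raddfB; exact: nrm_ge_Im.
exists (f +i* g).
apply: (@nrm_squeeze _ _ _ _ (fun n => `|complex.Re (u n) - f| + `|complex.Im (u n) - g|)).
  by move=> n; apply: le_trans (nrm_le_ReIm _) _; rewrite !raddfB.
rewrite -[X in _ --> X]addr0; apply: cvgD; apply/cvgr0Pnorm_lt => e e0.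
  move/cvgrPdist_lt : cf => /(_ _ e0); apply: filterS => n.
  by rewrite normr_id distrC.
move/cvgrPdist_lt : cg => /(_ _ e0); apply: filterS => n.
by rewrite normr_id distrC.
Qed.

Lemma cvgn_le_nrm (V : normedModType R[i]) (u : nat -> V) l (c : R) :
  u n @[n --> \oo] --> l -> (\forall n \near \oo, nrm (u n) <= c) -> nrm l <= c.
Proof.
move=> /cvg_nrm ul uc; rewrite -(cvg_lim _ ul)//.
by apply: limr_le => //; apply/cvg_ex; exists (nrm l).
Qed.

Lemma bop_linearD (X Y : normedModType R[i]) (T : bounded_op X Y) x y :
  T (x + y) = T x + T y.
Proof. by have := bop_linear T 1 x y; rewrite !scale1r. Qed.

Lemma bop_linearN (X Y : normedModType R[i]) (T : bounded_op X Y) x :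
  T (- x) = - T x.
Proof. by have := bop_linearZ T (-1) x; rewrite !scaleN1r. Qed.

Lemma bop_linearB (X Y : normedModType R[i]) (T : bounded_op X Y) x y :
  T (x - y) = T x - T y.
Proof. by rewrite bop_linearD bop_linearN. Qed.

Lemma bop_sum (X Y : normedModType R[i]) (T : bounded_op X Y) I (s : seq I)
  (F : I -> X) : T (\sum_(i <- s) F i) = \sum_(i <- s) T (F i).
Proof. by apply: (big_morph T (bop_linearD T) (bop_linear0 T)). Qed.

Lemma bop_nrm_le (X Y : normedModType R[i]) (T : bounded_op X Y) x :
  nrm (T x) <= opnorm T * nrm x.
Proof.
have [->|x0] := eqVneq x 0; first by rewrite bop_linear0 !nrm0 mulr0.
have nx0 : 0 < nrm x.
  rewrite lt_neqAle nrm_ge0 andbT eq_sym; apply: contra_neq x0; exact: nrm_eq0.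
rewrite -ler_pdivrMr//.
have : nrm ((nrm x)^-1%:C *: x) <= 1.
  by rewrite nrmZ nrm_real ger0_norm ?invr_ge0 ?nrm_ge0// mulVf// gt_eqF.
move=> /(opnorm_ge T); rewrite bop_linearZ nrmZ nrm_real ger0_norm ?invr_ge0 ?nrm_ge0//.
by rewrite mulrC.
Qed.

Lemma bop_cvg (X Y : normedModType R[i]) (T : bounded_op X Y) (u : nat -> X) l :
  u n @[n --> \oo] --> l -> T (u n) @[n --> \oo] --> T l.
Proof.
move=> /cvg_nrmP ul.
apply: (@nrm_squeeze _ _ _ _ (fun n => opnorm T * nrm (u n - l))).
  by move=> n; rewrite -bop_linearB bop_nrm_le.
exact: cvg0_mull.
Qed.

Lemma nrm_bop (X Y : normedModType R[i]) (T : bounded_op X Y) : nrm T = opnorm T.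
Proof. by []. Qed.

Lemma mk_bop (X Y : normedModType R[i]) (f : X -> Y) (M : R) :
  linear f -> (forall x, nrm (f x) <= M * nrm x) ->
  exists T : bounded_op X Y, forall x, T x = f x.
Proof.
move=> fl fM.
have fb : f \in bounded_linear (X := X) (Y := Y) by rewrite inE; split => //; exists M.
by exists (BoundedOp fb).
Qed.

Lemma opnorm_le_bound (X Y : normedModType R[i]) (T : bounded_op X Y) (M : R) :
  0 <= M -> (forall x, nrm (T x) <= M * nrm x) -> opnorm T <= M.
Proof.
move=> M0 TM; apply: opnorm_le => x x1; apply: le_trans (TM _) _.
by rewrite -[leRHS]mulr1 ler_wpM2l.
Qed.

Lemma seq_complete_bop (X Y : normedModType R[i]) :
  @seq_complete R Y -> @seq_complete R (bounded_op X Y).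
Proof.
move=> cY u uc.
have pc x : exists l : Y, (u n : bounded_op X Y) x @[n --> \oo] --> l.
  apply: cY => e e0.
  have e0' : 0 < e / (nrm x + 1) by rewrite divr_gt0// ltr_wpDl// nrm_ge0.
  have [N Nu] := uc _ e0'; exists N => m n Nm Nn.
  apply: (@le_lt_trans _ _ (opnorm (u m - u n) * nrm x)).
    exact: (bop_nrm_le (u m - u n) x).
  have := Nu _ _ Nm Nn; rewrite nrm_bop ltr_pdivlMr ?ltr_wpDl ?nrm_ge0//.
  apply: le_lt_trans; rewrite ler_wpM2l ?opnorm_ge0// lerDl ler01//.
have /choice [f cf] := pc.
have fl : linear f.
  move=> a x y; apply: (nrm_lim_unique (cf _)).
  under eq_fun do rewrite bop_linear.
  by apply: cvgD => //; apply: cvg_scaler => //; exact: cvg_cst.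
have near_op e : 0 < e -> exists N, forall n x, (N <= n)%N -> nrm (u n x - f x) <= e * nrm x.
  move=> e0; have [N Nu] := uc _ e0; exists N => n x Nn.
  have : (u n x - u m x) @[m --> \oo] --> u n x - f x.
    by apply: cvgB => //; exact: cvg_cst.
  move=> /cvgn_le_nrm; apply; exists N => // m /= Nm.
  apply: le_trans (bop_nrm_le (u n - u m) x) _.
  by rewrite ler_wpM2r ?nrm_ge0// ltW// Nu.
have [T Tf] : exists T : bounded_op X Y, forall x, T x = f x.
  have [N hN] := near_op 1 ltr01.
  apply: (@mk_bop _ _ _ (opnorm (u N) + 1)) => // x.
  rewrite (le_trans (nrmB_le _ (u N x)))// mulrDl lerD ?bop_nrm_le//.
  by rewrite nrm_distC hN.
exists T; apply/cvg_nrmP/cvgr0Pnorm_le => e e0.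
have [N hN] := near_op _ e0; exists N => // n /= Nn.
rewrite (ger0_norm (nrm_ge0 _)) nrm_bop.
apply: opnorm_le_bound => [|x]; first exact: ltW.
by have -> : (u n - T) x = u n x - f x; [rewrite -Tf|exact: hN].
Qed.

Lemma seq_complete_cop (X Y : normedModType R[i]) :
  [set: bounded_op X Y] = [set T : bounded_op X Y | T \in is_compact_op] ->
  @seq_complete R Y -> @seq_complete R (compact_op X Y).
Proof.
move=> LK cY u uc; have [l ul] := seq_complete_bop cY (u := fun n => val (u n)) uc.
have lK : l \in is_compact_op by have : [set: bounded_op X Y] l by []; rewrite LK.
exists (CompactOp lK); apply/cvg_nrmP.
by move/cvg_nrmP : ul.
Qed.

End completeness.

(** * Simple functions and finitely additive set functions *)

Definition fin_add (d : measure_display) (T : measurableType d) (M : zmodType)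
    (m : set T -> M) : Prop :=
  m set0 = 0 /\ forall A B, measurable A -> measurable B -> A `&` B = set0 ->
    m (A `|` B) = m A + m B.

Section simple_functions.
Context {d : measure_display} {T : measurableType d}.

Lemma simple_preimage (V : choiceType) (u : T -> V) (A : set V) :
  simple_fun u -> measurable (u @^-1` A).
Proof.
move=> [fu mu].
have -> : u @^-1` A = \bigcup_(v in range u `&` A) u @^-1` [set v].
  apply/seteqP; split=> [x Ax|x [v [_ Av] /= ->]]//; exists (u x) => //=.
  by split; [exists x|].
by apply: fin_bigcup_measurable => [|v _]; [exact: finite_setIl|exact: mu].
Qed.

Lemma simple_comp (V : choiceType) (W : Type) (g : V -> W) (u : T -> V) :
  simple_fun u -> simple_fun (g \o u).
Proof.
move=> su; split; last by move=> w; exact: (simple_preimage (g @^-1` [set w])).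
by rewrite -(image_comp u g); apply: finite_image; exact: (proj1 su).
Qed.

Lemma simple_pair (V W : choiceType) (u : T -> V) (v : T -> W) :
  simple_fun u -> simple_fun v -> simple_fun (fun x => (u x, v x)).
Proof.
move=> su sv; split.
  apply: (@sub_finite_set _ _ (range u `*` range v)).
    by move=> _ [x _ <-]; split; exists x.
  by apply: finite_setX; [exact: (proj1 su)|exact: (proj1 sv)].
move=> [a b].
rewrite (_ : _ @^-1` _ = u @^-1` [set a] `&` v @^-1` [set b]).
  by apply: measurableI; [exact: (proj2 su)|exact: (proj2 sv)].
by apply/seteqP; split=> x /= [-> ->].
Qed.

Lemma simple_cst (V : Type) (v : V) : simple_fun (fun _ : T => v).
Proof.
split; first by apply: (@sub_finite_set _ _ [set v]) => // _ [x _ <-].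
move=> w; have [->|vw] := pselect (v = w).
  by rewrite (_ : _ @^-1` _ = setT)//; apply/seteqP; split.
by rewrite (_ : _ @^-1` _ = set0)//; apply/seteqP; split.
Qed.

Lemma simple_bool (A : set T) : measurable A -> simple_fun (fun x => `[< A x >]).
Proof.
move=> mA; split; first exact: finite_finset.
case.
  by rewrite (_ : _ @^-1` _ = A)//; apply/seteqP; split=> x /asboolP.
rewrite (_ : _ @^-1` _ = ~` A); first exact: measurableC.
by apply/seteqP; split=> x /=; case: asboolP.
Qed.

Lemma simple_op (U V : choiceType) (W : Type) (h : U -> V -> W) (u : T -> U)
    (v : T -> V) :
  simple_fun u -> simple_fun v -> simple_fun (fun x => h (u x) (v x)).
Proof.
by move=> su sv; exact: (simple_comp (fun z => h z.1 z.2) (simple_pair su sv)).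
Qed.

Lemma simple_patch (V : choiceType) (v : V) (A : set T) (u : T -> V) :
  measurable A -> simple_fun u -> simple_fun (patch (fun=> v) A u).
Proof.
move=> mA su.
rewrite (_ : patch _ _ _ = fun x => (fun (b : bool) y => if b then y else v) `[< A x >] (u x)).
  exact: (simple_op (fun (b : bool) y => if b then y else v) (simple_bool mA) su).
by apply/funext => x; rewrite /patch; case: asboolP => Ax; [rewrite mem_set|rewrite memNset].
Qed.

Section simple_sums.
Context {V W : choiceType} {M E : zmodType}.
Variables (m : set T -> M) (B : W -> M -> E).
Hypothesis m_add : fin_add m.
Hypothesis B0 : forall w, B w 0 = 0.
Hypothesis BD : forall w a b, B w (a + b) = B w a + B w b.

Lemma fin_add_seq (u : T -> V) (l : seq V) : simple_fun u -> uniq l ->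
  m (u @^-1` [set` l]) = \sum_(v <- l) m (u @^-1` [set v]).
Proof.
move=> su; elim: l => [_|v l IH /= /andP[vl ul]].
  rewrite big_nil (_ : _ @^-1` _ = set0) ?(proj1 m_add)//.
  by apply/seteqP; split=> x /=; rewrite ?in_nil.
rewrite big_cons -IH//.
rewrite (_ : u @^-1` [set` v :: l] = u @^-1` [set v] `|` u @^-1` [set` l]).
  apply: (proj2 m_add (u @^-1` [set v]) (u @^-1` [set` l])); try exact: simple_preimage.
  by apply/seteqP; split=> x //= [->]; rewrite (negbTE vl).
apply/seteqP; split=> x /=; rewrite in_cons.
  by case/predU1P; [left|right].
by case=> [->|->]; rewrite ?eqxx ?orbT.
Qed.

(** The sum over the values of [g \o u] may be indexed by the values of the
finer function [u]; this is the independence of elementary integrals from the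
chosen representation, for both kinds of elementary integral used below. *)
Lemma simple_sum_comp (g : V -> W) (u : T -> V) : simple_fun u ->
  \sum_(w \in range (g \o u)) B w (m ((g \o u) @^-1` [set w])) =
  \sum_(v \in range u) B (g v) (m (u @^-1` [set v])).
Proof.
move=> su; have [fgu _] := simple_comp g su; have [fu _] := su.
rewrite !fsbig_finite//=.
have -> : fset_set (range (g \o u)) = [fset g v | v in fset_set (range u)]%fset.
  by rewrite -(image_comp u g) -fset_set_image.
rewrite [RHS](partition_big_imfset _ g)/=; apply: eq_big_seq => w _.
have -> : \sum_(v <- fset_set (range u) | g v == w) B (g v) (m (u @^-1` [set v])) =
          \sum_(v <- [seq v <- fset_set (range u) | g v == w]) B w (m (u @^-1` [set v])).
  by rewrite big_filter; apply: eq_bigr => v /eqP ->.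
rewrite -(big_morph (B w) (BD w) (B0 w)) -fin_add_seq//; last first.
  by rewrite filter_uniq// fset_uniq.
congr (B w (m _)); apply/seteqP; split=> x /=.
  move=> /= <-; rewrite mem_filter eqxx/= in_fset_set// mem_set//=.
  by exists x.
by rewrite mem_filter => /andP[/eqP].
Qed.

End simple_sums.

End simple_functions.

(** * The space of Bochner integrable functions *)

Section lower_integral.
Local Open Scope ereal_scope.
Context {d : measure_display} {T : measurableType d} {R : realType}.
Variable P : probability T R.
Import HBNNSimple.

(** The integral of a nonnegative function that is not assumed to be measurable is
a lower integral. It ignores null sets all the same, since the simple functions
below the integrand may be cut off on a null set without changing their
integrals. *)
Lemma le_lower_integral_ae (f g : T -> \bar R) :
  (forall x, 0 <= f x) -> (forall x, 0 <= g x) ->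
  {ae P, forall x, f x = g x} -> \int[P]_x f x <= \int[P]_x g x.
Proof.
move=> f0 g0 [N [mN PN fgN]]; rewrite !ge0_integralTE//.
apply: ub_ereal_sup => _ [h hf <-].
have mNC : measurable (~` N) by exact: measurableC.
rewrite -integralT_nnsfun (_ : \int[P]_x (h x)%:E =
  \int[P]_x (proj_nnsfun h mNC x)%:E); last first.
  have aeN : {ae P, forall x, ~ N x} by exists N; split => // x /= /contrapT.
  apply: ae_eq_integral => //; first exact/measurable_EFinP/measurable_funP.
    exact/measurable_EFinP/measurable_funP.
  by apply: filterS aeN => x Nx _ /=; rewrite mindicE mem_set// mulr1.
rewrite integralT_nnsfun; apply: ereal_sup_ubound; exists (proj_nnsfun h mNC) => //= x.
rewrite mindicE; case: (pselect (N x)) => Nx.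
  by rewrite memNset ?mulr0//=; exact/notK.
rewrite mem_set// mulr1 (le_trans (hf x))//.
suff -> : f x = g x by [].
by apply: contrapT => fg; apply: Nx; exact: fgN.
Qed.

Lemma lower_integral_ae (f g : T -> \bar R) :
  (forall x, 0 <= f x) -> (forall x, 0 <= g x) ->
  {ae P, forall x, f x = g x} -> \int[P]_x f x = \int[P]_x g x.
Proof.
move=> f0 g0 fg; apply/eqP; rewrite eq_le !le_lower_integral_ae//.
by move: fg; apply: filterS => x ->.
Qed.

End lower_integral.

(** Everywhere convergence, unlike convergence off a null set, makes the norm of
the function measurable, so that the integrals of norms are additive and obey the
convergence theorems. *)
Definition bmeas (d : measure_display) (T : measurableType d) (R : realType)
    (E : normedModType R[i]) (f : T -> E) : Prop :=
  exists2 s : nat -> T -> E, (forall n, simple_fun (s n)) &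
    forall x, s n x @[n --> \oo] --> f x.

Definition L1norm (d : measure_display) (T : measurableType d) (R : realType)
    (P : probability T R) (E : normedModType R[i]) (f : T -> E) : \bar R :=
  (\int[P]_x (nrm (f x))%:E)%E.

Section measurable_vector_functions.
Context {d : measure_display} {T : measurableType d} {R : realType}.
Implicit Types E F : normedModType R[i].

Lemma measurable_simple (V : choiceType) (u : T -> V) (h : V -> R) :
  simple_fun u -> measurable_fun setT (h \o u).
Proof.
by move=> su _ Y mY; rewrite setTI; exact: (simple_preimage (h @^-1` Y) su).
Qed.

Lemma bmeas_simple E (s : T -> E) : simple_fun s -> bmeas s.
Proof. by move=> ss; exists (fun=> s) => // x; exact: cvg_cst. Qed.

Lemma bmeas_cst E (v : E) : bmeas (fun _ : T => v).
Proof. exact: bmeas_simple (simple_cst v). Qed.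

Lemma bmeasD E (f g : T -> E) : bmeas f -> bmeas g -> bmeas (fun x => f x + g x).
Proof.
move=> [s ss sf] [t st tg]; exists (fun n x => s n x + t n x) => [n|x].
  exact: simple_op.
exact: cvgD.
Qed.

Lemma bmeasZ E (a : T -> R[i]^o) (f : T -> E) :
  bmeas a -> bmeas f -> bmeas (fun x => a x *: f x).
Proof.
move=> [s ss sf] [t st tg]; exists (fun n x => s n x *: t n x) => [n|x].
  exact: (simple_op (fun (a : R[i]^o) (v : E) => a *: v)).
exact: cvg_scaler.
Qed.

Lemma bmeasN E (f : T -> E) : bmeas f -> bmeas (fun x => - f x).
Proof.
move=> [s ss sf]; exists (fun n x => - s n x) => [n|x].
  exact: (simple_comp (fun v : E => - v)).
exact: cvgN.
Qed.

Lemma bmeasB E (f g : T -> E) : bmeas f -> bmeas g -> bmeas (fun x => f x - g x).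
Proof. by move=> bf bg; apply: bmeasD => //; exact: bmeasN. Qed.

Lemma bmeas_patch E (A : set T) (f : T -> E) :
  measurable A -> bmeas f -> bmeas (patch (fun=> 0) A f).
Proof.
move=> mA [s ss sf]; exists (fun n => patch (fun=> 0) A (s n)) => [n|x].
  exact: simple_patch.
by rewrite /patch; case: ifP => _; [exact: sf|exact: cvg_cst].
Qed.

Lemma bmeas_bop E F (L : bounded_op E F) (f : T -> E) :
  bmeas f -> bmeas (fun x => L (f x)).
Proof.
move=> [s ss sf]; exists (fun n x => L (s n x)) => [n|x].
  exact: (simple_comp L).
exact: bop_cvg.
Qed.

Lemma bmeas_nrm E (f : T -> E) : bmeas f -> measurable_fun setT (fun x => nrm (f x)).
Proof.
move=> [s ss sf]; apply/measurable_EFinP.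
apply: (emeasurable_fun_cvg (fun n x => (nrm (s n x))%:E)) => [n|x _].
  by apply/measurable_EFinP; exact: measurable_simple.
by apply: cvg_EFin; [exact: nearW|exact: cvg_nrm].
Qed.

End measurable_vector_functions.
Hint Extern 0 (is_true (0 <= nrm _)) => exact: nrm_ge0 : core.

Section L1norm.
Context {d : measure_display} {T : measurableType d} {R : realType}.
Variable P : probability T R.
Implicit Types E F : normedModType R[i].
Local Open Scope ereal_scope.

Lemma L1norm_ge0 E (f : T -> E) : 0 <= L1norm P f.
Proof. by apply: integral_ge0 => x _; rewrite lee_fin. Qed.

Lemma L1normD E (f g : T -> E) : bmeas f -> bmeas g ->
  L1norm P (fun x => f x + g x)%R <= L1norm P f + L1norm P g.
Proof.
move=> bf bg; rewrite /L1norm -ge0_integralD//; first last.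
- by apply/measurable_EFinP; exact: bmeas_nrm.
- by move=> x _; rewrite lee_fin.
- by apply/measurable_EFinP; exact: bmeas_nrm.
- by move=> x _; rewrite lee_fin.
apply: ge0_le_integral => //.
- by move=> x _; rewrite lee_fin.
- by apply/measurable_EFinP/bmeas_nrm/bmeasD.
- by apply: emeasurable_funD; apply/measurable_EFinP; exact: bmeas_nrm.
- by move=> x _; rewrite -EFinD lee_fin nrmD.
Qed.

Lemma L1normN E (f : T -> E) : L1norm P (fun x => - f x)%R = L1norm P f.
Proof. by apply: eq_integral => x _; rewrite nrmN. Qed.

Lemma L1normB E (f g : T -> E) : bmeas f -> bmeas g ->
  L1norm P (fun x => f x - g x)%R <= L1norm P f + L1norm P g.
Proof. by move=> bf bg; rewrite -(L1normN g); apply: L1normD => //; exact: bmeasN. Qed.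

Lemma L1norm_le E F (f : T -> E) (g : T -> F) (c : R) : (0 <= c)%R ->
  bmeas f -> bmeas g -> (forall x, nrm (f x) <= c * nrm (g x))%R ->
  L1norm P f <= c%:E * L1norm P g.
Proof.
move=> c0 bf bg fg; rewrite /L1norm -ge0_integralZl_EFin//; first last.
- by apply/measurable_EFinP; exact: bmeas_nrm.
- by move=> x _; rewrite lee_fin.
apply: ge0_le_integral => //.
- by move=> x _; rewrite lee_fin.
- by apply/measurable_EFinP/bmeas_nrm.
- by apply: emeasurable_funM => //; apply/measurable_EFinP; exact: bmeas_nrm.
- by move=> x _; rewrite -EFinM lee_fin.
Qed.

Lemma L1norm_ae E (f g : T -> E) : {ae P, forall x, f x = g x} ->
  L1norm P f = L1norm P g.
Proof.
by move=> fg; apply: lower_integral_ae => [x|x|]; rewrite ?lee_fin//;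
  move: fg; apply: filterS => x ->.
Qed.

Lemma L1norm_patch_le E (A : set T) (f : T -> E) : measurable A -> bmeas f ->
  L1norm P (patch (fun=> 0%R) A f) <= L1norm P f.
Proof.
move=> mA bf; rewrite -[leRHS]mul1e; apply: L1norm_le => //.
  exact: bmeas_patch.
by move=> x; rewrite mul1r /patch; case: ifP; rewrite // nrm0.
Qed.

Lemma L1norm_patch E (A : set T) (f : T -> E) :
  L1norm P (patch (fun=> 0%R) A f) = \int[P]_(x in A) (nrm (f x))%:E.
Proof.
rewrite integral_mkcond; apply: eq_integral => x _.
by rewrite /patch; case: ifP => //; rewrite nrm0.
Qed.

(** The function is set to 0 on a measurable null set containing the points of
divergence. All the quantities attached to f ignore this change, which allows the
rest of the theory to deal with everywhere measurable functions only. *)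
Lemma strongly_measurable_bmeas E (f : T -> E) : strongly_measurable P f ->
  exists2 f', bmeas f' & {ae P, forall x, f x = f' x}.
Proof.
move=> [s [ss [N [mN PN sfN]]]].
exists (patch (fun=> 0)%R (~` N) f).
  exists (fun n => patch (fun=> 0)%R (~` N) (s n)) => [n|x].
    by apply: simple_patch; [exact: measurableC|exact: ss].
  rewrite /patch; case: ifPn => [|_]; last exact: cvg_cst.
  by rewrite inE => /= Nx; apply: contrapT => h; apply: Nx; exact: sfN.
exists N; split => // x /=; apply: contra_notP => Nx.
by rewrite /patch mem_set.
Qed.

Lemma bmeas_strongly_measurable E (f : T -> E) : bmeas f -> strongly_measurable P f.
Proof. by move=> [s ss sf]; exists s; split => //; exact: aeW. Qed.

Lemma strongly_measurable_ae E (f g : T -> E) : {ae P, forall x, f x = g x} ->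
  strongly_measurable P f -> strongly_measurable P g.
Proof.
move=> fg [s [ss sf]]; exists s; split => //.
by apply: filterS2 fg sf => x ->.
Qed.

(** Truncating the approximating simple functions at twice the norm of the limit
makes dominated convergence applicable. *)
Lemma bmeas_L1_approx E (f : T -> E) : bmeas f -> L1norm P f < +oo ->
  exists2 s : nat -> T -> E, (forall n, simple_fun (s n)) &
    L1norm P (fun x => f x - s n x)%R @[n --> \oo] --> 0.
Proof.
move=> bf fi; have [s ss sf] := bf.
pose A n := [set x | nrm (s n x) <= 2 * nrm (f x)]%R.
have mA n : measurable (A n).
  rewrite -[A n]setTI; apply: measurable_fun_le => //.
    exact: measurable_simple.
  by apply: measurable_funM => //; exact: bmeas_nrm.
pose t n := patch (fun=> 0)%R (A n) (s n).
have st n : simple_fun (t n) by exact: simple_patch.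
exists t => //.
have tle n x : (nrm (t n x) <= 2 * nrm (f x))%R.
  rewrite /t /patch; case: ifPn => [/[!inE]//|_]; rewrite nrm0.
  by rewrite mulr_ge0.
have tf x : t n x @[n --> \oo] --> f x.
  have [f0|f0] := eqVneq (f x) 0%R.
    have -> : t^~ x = fun=> 0%R.
      apply/funext => n; apply: nrm_eq0; apply/eqP; rewrite eq_le nrm_ge0 andbT.
      by rewrite (le_trans (tle _ _))// f0 nrm0 mulr0.
    by rewrite f0; exact: cvg_cst.
  have f0' : (0 < nrm (f x))%R.
    by rewrite lt_neqAle nrm_ge0 andbT eq_sym; apply: contra_neq f0; exact: nrm_eq0.
  apply: cvg_trans (sf x); apply: near_eq_cvg.
  have /cvg_nrmP/cvgrPdist_lt/(_ _ f0') := sf x.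
  apply: filterS => n; rewrite sub0r normrN ger0_norm// => snf.
  rewrite /t /patch mem_set// /A /= (le_trans (nrmB_le _ (f x)))//.
  by rewrite mulr_natl mulr2n lerD2l ltW.
have m n : measurable_fun setT (fun x => (nrm (f x - t n x))%:E).
  by apply/measurable_EFinP/bmeas_nrm/bmeasB => //; exact: bmeas_simple.
have := @dominated_cvg _ _ _ P setT measurableT
  (fun n x => (nrm (f x - t n x))%:E) (cst 0) (fun x => (3 * nrm (f x))%:E).
rewrite integral0; apply => //.
- move=> x _ /=; apply: cvg_EFin; first exact: nearW.
  have /cvg_nrmP tfx := tf x.
  apply: cvg_trans tfx; apply: near_eq_cvg; apply: nearW => n /=.
  by rewrite nrm_distC.
- apply/integrableP; split.
    by apply/measurable_EFinP; apply: measurable_funM => //; exact: bmeas_nrm.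
  apply: (@le_lt_trans _ _ (3%:E * L1norm P f)); last by rewrite lte_mul_pinfty.
  rewrite /L1norm -ge0_integralZl_EFin//.
  + rewrite le_eqVlt; apply/predU1P; left; apply: eq_integral => x _.
    by rewrite gee0_abs ?EFinM// lee_fin mulr_ge0.
  + by move=> x _; rewrite lee_fin.
  + by apply/measurable_EFinP; exact: bmeas_nrm.
- move=> n x _; rewrite gee0_abs ?lee_fin// (le_trans (nrmB _ _))//.
  by rewrite -natr1 mulrDl mul1r addrC lerD2r.
Qed.

End L1norm.

(** * The Bochner integral *)

Section bochner.
Context {d : measure_display} {T : measurableType d} {R : realType}.
Variable P : probability T R.
Implicit Types E F : normedModType R[i].

Lemma fin_add_measure : fin_add (fun A : set T => (fine (P A))%:C : R[i]).
Proof.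
split; first by rewrite measure0.
move=> A B mA mB AB; rewrite -rmorphD/= measureU//.
by rewrite fineD// fin_num_measure.
Qed.

Lemma simple_integral_comp E (V : choiceType) (g : V -> E) (u : T -> V) :
  simple_fun u -> simple_integral P (g \o u) =
  \sum_(v <- fset_set (range u)) (fine (P (u @^-1` [set v])))%:C *: g v.
Proof.
move=> su; rewrite /simple_integral.
rewrite (simple_sum_comp (B := fun (w : E) (c : R[i]) => c *: w) fin_add_measure)//.
- by rewrite fsbig_finite//; case: su.
- by move=> w; rewrite scale0r.
- by move=> w a b; rewrite scalerDl.
Qed.

Lemma simple_integralD E (s t : T -> E) : simple_fun s -> simple_fun t ->
  simple_integral P (fun x => s x + t x) = simple_integral P s + simple_integral P t.
Proof.
move=> ss st; have su := simple_pair ss st.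
rewrite (simple_integral_comp (fun z => z.1 + z.2) su).
rewrite (simple_integral_comp fst su) (simple_integral_comp snd su) -big_split/=.
by apply: eq_bigr => z _; rewrite scalerDr.
Qed.

Lemma simple_integral_bop E F (L : bounded_op E F) (s : T -> E) : simple_fun s ->
  simple_integral P (fun x => L (s x)) = L (simple_integral P s).
Proof.
move=> ss; rewrite (simple_integral_comp L ss) (simple_integral_comp id ss) bop_sum.
by apply: eq_bigr => z _; rewrite bop_linearZ.
Qed.

Lemma simple_integralZ E (a : R[i]) (s : T -> E) : simple_fun s ->
  simple_integral P (fun x => a *: s x) = a *: simple_integral P s.
Proof.
move=> ss; rewrite (simple_integral_comp (fun v => a *: v) ss) (simple_integral_comp id ss).
by rewrite scaler_sumr; apply: eq_bigr => z _; rewrite !scalerA mulrC.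
Qed.

Lemma integral_simple (V : choiceType) (u : T -> V) (h : V -> R) :
  simple_fun u -> (forall v, 0 <= h v) ->
  (\int[P]_x (h (u x))%:E)%E =
  (\sum_(v <- fset_set (range u)) fine (P (u @^-1` [set v])) * h v)%:E.
Proof.
move=> su h0; have [fu mu] := su.
transitivity (\int[P]_x (\sum_(v <- fset_set (range u))
    ((h v)%:E * (\1_(u @^-1` [set v]) x)%:E)))%E.
  apply: eq_integral => x _.
  rewrite (big_fsetD1 (u x))/=; last by rewrite in_fset_set// mem_set//; exists x.
  rewrite indicE mem_set// mule1 big_seq big1 ?adde0// => v.
  rewrite in_fsetD1 => /andP[vux _]; rewrite indicE memNset ?mule0//= => uxv.
  by rewrite uxv eqxx in vux.
rewrite ge0_integral_sum//; first last.
- by move=> v x _; rewrite mule_ge0 ?lee_fin.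
- by move=> v; apply: emeasurable_funM => //; apply/measurable_EFinP.
rewrite -sumEFin; apply: eq_bigr => v _.
rewrite ge0_integralZl_EFin//; last first.
  by apply/measurable_EFinP.
rewrite integral_indic// setIT EFinM muleC fineK//.
by rewrite fin_num_measure.
Qed.

Lemma simple_integral_L1norm E (s : T -> E) : simple_fun s ->
  ((nrm (simple_integral P s))%:E <= L1norm P s)%E.
Proof.
move=> ss; rewrite /L1norm (integral_simple (h := @nrm R E))//.
rewrite (simple_integral_comp id ss) lee_fin (le_trans (nrm_sum _ _ _))//.
apply: ler_sum => v _; rewrite nrmZ nrm_real ger0_norm// fine_ge0//.
Qed.

Lemma simple_integralB E (s t : T -> E) : simple_fun s -> simple_fun t ->
  simple_integral P (fun x => s x - t x) = simple_integral P s - simple_integral P t.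
Proof.
move=> ss st; rewrite simple_integralD//; last exact: (simple_comp (fun v : E => - v)).
congr (_ + _); rewrite -scaleN1r -simple_integralZ//; congr (simple_integral P _).
by apply/funext => x; rewrite scaleN1r.
Qed.

Lemma cvge0_real (a : nat -> \bar R) : (forall n, (0 <= a n)%E) ->
  a n @[n --> \oo] --> 0%E -> forall e : R, 0 < e ->
  exists N, forall n, (N <= n)%N -> (a n < e%:E)%E.
Proof.
move=> a0 /fine_cvgP[afin /cvgrPdist_lt ac] e e0.
have := filterI afin (ac _ e0) => -[N _ hN]; exists N => n Nn.
have /= [an] := hN n Nn.
rewrite sub0r normrN ger0_norm ?fine_ge0// => h.
by rewrite -(fineK an) lte_fin.
Qed.

Lemma L1norm_squeeze E (h : nat -> T -> E) (a : nat -> \bar R) :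
  (forall n, (L1norm P (h n) <= a n)%E) -> a n @[n --> \oo] --> 0%E ->
  L1norm P (h n) @[n --> \oo] --> 0%E.
Proof.
move=> ha a0; apply: (@squeeze_cvge _ _ _ _ (cst 0%E) _ a) => //.
  by apply: nearW => n; rewrite L1norm_ge0 ha.
exact: cvg_cst.
Qed.

Lemma is_bochnerD E (f g : T -> E) v w : bmeas f -> bmeas g ->
  is_bochner_integral P f v -> is_bochner_integral P g w ->
  is_bochner_integral P (fun x => f x + g x) (v + w).
Proof.
move=> bf bg [_ [s [ss sf sv]]] [_ [t [st tg tw]]].
split; first exact/bmeas_strongly_measurable/bmeasD.
exists (fun n x => s n x + t n x); split => [n||].
- exact: simple_op.
- apply: (@L1norm_squeeze _ (fun n x => f x + g x - (s n x + t n x))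
    (fun n => L1norm P (fun x => (f x - s n x)%R) + L1norm P (fun x => (g x - t n x)%R))%E).
    move=> n; rewrite (_ : L1norm P _ = L1norm P (fun x => (f x - s n x) + (g x - t n x))).
      by apply: L1normD; apply: bmeasB => //; exact: bmeas_simple.
    by apply: eq_integral => x _; rewrite opprD addrACA.
  by rewrite -[X in _ --> X](adde0 0%E); apply: cvgeD.
- under eq_fun do rewrite simple_integralD//.
  exact: cvgD.
Qed.

Lemma is_bochner_bop E F (L : bounded_op E F) (f : T -> E) v : bmeas f ->
  is_bochner_integral P f v -> is_bochner_integral P (fun x => L (f x)) (L v).
Proof.
move=> bf [_ [s [ss sf sv]]].
split; first exact/bmeas_strongly_measurable/bmeas_bop.
exists (fun n x => L (s n x)); split => [n||].
- exact: (simple_comp L).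
- apply: (@L1norm_squeeze _ (fun n x => L (f x) - L (s n x))
    (fun n => (opnorm L)%:E * L1norm P (fun x => (f x - s n x)%R))%E).
    move=> n; apply: L1norm_le.
    + exact: opnorm_ge0.
    + by apply: bmeasB; apply: bmeas_bop => //; exact: bmeas_simple.
    + by apply: bmeasB => //; exact: bmeas_simple.
    + by move=> x; rewrite -bop_linearB bop_nrm_le.
  by rewrite -[X in _ --> X](mule0 (opnorm L)%:E); apply: cvgeZl.
- under eq_fun do rewrite simple_integral_bop//.
  exact: bop_cvg.
Qed.

Lemma scale_op_exists E (a : R[i]) : exists L : bounded_op E E, forall x, L x = a *: x.
Proof.
apply: (@mk_bop _ _ _ _ (nrm a)) => [b x y|x]; last by rewrite nrmZ.
by rewrite scalerDr !scalerA mulrC.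
Qed.

Lemma is_bochnerZ E (a : R[i]) (f : T -> E) v : bmeas f ->
  is_bochner_integral P f v -> is_bochner_integral P (fun x => a *: f x) (a *: v).
Proof.
move=> bf fv; have [L La] := scale_op_exists E a.
have := is_bochner_bop L bf fv; rewrite La.
by rewrite (_ : (fun x => L (f x)) = fun x => a *: f x)//; apply/funext => x; rewrite La.
Qed.

Lemma is_bochnerB E (f g : T -> E) v w : bmeas f -> bmeas g ->
  is_bochner_integral P f v -> is_bochner_integral P g w ->
  is_bochner_integral P (fun x => f x - g x) (v - w).
Proof.
move=> bf bg fv gw; have := is_bochnerZ (-1) bg gw; rewrite scaleN1r => gw'.
have -> : (fun x => f x - g x) = (fun x => f x + -1 *: g x).
  by apply/funext => x; rewrite scaleN1r.
by apply: is_bochnerD => //; under eq_fun do rewrite scaleN1r; exact: bmeasN.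
Qed.

Lemma is_bochner_simple E (s : T -> E) : simple_fun s ->
  is_bochner_integral P s (simple_integral P s).
Proof.
move=> ss; split; first exact/bmeas_strongly_measurable/bmeas_simple.
exists (fun=> s); split => //; last exact: cvg_cst.
under eq_fun do under eq_integral do rewrite subrr nrm0.
by under eq_fun do rewrite integral0; exact: cvg_cst.
Qed.

(** The bound passes from simple functions to the limit; applied to a difference it
gives the uniqueness of the integral. *)
Lemma is_bochner_nrm E (f : T -> E) v : bmeas f ->
  is_bochner_integral P f v -> ((nrm v)%:E <= L1norm P f)%E.
Proof.
move=> bf [_ [s [ss sf sv]]].
apply/lee_addgt0Pr => e e0.
have e20 : 0 < e / 2 by rewrite divr_gt0.
have [N hN] := cvge0_real (fun n => L1norm_ge0 P (fun x => f x - s n x)) sf e20.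
have /cvg_nrmP/cvgrPdist_lt/(_ _ e20)[M _ hM] := sv.
set n := maxn N M.
have := hM n (leq_maxr _ _); rewrite /= sub0r normrN ger0_norm// => h1.
have h2 := hN n (leq_maxl _ _).
apply: (@le_trans _ _ ((nrm (simple_integral P (s n)))%:E + (e / 2)%:E)%E).
  rewrite -EFinD lee_fin (le_trans (nrmB_le _ (simple_integral P (s n))))// lerD2l.
  by rewrite nrm_distC ltW.
rewrite {2}(splitr e) EFinD addeA leeD2r//.
apply: (le_trans (simple_integral_L1norm (ss n))).
apply: (@le_trans _ _ (L1norm P f + L1norm P (fun x => (f x - s n x)%R))%E).
  rewrite (_ : L1norm P (s n) = L1norm P (fun x => f x - (f x - s n x))).
    apply: L1normB => //; apply: bmeasB => //; exact: bmeas_simple.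
  by apply: eq_integral => x _; rewrite subKr.
by rewrite leeD2l// ltW.
Qed.

Lemma is_bochner_unique E (f : T -> E) v w : bmeas f ->
  is_bochner_integral P f v -> is_bochner_integral P f w -> v = w.
Proof.
move=> bf fv fw; have := is_bochner_nrm (bmeasB bf bf) (is_bochnerB bf bf fv fw).
rewrite /L1norm; under eq_integral do rewrite subrr nrm0.
rewrite integral0 lee_fin => vw; apply/eqP; rewrite -subr_eq0; apply/eqP.
by apply: nrm_eq0; apply/eqP; rewrite eq_le vw nrm_ge0.
Qed.

Lemma is_bochner_exists E (f : T -> E) : seq_complete E -> bmeas f ->
  (L1norm P f < +oo)%E -> exists v, is_bochner_integral P f v.
Proof.
move=> cE bf fi; have [s ss sf] := bmeas_L1_approx bf fi.
suff [v sv] : exists v : E, simple_integral P (s n) @[n --> \oo] --> v.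
  by exists v; split; [exact: bmeas_strongly_measurable|exists s].
apply: cE => e e0.
have e20 : 0 < e / 2 by rewrite divr_gt0.
have [N hN] := cvge0_real (fun n => L1norm_ge0 P (fun x => f x - s n x)) sf e20.
exists N => m n Nm Nn; rewrite -simple_integralB// -lte_fin.
have sd : simple_fun (fun x => s m x - s n x) by exact: (simple_op (fun a b : E => a - b)).
apply: le_lt_trans (simple_integral_L1norm sd) _.
apply: (@le_lt_trans _ _ (L1norm P (fun x => (f x - s n x)%R) + L1norm P (fun x => (f x - s m x)%R))%E).
  rewrite (_ : L1norm P _ = L1norm P (fun x => (f x - s n x) - (f x - s m x))).
    by apply: L1normB; apply: bmeasB => //; exact: bmeas_simple.
  apply: eq_integral => x _; congr (nrm _)%:E.
  by rewrite opprB [RHS]addrC subrKA.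
by rewrite (splitr e) EFinD lteD// hN.
Qed.

Lemma is_bochner_ae E (f g : T -> E) v : {ae P, forall x, f x = g x} ->
  is_bochner_integral P f v -> is_bochner_integral P g v.
Proof.
move=> fg [mf [s [ss sf sv]]]; split; first exact: strongly_measurable_ae fg mf.
exists s; split => //; apply: cvg_trans sf; apply: near_eq_cvg; apply: nearW => n.
apply: lower_integral_ae => [x|x|]; rewrite ?lee_fin//.
by apply: filterS fg => x ->.
Qed.

(** In a complete space these functions have a Bochner integral over every
measurable set. *)
Definition bint E (f : T -> E) : Prop := bmeas f /\ (L1norm P f < +oo)%E.

Lemma bint_patch E (A : set T) (f : T -> E) : measurable A -> bint f ->
  bint (patch (fun=> 0) A f).
Proof.
move=> mA [bf fi]; split; first exact: bmeas_patch.
exact: le_lt_trans (L1norm_patch_le _ mA bf) fi.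
Qed.

Lemma bintD E (f g : T -> E) : bint f -> bint g -> bint (fun x => f x + g x).
Proof.
move=> [bf fi] [bg gi]; split; first exact: bmeasD.
by apply: (le_lt_trans (L1normD _ bf bg)); exact: lte_add_pinfty.
Qed.

Lemma bintZ E (a : R[i]) (f : T -> E) : bint f -> bint (fun x => a *: f x).
Proof.
move=> [bf fi]; have ba : bmeas (fun x => a *: f x).
  by apply: (@bmeasZ _ _ _ _ (fun=> a)) => //; exact: bmeas_cst.
split=> //; apply: (@le_lt_trans _ _ ((nrm a)%:E * L1norm P f)%E).
  by apply: L1norm_le => // x; rewrite nrmZ.
by rewrite lte_mul_pinfty// lee_fin.
Qed.

Lemma bint_bop E F (L : bounded_op E F) (f : T -> E) : bint f -> bint (fun x => L (f x)).
Proof.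
move=> [bf fi]; have bL := bmeas_bop L bf.
split=> //; apply: (@le_lt_trans _ _ ((opnorm L)%:E * L1norm P f)%E).
  by apply: L1norm_le => // [|x]; [exact: opnorm_ge0|exact: bop_nrm_le].
by rewrite lte_mul_pinfty// lee_fin opnorm_ge0.
Qed.

Lemma bochner_integralE E (A : set T) (f : T -> E) v :
  measurable A -> bmeas f -> is_bochner_integral P (patch (fun=> 0) A f) v ->
  bochner_integral P A f = v.
Proof.
move=> mA bf fv; rewrite /bochner_integral; case: xgetP => [w _ fw|/(_ v)//].
exact: (is_bochner_unique (bmeas_patch mA bf) fw fv).
Qed.

Lemma is_bochner_integralP E (A : set T) (f : T -> E) : seq_complete E ->
  measurable A -> bint f ->
  is_bochner_integral P (patch (fun=> 0) A f) (bochner_integral P A f).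
Proof.
move=> cE mA fi; have [bp pi] := bint_patch mA fi.
have [v fv] := is_bochner_exists cE bp pi.
by rewrite (bochner_integralE mA (proj1 fi) fv).
Qed.

Lemma bochner_integral_ae E (A : set T) (f g : T -> E) :
  {ae P, forall x, f x = g x} -> bochner_integral P A f = bochner_integral P A g.
Proof.
move=> fg; rewrite /bochner_integral; congr (xget _ _); apply/seteqP.
have pfg : {ae P, forall x, patch (fun=> 0) A f x = patch (fun=> 0) A g x}.
  by apply: filterS fg => x fgx; rewrite /patch; case: ifP.
split=> v /=; apply: is_bochner_ae => //.
by apply: filterS pfg => x ->.
Qed.

End bochner.

(** * Vector measures, variation and integration of bounded functions *)

(** The partitions over which the variation is a supremum. *)
Definition npart (d : measure_display) (T : measurableType d) (A : set T) (n : nat)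
    (F : (set T)^nat) : Prop :=
  [/\ forall i, measurable (F i), trivIset `I_n F & \bigcup_(i in `I_n) F i = A].

Section partitions.
Context {d : measure_display} {T : measurableType d}.

Lemma npart_setIl (A B : set T) n F : measurable B -> npart A n F ->
  npart (B `&` A) n (fun i => B `&` F i).
Proof.
move=> mB [mF tF FA]; split => [i||]; first exact: measurableI.
- exact: trivIset_setIl.
- by rewrite -FA setI_bigcupr.
Qed.

Lemma npart_simple (V : choiceType) (u : T -> V) : simple_fun u ->
  exists n (c : nat -> V), [/\ npart setT n (fun i => u @^-1` [set c i]) &
    forall (M : nmodType) (h : V -> M),
      \sum_(v <- fset_set (range u)) h v = \sum_(0 <= i < n) h (c i)].
Proof.
move=> su; have [fu mu] := su.
pose l : seq V := fset_set (range u).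
pose c i := nth (u point) l i.
exists (size l), c; split; last by move=> M h; rewrite (big_nth (u point)).
have ul : uniq l by exact: fset_uniq.
split => [i||]; first exact: mu.
- move=> i j /= il jl [x [uxi uxj]]; apply/eqP.
  by rewrite -(nth_uniq (u point) il jl ul); apply/eqP; exact: etrans (esym uxi) uxj.
- apply/seteqP; split => // x _.
  have uxl : u x \in l by rewrite /l in_fset_set// mem_set//; exists x.
  by exists (index (u x) l); rewrite /= ?index_mem// /c nth_index.
Qed.

Lemma fin_add_npart (M : zmodType) (m : set T -> M) (A : set T) n F :
  fin_add m -> npart A n F -> m A = \sum_(0 <= i < n) m (F i).
Proof.
move=> [m0 mD]; elim: n A => [|n IH] A [mF tF <-].
  by rewrite big_geq// (_ : \bigcup_(_ in _) _ = set0)//; apply/seteqP; split=> x // [].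
rewrite big_nat_recr//= -(IH (\bigcup_(i in `I_n) F i)); last first.
  split=> //; apply: sub_trivIset tF => i /= /ltnW.
  by rewrite -ltnS.
rewrite (_ : \bigcup_(i in `I_n.+1) F i = (\bigcup_(i in `I_n) F i) `|` F n); last first.
  by rewrite !bigcup_mkord big_ord_recr.
apply: mD => //; first exact: bigcup_measurable.
apply/seteqP; split=> x //= -[[i /= iN Fi] Fn].
have : i = n by apply: tF => //=; [rewrite ltnS ltnW|exists x].
by move=> iE; rewrite iE ltnn in iN.
Qed.

Lemma npartU (A B : set T) n m F G : A `&` B = set0 ->
  npart A n F -> npart B m G ->
  npart (A `|` B) (n + m) (fun i => if (i < n)%N then F i else G (i - n)%N).
Proof.
move=> AB [mF tF FA] [mG tG GB]; split => [i||].
- by case: ifP.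
- move=> i j /= inm jnm.
  have FAx k x : (k < n)%N -> F k x -> A x by move=> kn Fk; rewrite -FA; exists k.
  have GBx k x : (k < m)%N -> G k x -> B x by move=> km Gk; rewrite -GB; exists k.
  have dis x : A x -> B x -> False by move=> Ax Bx; have : (A `&` B) x by []; rewrite AB.
  have lnm k : ~~ (k < n)%N -> (k < n + m)%N -> (k - n < m)%N.
    by rewrite -leqNgt => nk knm; rewrite ltn_subLR.
  case: ifPn => [iN|iN]; case: ifPn => [jN|jN] [x [h1 h2]].
  + by apply: tF => //; exists x.
  + by exfalso; apply: (dis x); [exact: FAx h1|apply: GBx h2; exact: lnm].
  + by exfalso; apply: (dis x); [exact: FAx h2|apply: GBx h1; exact: lnm].
  + have : (i - n = j - n)%N by apply: tG; [exact: lnm|exact: lnm|exists x].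
    rewrite -!leqNgt in iN jN.
    by move=> /(congr1 (addn^~ n)); rewrite !subnK.
- apply/seteqP; split => [x [i /= inm]|x [|]].
  + case: ifPn => [iN Fi|iN Gi]; first by left; rewrite -FA; exists i.
    by right; rewrite -GB; exists (i - n)%N => //=; rewrite ltn_subLR// leqNgt.
  + rewrite -FA => -[i /= iN Fi]; exists i => /=; first by rewrite ltn_addr.
    by rewrite iN.
  + rewrite -GB => -[i /= iN Gi]; exists (n + i)%N => /=; first by rewrite ltn_add2l.
    by rewrite ltnNge leq_addr/= addKn.
Qed.

End partitions.

Section vector_measures.
Context {d : measure_display} {T : measurableType d} {R : realType}.
Implicit Types E : normedModType R[i].

Lemma variation_ge E (mu : set T -> E) A n F : npart A n F ->
  ((\sum_(0 <= i < n) nrm (mu (F i)))%:E <= variation mu A)%E.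
Proof. by move=> [mF tF FA]; apply: ereal_sup_ubound; exists n, F. Qed.

Lemma variation_le E (mu : set T -> E) A (c : \bar R) :
  (forall n F, npart A n F -> ((\sum_(0 <= i < n) nrm (mu (F i)))%:E <= c)%E) ->
  (variation mu A <= c)%E.
Proof.
by move=> h; apply: ub_ereal_sup => _ [n [F [mF tF FA ->]]]; exact: h.
Qed.

Lemma npart1 (A : set T) : measurable A -> npart A 1 (fun=> A).
Proof.
move=> mA; split => //; first by move=> [|i] [|j].
by apply/seteqP; split=> [x [i _]|x Ax]//; exists 0.
Qed.

Lemma nrm_le_variation E (mu : set T -> E) A : measurable A ->
  ((nrm (mu A))%:E <= variation mu A)%E.
Proof.
by move=> mA; have := variation_ge mu (npart1 mA); rewrite big_nat1.
Qed.

Lemma variation_ge0 E (mu : set T -> E) A : measurable A -> (0 <= variation mu A)%E.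
Proof.
by move=> mA; apply: le_trans (nrm_le_variation mu mA); rewrite lee_fin.
Qed.

(** Partitions of two disjoint sets concatenate to a partition of the union. This
superadditivity bounds the integral of a maximum of densities. *)
Lemma variationU E (mu : set T -> E) A B : measurable A -> measurable B ->
  A `&` B = set0 -> (variation mu A + variation mu B <= variation mu (A `|` B))%E.
Proof.
move=> mA mB AB.
have key n F m G : npart A n F -> npart B m G ->
  ((\sum_(0 <= i < n) nrm (mu (F i)) + \sum_(0 <= i < m) nrm (mu (G i)))%:E
    <= variation mu (A `|` B))%E.
  move=> pF pG; apply: le_trans (variation_ge mu (npartU AB pF pG)).
  rewrite lee_fin (big_cat_nat (n := n) (p := n + m))//= ?leq_addr//.
  apply: lerD.
    by rewrite le_eqVlt; apply/predU1P; left; apply: eq_big_nat => i /andP[_ ->].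
  rewrite -{1}(add0n n) big_addn addKn.
  rewrite le_eqVlt; apply/predU1P; left; apply: eq_big_nat => i _.
  by rewrite ltnNge leq_addl/= addnK.
have := variation_ge0 mu (measurableU _ _ mA mB).
case E1 : (variation mu (A `|` B)) => [r| |] r0 //; last by rewrite leey.
have bB m G : npart B m G ->
    (variation mu A <= (r - \sum_(0 <= i < m) nrm (mu (G i)))%:E)%E.
  move=> pG; apply: variation_le => n F pF.
  by have := key _ _ _ _ pF pG; rewrite E1 !lee_fin lerBrDr.
have : (variation mu A < +oo)%E by apply: le_lt_trans (bB _ _ (npart1 mB)) _; rewrite ltry.
have := variation_ge0 mu mA.
case E2 : (variation mu A) bB => [a| |] bB a0 // _.
suff : (variation mu B <= (r - a)%:E)%E.
  by move=> /(leeD2l a%:E); rewrite -EFinD (addrC a) subrK.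
apply: variation_le => m G /bB; rewrite !lee_fin => h.
by rewrite lerBrDl -lerBrDr.
Qed.

Lemma countably_additive_fin_add E (mu : set T -> E) :
  countably_additive mu -> fin_add mu.
Proof.
move=> ca.
have mu0 : mu set0 = 0.
  (* The partial sums for the constant sequence of empty sets converge, so that
     their increments tend to 0. *)
  have t0 : trivIset setT (fun _ : nat => set0 : set T) by exact: trivIset_set0.
  have := ca (fun=> set0) (fun=> measurable0) t0.
  rewrite bigcup0// => c1.
  have c2 : \sum_(0 <= i < n.+1) mu set0 @[n --> \oo] --> mu set0.
    by rewrite (cvg_shiftS (fun n => \sum_(0 <= i < n) mu set0)).
  have : (\sum_(0 <= i < n.+1) mu set0 - \sum_(0 <= i < n) mu set0) @[n --> \oo] --> mu set0 - mu set0.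
    exact: cvgB.
  under eq_fun do rewrite big_nat_recr//= addrAC subrr add0r.
  rewrite subrr => c3; apply: (nrm_lim_unique _ c3); exact: cvg_cst.
split=> // A B mA mB AB.
have mF n : measurable (bigcup2 A B n) by move: n => [|[|n]]; rewrite /bigcup2/=.
have := ca (bigcup2 A B) mF; rewrite -trivIset_bigcup2 => /(_ AB).
rewrite bigcup2E => c1; apply: (nrm_lim_unique c1).
have hE : {near \oo, (fun _ : nat => mu A + mu B) =1
    (fun n => \sum_(0 <= i < n) mu (bigcup2 A B i))}.
  exists 2 => // n /= n2.
  rewrite (big_cat_nat (n := 2))//= big_nat_recr//= big_nat1 /bigcup2/=.
  rewrite big_nat_cond big1 ?addr0// => i /andP[/andP[i2 _] _].
  by case: i i2 => [|[|i]].
by apply: cvg_trans (near_eq_cvg hE) _; exact: cvg_cst.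
Qed.

Section integration.
Variables (E : normedModType R[i]) (mu : set T -> E).
Hypothesis mu_add : fin_add mu.

Lemma simple_integral_vm_comp (V : choiceType) (g : V -> R[i]) (u : T -> V) :
  simple_fun u -> simple_integral_vm mu (g \o u) =
  \sum_(v <- fset_set (range u)) g v *: mu (u @^-1` [set v]).
Proof.
move=> su; rewrite /simple_integral_vm.
rewrite (simple_sum_comp (B := fun (a : R[i]) (w : E) => a *: w) mu_add)//.
- by rewrite fsbig_finite//; case: su.
- by move=> w; rewrite scaler0.
- by move=> w a b; rewrite scalerDr.
Qed.

Lemma simple_integral_vmB (s t : T -> R[i]) : simple_fun s -> simple_fun t ->
  simple_integral_vm mu (fun x => s x - t x) =
  simple_integral_vm mu s - simple_integral_vm mu t.
Proof.
move=> ss st; have su := simple_pair ss st.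
rewrite (simple_integral_vm_comp (fun z => z.1 - z.2) su).
rewrite (simple_integral_vm_comp fst su) (simple_integral_vm_comp snd su) -sumrB/=.
by apply: eq_bigr => z _; rewrite scalerBl.
Qed.

Lemma simple_integral_vm_nrm (s : T -> R[i]) (c V : R) : simple_fun s ->
  0 <= c -> (forall x, nrm (s x) <= c) -> (variation mu setT <= V%:E)%E ->
  nrm (simple_integral_vm mu s) <= c * V.
Proof.
move=> ss c0 sc muV; rewrite (simple_integral_vm_comp id ss).
have [n [a [pn sumE]]] := npart_simple ss.
rewrite sumE (le_trans (nrm_sum _ _ _))//.
apply: (@le_trans _ _ (c * \sum_(0 <= i < n) nrm (mu (s @^-1` [set a i])))).
  rewrite big_distrr/=; apply: ler_sum => i _; rewrite nrmZ.
  have [[x /= sx]|/forallNP h] := pselect (exists x, (s @^-1` [set a i]) x).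
    by rewrite ler_wpM2r// -sx.
  rewrite (_ : _ @^-1` _ = set0) ?(proj1 mu_add) ?nrm0 ?mulr0//.
  by apply/seteqP; split=> x // /h.
rewrite ler_wpM2l// -lee_fin; apply: le_trans muV; exact: variation_ge pn.
Qed.

(** Two uniform approximations of phi are uniformly close, and simple integrals
are bounded by the sup norm times the total variation. *)
Lemma is_integral_vm_unique (V : R) (phi : T -> R[i]) v w :
  (variation mu setT <= V%:E)%E ->
  is_integral_vm mu phi v -> is_integral_vm mu phi w -> v = w.
Proof.
move=> muV [s [ss sp sv]] [t [st tp tw]].
have V0 : 0 <= V by rewrite -lee_fin; apply: le_trans muV; exact: variation_ge0.
apply/eqP; rewrite -subr_eq0; apply/eqP/nrm_eq0/eqP; rewrite eq_le nrm_ge0 andbT.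
apply/ler_addgt0Pr => e e0; rewrite add0r.
have : simple_integral_vm mu (s n) - simple_integral_vm mu (t n) @[n --> \oo] --> v - w.
  exact: cvgB.
move=> /cvgn_le_nrm; apply.
have V1 : 0 < V + 1 by rewrite ltr_wpDl.
have e'0 : 0 < e / (V + 1) / 2 by rewrite !divr_gt0.
apply: filterS2 (sp _ e'0) (tp _ e'0) => n h1 h2.
rewrite -simple_integral_vmB//.
have sd : simple_fun (fun x => s n x - t n x) by exact: (simple_op (fun a b : R[i] => a - b)).
apply: (le_trans (simple_integral_vm_nrm sd (c := e / (V + 1)) _ _ muV)).
- by rewrite ltW// divr_gt0.
- move=> x; rewrite (le_trans (nrm_triangle (phi x) _ _))// (splitr (e / _)).
  by rewrite lerD// ltW// nrm_distC.
- by rewrite mulrAC ler_pdivrMr// ler_pM2l// lerDl.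
Qed.

Lemma is_integral_vm_exists (V : R) (phi : T -> R[i]) (s : nat -> T -> R[i]) :
  seq_complete E -> (variation mu setT <= V%:E)%E ->
  (forall n, simple_fun (s n)) ->
  (forall e : R, 0 < e -> \forall n \near \oo, forall x, nrm (phi x - s n x) < e) ->
  exists v, is_integral_vm mu phi v.
Proof.
move=> cE muV ss sp.
have V0 : 0 <= V by rewrite -lee_fin; apply: le_trans muV; exact: variation_ge0.
suff [v sv] : exists v : E, simple_integral_vm mu (s n) @[n --> \oo] --> v.
  by exists v; exists s.
apply: cE => e e0.
have V1 : 0 < V + 1 by rewrite ltr_wpDl.
have e'0 : 0 < e / (V + 1) / 2 by rewrite !divr_gt0.
have [N _ hN] := sp _ e'0; exists N => m n Nm Nn.
rewrite -simple_integral_vmB//.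
have sd : simple_fun (fun x => s m x - s n x) by exact: (simple_op (fun a b : R[i] => a - b)).
apply: (le_lt_trans (simple_integral_vm_nrm sd (c := e / (V + 1)) _ _ muV)).
- by rewrite ltW// divr_gt0.
- move=> x; rewrite (le_trans (nrm_triangle (phi x) _ _))// (splitr (e / _)).
  have h1 := hN _ Nm x; have h2 := hN _ Nn x.
  by rewrite lerD// ltW// nrm_distC.
- by rewrite mulrAC ltr_pdivrMr// ltr_pM2l// ltrDl.
Qed.

End integration.

Lemma integral_vmE E (mu : set T -> E) (phi : T -> R[i]) v : bv_measures mu ->
  is_integral_vm mu phi v -> integral_vm mu phi = v.
Proof.
move=> [ca bv] pv; rewrite /integral_vm; case: xgetP => [w _ pw|/(_ v)//].
have bvf : variation mu setT \is a fin_num.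
  by rewrite ge0_fin_numE// variation_ge0.
apply: (is_integral_vm_unique (countably_additive_fin_add ca) _ pw pv
  (V := fine (variation mu setT))).
by rewrite fineK.
Qed.

Lemma integral_vm_exists E (mu : set T -> E) (phi : T -> R[i]) (s : nat -> T -> R[i]) :
  seq_complete E -> bv_measures mu -> (forall n, simple_fun (s n)) ->
  (forall e : R, 0 < e -> \forall n \near \oo, forall x, nrm (phi x - s n x) < e) ->
  exists v, is_integral_vm mu phi v.
Proof.
move=> cE [ca bv] ss sp.
have bvf : variation mu setT \is a fin_num.
  by rewrite ge0_fin_numE// variation_ge0.
apply: (is_integral_vm_exists (countably_additive_fin_add ca)
  (V := fine (variation mu setT)) cE _ ss sp).
by rewrite fineK.
Qed.

Section image.
Variables (E F : normedModType R[i]) (L : bounded_op E F) (mu : set T -> E).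

Lemma countably_additive_bop : countably_additive mu ->
  countably_additive (fun A => L (mu A)).
Proof.
move=> ca G mG tG; under eq_fun do rewrite -bop_sum.
by apply: bop_cvg; exact: ca.
Qed.

Lemma variation_bop A : measurable A ->
  (variation (fun B => L (mu B)) A <= (opnorm L)%:E * variation mu A)%E.
Proof.
move=> mA; apply: variation_le => n G pG.
apply: (@le_trans _ _ ((opnorm L)%:E * (\sum_(0 <= i < n) nrm (mu (G i)))%:E)%E).
  rewrite -EFinM lee_fin big_distrr; apply: ler_sum => i _; exact: bop_nrm_le.
by apply: lee_wpmul2l; [rewrite lee_fin opnorm_ge0|exact: variation_ge].
Qed.

Lemma bv_measures_bop : bv_measures mu -> bv_measures (fun A => L (mu A)).
Proof.
move=> [ca bv]; split; first exact: countably_additive_bop.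
apply: (le_lt_trans (variation_bop measurableT)).
by apply: lte_mul_pinfty => //; rewrite lee_fin opnorm_ge0.
Qed.

Lemma is_integral_vm_bop (phi : T -> R[i]) v :
  is_integral_vm mu phi v -> is_integral_vm (fun A => L (mu A)) phi (L v).
Proof.
move=> [s [ss sp sv]]; exists s; split => //.
rewrite (_ : (fun n => _) = fun n => L (simple_integral_vm mu (s n))).
  exact: bop_cvg.
apply/funext => n; have [fs _] := ss n.
rewrite /simple_integral_vm !fsbig_finite// bop_sum; apply: eq_bigr => a _.
by rewrite bop_linearZ.
Qed.

End image.

End vector_measures.

(** * Vector measures with a Bochner density *)

Section ae_bound.
Context {d : measure_display} {T : measurableType d} {R : realType}.
Variable P : probability T R.
Local Open Scope ereal_scope.

(** On the set where g is at least C + 1/n the hypothesis leaves room only for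
measure 0. *)
Lemma ae_le_of_integral_le (g : T -> \bar R) (C : R) :
  measurable_fun setT g -> (forall x, 0 <= g x) -> (0 <= C)%R ->
  (forall A, measurable A -> \int[P]_(x in A) g x <= C%:E * P A) ->
  {ae P, forall x, g x <= C%:E}.
Proof.
move=> mg g0 C0 gC.
have small n : {ae P, forall x, g x < (C + n.+1%:R^-1)%:E}.
  pose A := [set x | (C + n.+1%:R^-1)%:E <= g x].
  have mA : measurable A.
    by rewrite -[A]setTI; apply: measurable_lee => //; exact: measurable_cst.
  exists A; split => //.
    apply/eqP; rewrite eq_le measure_ge0 andbT.
    have : (C + n.+1%:R^-1)%:E * P A <= C%:E * P A.
      apply: le_trans (gC _ mA); rewrite -integral_cst//.
      apply: ge0_le_integral => //.
      all: try by move=> x _; rewrite lee_fin addr_ge0.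
      all: try exact: measurable_funTS.
    rewrite -(fineK (fin_num_measure P _ mA)) -!EFinM !lee_fin mulrDl gerDl.
    by rewrite pmulr_rle0.
  by move=> x /= /negP; rewrite -leNgt.
apply: filterS (ae_foralln small) => x hx.
apply/lee_addgt0Pr => e e0.
have /ltW/le_trans := hx (Num.truncn e^-1); apply.
rewrite -EFinD lee_fin lerD2l -[leRHS]invrK lef_pV2 ?posrE ?invr_gt0//.
by rewrite ltW// truncnS_gt.
Qed.

End ae_bound.

Section densities.
Context {d : measure_display} {T : measurableType d} {R : realType}.
Variable P : probability T R.

Lemma L1norm_patch_small (E : normedModType R[i]) (f : T -> E) (U : (set T)^nat) :
  bint P f -> (forall n, measurable (U n)) ->
  (forall x, \forall n \near \oo, ~ U n x) ->
  L1norm P (patch (fun=> 0) (U n) f) @[n --> \oo] --> 0%E.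
Proof.
move=> [bf fi] mU Ue.
have := @dominated_cvg _ _ _ P setT measurableT
  (fun n x => (nrm (patch (fun=> 0) (U n) f x))%:E) (cst 0%E) (fun x => (nrm (f x))%:E).
rewrite integral0; apply => //.
- by move=> n; apply/measurable_EFinP/bmeas_nrm; exact: bmeas_patch.
- move=> x _.
  have hE : {near \oo, (fun _ : nat => 0%E) =1
      (fun n => (nrm (patch (fun=> 0) (U n) f x))%:E)}.
    by apply: filterS (Ue x) => n nU; rewrite /patch memNset// nrm0.
  by apply: cvg_trans (near_eq_cvg hE) _; exact: cvg_cst.
- apply/integrableP; split; first by apply/measurable_EFinP; exact: bmeas_nrm.
  apply: le_lt_trans fi; rewrite le_eqVlt; apply/predU1P; left.
  by apply: eq_integral => x _; rewrite gee0_abs ?lee_fin.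
- move=> n x _; rewrite gee0_abs ?lee_fin//.
  by rewrite /patch; case: ifP => _ //; rewrite nrm0.
Qed.

Lemma integral_npart (h : T -> \bar R) A n F : npart A n F ->
  measurable_fun setT h -> (forall x, 0 <= h x)%E ->
  (\int[P]_(x in A) h x = \sum_(0 <= i < n) \int[P]_(x in F i) h x)%E.
Proof.
move=> [mF tF <-] mh h0; rewrite bigcup_mkord -(big_mkord xpredT F).
rewrite ge0_integral_bigsetU//; first exact: iota_uniq.
- by apply: sub_trivIset tF => i /=; rewrite mem_index_iota.
- exact: measurable_funTS.
Qed.

Lemma simple_integral_fin (V : finType) (E : normedModType R[i]) (g : V -> E)
    (u : T -> V) : simple_fun u ->
  simple_integral P (g \o u) = \sum_(v : V) (fine (P (u @^-1` [set v])))%:C *: g v.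
Proof.
move=> su; rewrite (simple_integral_comp P g su) [RHS](bigID (mem (fset_set (range u))))/=.
rewrite [X in _ = _ + X]big1 ?addr0 => [|v vu].
  by rewrite big_uniq ?fset_uniq.
rewrite (_ : _ @^-1` _ = set0) ?measure0 ?scale0r//.
have [fu _] := su.
apply/seteqP; split=> x //= uxv; apply: (negP vu).
by rewrite in_fset_set// mem_set//; exists x.
Qed.

Section one_density.
Variables (E : normedModType R[i]) (cE : seq_complete E) (f : T -> E).
Hypothesis fi : bint P f.
Variable mu : set T -> E.
Hypothesis muE : forall A, measurable A -> mu A = bochner_integral P A f.

Lemma density_is_bochner A : measurable A ->
  is_bochner_integral P (patch (fun=> 0) A f) (mu A).
Proof. by move=> mA; rewrite muE//; exact: is_bochner_integralP. Qed.

Lemma density_bmeas_patch A : measurable A -> bmeas (patch (fun=> 0) A f).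
Proof. by move=> mA; apply: bmeas_patch => //; case: fi. Qed.

Lemma density_nrm_le A : measurable A -> ((nrm (mu A))%:E <= \int[P]_(x in A) (nrm (f x))%:E)%E.
Proof.
move=> mA; rewrite -L1norm_patch; apply: is_bochner_nrm; last exact: density_is_bochner.
exact: density_bmeas_patch.
Qed.

Lemma density_fin_add : fin_add mu.
Proof.
split.
  have := density_nrm_le measurable0; rewrite integral_set0 lee_fin => h.
  by apply: nrm_eq0; apply/eqP; rewrite eq_le h nrm_ge0.
move=> A B mA mB AB.
have mAB := measurableU _ _ mA mB.
apply: (is_bochner_unique (density_bmeas_patch mAB) (density_is_bochner mAB)).
have := is_bochnerD (density_bmeas_patch mA) (density_bmeas_patch mB)
  (density_is_bochner mA) (density_is_bochner mB).
congr (is_bochner_integral P _ _); apply/funext => x; rewrite /patch in_setU.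
case: ifPn => [/[!inE] Ax|_]; case: ifPn => [/[!inE] Bx|_] /=; rewrite ?addr0 ?add0r//.
by have : (A `&` B) x by []; rewrite AB.
Qed.

(** The defect of the n-th partial sum is the integral over a tail of the union,
and the tails decrease to the empty set. *)
Lemma density_countably_additive : countably_additive mu.
Proof.
move=> F mF tF.
pose U n := \bigcup_i F i `\` \bigcup_(i in `I_n) F i.
have mFn n : measurable (\bigcup_(i in `I_n) F i) by exact: bigcup_measurable.
have mFo : measurable (\bigcup_i F i) by exact: bigcup_measurable.
have mU n : measurable (U n) by exact: measurableD.
have pn n : npart (\bigcup_(i in `I_n) F i) n F.
  by split => //; apply: sub_trivIset tF.
have UE n : mu (\bigcup_i F i) - \sum_(0 <= i < n) mu (F i) = mu (U n).
  rewrite -(fin_add_npart density_fin_add (pn n)); apply/eqP; rewrite subr_eq addrC.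
  rewrite -(proj2 density_fin_add)//.
    rewrite setDUK//; first by move=> x [i _ Fi]; exists i.
  by rewrite setDIK.
have Usm x : \forall n \near \oo, ~ U n x.
  have [[i _ Fi]|h] := pselect ((\bigcup_i F i) x).
    by exists i.+1 => // n /= ni [_]; apply; exists i.
  by apply: nearW => n [].
have /(L1norm_patch_small fi mU)/cvge0_real L0 := Usm.
apply/cvg_nrmP/cvgr0Pnorm_lt => e e0.
have [N hN] := L0 (fun n => L1norm_ge0 _ _) _ e0.
exists N => // n /= Nn.
rewrite ger0_norm// nrm_distC UE -lte_fin; apply: le_lt_trans (hN _ Nn).
by rewrite L1norm_patch; exact: density_nrm_le.
Qed.

Lemma measurable_density_nrm : measurable_fun setT (fun x => (nrm (f x))%:E).
Proof. by apply/measurable_EFinP/bmeas_nrm; case: fi. Qed.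

Lemma density_variation_le A :
  (variation mu A <= \int[P]_(x in A) (nrm (f x))%:E)%E.
Proof.
apply: variation_le => n F pF.
rewrite (integral_npart pF measurable_density_nrm); last by move=> x; rewrite lee_fin.
rewrite -sumEFin; apply: lee_sum => i _; apply: density_nrm_le.
by case: pF.
Qed.

Lemma density_bv : bv_measures mu.
Proof.
split; first exact: density_countably_additive.
by apply: (le_lt_trans (density_variation_le _)); case: fi.
Qed.

Lemma density_ac : abs_continuous P mu.
Proof.
move=> A mA PA0; apply: nrm_eq0; apply/eqP; rewrite eq_le nrm_ge0 andbT -lee_fin.
apply: (le_trans (density_nrm_le mA)).
rewrite -L1norm_patch (L1norm_ae (g := fun=> 0)).
  by rewrite /L1norm; under eq_integral do rewrite nrm0; rewrite integral0.
by exists A; split => // x /=; apply: contra_notP => Ax; rewrite /patch memNset.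
Qed.

(** Integrating phi against the measure with density f is integrating phi f: this
holds term by term when phi is simple, and both integrals are continuous for
uniform convergence. With phi a conjugate character it identifies the two kinds
of Fourier coefficients. *)
Lemma density_integral_vm (phi : T -> R[i]) (s : nat -> T -> R[i]) (c : R) :
  (forall x, nrm (phi x) <= c) -> (forall n, simple_fun (s n)) ->
  (forall e : R, 0 < e -> \forall n \near \oo, forall x, nrm (phi x - s n x) < e) ->
  exists2 v, is_bochner_integral P (fun x => phi x *: f x) v & is_integral_vm mu phi v.
Proof.
move=> phic ss sp; have [bf fL] := fi.
have bphi : bmeas (phi : T -> R[i]^o).
  exists s => // x; apply/cvg_nrmP/cvgr0Pnorm_lt => e e0.
  apply: filterS (sp _ e0) => n /(_ x).
  by rewrite nrm_distC ger0_norm.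
have bphif : bmeas (fun x => phi x *: f x) by exact: bmeasZ.
have c0 : 0 <= c by rewrite (le_trans (nrm_ge0 (phi point))).
have iphif : (L1norm P (fun x => phi x *: f x) < +oo)%E.
  apply: (@le_lt_trans _ _ (c%:E * L1norm P f)%E); last exact: lte_mul_pinfty.
  by apply: L1norm_le => // x; rewrite nrmZ ler_wpM2r.
have [v phifv] := is_bochner_exists cE bphif iphif.
exists v => //; exists s; split => //.
have simp t : simple_fun t ->
    is_bochner_integral P (fun x => t x *: f x) (simple_integral_vm mu t).
  move=> st; rewrite (simple_integral_vm_comp density_fin_add id st).
  have mt a : measurable (t @^-1` [set a]) by exact: (proj2 st).
  pose F a x := a *: patch (fun=> 0) (t @^-1` [set a]) f x.
  have bF a : bmeas (F a).
    by apply: (@bmeasZ _ _ _ _ (fun=> a)); [exact: bmeas_cst|exact: density_bmeas_patch].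
  have Fa a : is_bochner_integral P (F a) (a *: mu (t @^-1` [set a])).
    by apply: is_bochnerZ; [exact: density_bmeas_patch|exact: density_is_bochner].
  have sumF (l : seq R[i]) : bmeas (fun x => \sum_(a <- l) F a x) /\
      is_bochner_integral P (fun x => \sum_(a <- l) F a x)
        (\sum_(a <- l) a *: mu (t @^-1` [set a])).
    elim: l => [|a l [IH1 IH2]].
      rewrite big_nil; under eq_fun do rewrite big_nil.
      split; first exact: bmeas_cst.
      have s0 := @simple_cst _ T _ (0 : E).
      have := is_bochner_simple P s0; congr (is_bochner_integral P _ _).
      rewrite (simple_integral_comp P (fun _ : E => 0) s0) big1// => z0 _.
      by rewrite scaler0.
    rewrite big_cons; under eq_fun do rewrite big_cons.
    by split; [exact: bmeasD|exact: is_bochnerD].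
  have := (sumF (fset_set (range t))).2.
  congr (is_bochner_integral P _ _); apply/funext => x.
  have [ft _] := st.
  rewrite (big_fsetD1 (t x))/=; last by rewrite in_fset_set// mem_set//; exists x.
  rewrite {1}/F /patch mem_set// big_seq big1 ?addr0// => a.
  rewrite in_fsetD1 => /andP[atx _]; rewrite /F /patch memNset ?scaler0//=.
  by move=> txa; rewrite txa eqxx in atx.
apply/cvg_nrmP/cvgr0Pnorm_lt => e e0.
have Lf : L1norm P f \is a fin_num by rewrite ge0_fin_numE// L1norm_ge0.
have l0 : 0 <= fine (L1norm P f) by rewrite fine_ge0// L1norm_ge0.
have e'0 : 0 < e / (fine (L1norm P f) + 1) by rewrite divr_gt0// ltr_wpDl.
apply: filterS (sp _ e'0) => n hn; rewrite ger0_norm// nrm_distC -lte_fin.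
have bs : bmeas (fun x => s n x *: f x).
  apply: (@bmeasZ _ _ _ _ (s n : T -> R[i]^o) f _ bf).
  exact: (@bmeas_simple _ _ _ (R[i]^o) (s n) (ss n)).
have := is_bochnerB bphif bs phifv (simp _ (ss n)) => /is_bochner_nrm.
move=> /(_ (bmeasB bphif bs)) /le_lt_trans; apply.
apply: (@le_lt_trans _ _ ((e / (fine (L1norm P f) + 1))%:E * L1norm P f)%E).
  apply: L1norm_le => //; [exact: ltW|exact: bmeasB|].
  by move=> x; rewrite -scalerBl nrmZ ler_wpM2r// ltW.
rewrite -(fineK Lf) -EFinM lte_fin mulrAC ltr_pdivrMr ?ltr_wpDl//.
by rewrite ltr_pM2l// ltrDl.
Qed.

(** The total variation is the integral of the norm of the density: for a simple
density the two sides agree term by term, and both sides are continuous in the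
L1 norm. *)
Lemma density_L1_le_variation :
  (L1norm P f <= variation mu setT)%E.
Proof.
apply/lee_addgt0Pr => e e0; have [bf fL] := fi.
have [s ss sf] := bmeas_L1_approx bf fL.
have e20 : 0 < e / 2 by rewrite divr_gt0.
have [N hN] := cvge0_real (fun n => L1norm_ge0 P (fun x => f x - s n x)) sf e20.
move: (hN _ (leqnn N)) (ss N); move: (s N) => t {ss sf hN s N} tf st.
have bt := bmeas_simple st; have bft := bmeasB bf bt.
have [n [c [pn sumE]]] := npart_simple st.
have mt i : measurable (t @^-1` [set c i]) by case: pn.
have piece i : ((fine (P (t @^-1` [set c i])) * nrm (c i))%:E <=
    (nrm (mu (t @^-1` [set c i])))%:E +
    \int[P]_(x in t @^-1` [set c i]) (nrm (f x - t x))%:E)%E.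
  set B := t @^-1` [set c i].
  have stB : simple_fun (patch (fun=> 0) B t) by apply: simple_patch st; exact: mt.
  have Bint : is_bochner_integral P (patch (fun=> 0) B t) ((fine (P B))%:C *: c i).
    have sB := @simple_bool _ T B (mt i).
    have := is_bochner_simple P stB; congr (is_bochner_integral P _ _).
    pose g (b : bool) := if b then c i else 0.
    have -> : patch (fun=> 0) B t = g \o (fun x => `[< B x >]).
      apply/funext => x /=; rewrite /patch /g; case: asboolP => Bx; last by rewrite memNset.
      by rewrite mem_set.
    rewrite (simple_integral_fin g sB) big_bool/= scaler0 addr0.
    congr ((fine (P _))%:C *: _).
    by apply/seteqP; split=> y /=; [move=> /asboolP|move=> /asboolP ->].
  have h := is_bochnerB (bmeas_patch (mt i) bf) (bmeas_simple stB) (density_is_bochner (mt i)) Bint.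
  have := is_bochner_nrm (bmeasB (bmeas_patch (mt i) bf) (bmeas_simple stB)) h.
  rewrite -L1norm_patch (_ : L1norm P _ = L1norm P (patch (fun=> 0) B (fun x => f x - t x))); last first.
    by apply: eq_integral => x _; rewrite /patch; case: ifP; rewrite // subr0.
  move=> h1.
  rewrite (_ : _ * _ = nrm ((fine (P B))%:C *: c i)); last first.
    by rewrite nrmZ nrm_real ger0_norm// fine_ge0.
  apply: (le_trans _ (leeD2l _ h1)); rewrite -EFinD lee_fin.
  by rewrite nrm_distC; exact: nrmB_le.
have mft : measurable_fun setT (fun x => (nrm (f x - t x))%:E).
  by apply/measurable_EFinP/bmeas_nrm.
have L1t : (L1norm P t <= variation mu setT + L1norm P (fun x => (f x - t x)%R))%E.
  rewrite /L1norm (integral_simple P (h := @nrm R E))// sumE -sumEFin.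
  apply: (le_trans (lee_sum _ (fun i _ => piece i))).
  rewrite big_split/= -(integral_npart pn mft); last by move=> x; rewrite lee_fin.
  by apply: leeD => //; rewrite sumEFin; exact: variation_ge pn.
apply: (@le_trans _ _ (L1norm P t + L1norm P (fun x => (f x - t x)%R))%E).
  rewrite (_ : L1norm P f = L1norm P (fun x => t x + (f x - t x))); first exact: L1normD.
  by apply: eq_integral => x _; rewrite subrKC.
apply: (le_trans (leeD2r _ L1t)); rewrite -addeA leeD2l//.
by rewrite (splitr e) EFinD leeD// ltW.
Qed.

End one_density.

Lemma variation_restrict (E : normedModType R[i]) (mu : set T -> E) A : measurable A ->
  (variation (fun B => mu (A `&` B)) setT <= variation mu A)%E.
Proof.
move=> mA; apply: variation_le => n F pF; apply: variation_ge.
by rewrite -[X in npart X](setIT A); exact: npart_setIl.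
Qed.

Lemma patch_patch (E : Type) (z : E) (A B : set T) (f : T -> E) :
  patch (fun=> z) B (patch (fun=> z) A f) = patch (fun=> z) (A `&` B) f.
Proof.
apply/funext => x; rewrite /patch in_setI.
by case: (x \in A); case: (x \in B).
Qed.

Lemma density_integral_le_variation (E : normedModType R[i]) (f : T -> E)
    (mu : set T -> E) (A : set T) : seq_complete E -> bint P f ->
  (forall B, measurable B -> mu B = bochner_integral P B f) -> measurable A ->
  (\int[P]_(x in A) (nrm (f x))%:E <= variation mu A)%E.
Proof.
move=> cE fi muE mA; rewrite -L1norm_patch.
apply: le_trans (variation_restrict mu mA).
apply: density_L1_le_variation => //; first exact: bint_patch.
move=> B mB; rewrite muE; last exact: measurableI.
by rewrite /bochner_integral patch_patch.
Qed.

(** The difference has the zero measure as its indefinite integral, and the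
integral of its norm is the variation of that measure. *)
Lemma density_unique (E : normedModType R[i]) (f g : T -> E) :
  seq_complete E -> bint P f -> bint P g ->
  (forall B, measurable B -> bochner_integral P B f = bochner_integral P B g) ->
  {ae P, forall x, f x = g x}.
Proof.
move=> cE fi gi fg.
have di : bint P (fun x => f x - g x).
  have := bintD fi (bintZ (-1) gi); congr (bint P _).
  by apply/funext => x; rewrite scaleN1r.
have d0 B : measurable B -> (fun _ : set T => 0 : E) B = bochner_integral P B (fun x => f x - g x).
  move=> mB; apply/esym; apply: bochner_integralE => //; first by case: di.
  have := is_bochnerB (bmeas_patch mB (proj1 fi)) (bmeas_patch mB (proj1 gi))
    (is_bochner_integralP cE mB fi) (is_bochner_integralP cE mB gi).
  rewrite fg// subrr; congr (is_bochner_integral P _ _).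
  by apply/funext => x; rewrite /patch; case: ifP => //; rewrite subr0.
have : {ae P, forall x, ((nrm (f x - g x))%:E <= 0%:E)%E}.
  apply: ae_le_of_integral_le => //.
  - by apply/measurable_EFinP/bmeas_nrm; case: di.
  - by move=> x; rewrite lee_fin.
  - move=> A mA; rewrite mul0e.
    apply: (le_trans (density_integral_le_variation cE di d0 mA)).
    apply: variation_le => n F _; rewrite big1// => i _; exact: nrm0.
apply: filterS => x; rewrite lee_fin => h; apply/eqP; rewrite -subr_eq0.
by apply/eqP/nrm_eq0/eqP; rewrite eq_le h nrm_ge0.
Qed.

Lemma bochner_integral_bop (E F : normedModType R[i]) (L : bounded_op E F) (f : T -> E) A :
  seq_complete E -> bint P f -> measurable A ->
  bochner_integral P A (fun x => L (f x)) = L (bochner_integral P A f).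
Proof.
move=> cE fi mA; apply: bochner_integralE => //.
  by apply: bmeas_bop; case: fi.
have := is_bochner_bop L (bmeas_patch mA (proj1 fi)) (is_bochner_integralP cE mA fi).
congr (is_bochner_integral P _ _); apply/funext => x; rewrite /patch.
by case: ifP => //; rewrite bop_linear0.
Qed.

End densities.

(** * Fourier coefficients *)

Section uniform_approximation.
Context {d : measure_display} {T : measurableType d} {R : realType}.

Lemma real_uniform_approx (h : T -> R) (c : R) :
  (forall b, measurable [set x | h x < b]) -> (forall x, `|h x| <= c) ->
  forall n, exists2 s : T -> R, simple_fun s & forall x, `|h x - s x| <= n.+1%:R^-1.
Proof.
move=> mh hc n.
pose y x := n.+1%:R * (h x + c).
have y0 x : 0 <= y x.
  by rewrite mulr_ge0// -lerBlDr sub0r; have := hc x; rewrite ler_norml => /andP[].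
pose u x := Num.truncn (y x).
have uP x : (u x)%:R <= y x < (u x).+1%:R by exact: truncn_itv.
have ylt x b : (y x < b) = (h x < b / n.+1%:R - c).
  by rewrite ltrBrDr ltr_pdivlMr// mulrC.
have su : simple_fun u.
  split.
    apply: (@sub_finite_set _ _ `I_(Num.truncn (n.+1%:R * (c + c))).+1) => //.
    move=> _ [x _ <-] /=; rewrite ltnS; apply: le_truncn.
    by rewrite ler_wpM2l// lerD2r; have := hc x; rewrite ler_norml => /andP[].
  move=> k; rewrite (_ : _ @^-1` _ = [set x | h x < k.+1%:R / n.+1%:R - c] `\`
      [set x | h x < k%:R / n.+1%:R - c]); first by apply: measurableD; exact: mh.
  apply/seteqP; split => x /=; rewrite -!ylt.
    by move=> <-; have /andP[h1 ->] := uP x; split=> //; apply/negP; rewrite -leNgt.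
  move=> [h1 /negP]; rewrite -leNgt => h2; have /andP[h3 h4] := uP x.
  have e1 : (u x < k.+1)%N by rewrite -(ltr_nat R); exact: le_lt_trans h3 h1.
  have e2 : (k < (u x).+1)%N by rewrite -(ltr_nat R); exact: le_lt_trans h2 h4.
  by apply/eqP; rewrite eqn_leq -ltnS e1 -ltnS e2.
exists (fun x => (u x)%:R / n.+1%:R - c).
  exact: (simple_comp (fun k : nat => k%:R / n.+1%:R - c : R) su).
move=> x; have n0 : n.+1%:R != 0 :> R by rewrite pnatr_eq0.
have -> : h x - ((u x)%:R / n.+1%:R - c) = (y x - (u x)%:R) / n.+1%:R.
  by rewrite mulrBl [y x / _]mulrAC mulfV// mul1r opprB addrCA addrAC addrC addrAC.
have /andP[h1 h2] := uP x.
rewrite normrM normfV normr_nat ler_piMl// ger0_norm ?subr_ge0//.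
by rewrite lerBlDl natr1 ltW.
Qed.

Lemma complex_uniform_approx (phi : T -> R[i]) (c : R) :
  (forall b, measurable [set x | complex.Re (phi x) < b]) ->
  (forall b, measurable [set x | complex.Im (phi x) < b]) ->
  (forall x, nrm (phi x) <= c) ->
  exists2 s : nat -> T -> R[i], (forall n, simple_fun (s n)) &
    forall e : R, 0 < e -> \forall n \near \oo, forall x, nrm (phi x - s n x) < e.
Proof.
move=> mr mi phic.
have /choice [a /all_and2 [sa ha]] : forall n, exists s, simple_fun s /\
    forall x, `|complex.Re (phi x) - s x| <= n.+1%:R^-1.
  move=> n; have [s ss hs] := real_uniform_approx mr (fun x => le_trans (nrm_ge_Re _) (phic x)) n.
  by exists s.
have /choice [b /all_and2 [sb hb]] : forall n, exists s, simple_fun s /\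
    forall x, `|complex.Im (phi x) - s x| <= n.+1%:R^-1.
  move=> n; have [s ss hs] := real_uniform_approx mi (fun x => le_trans (nrm_ge_Im _) (phic x)) n.
  by exists s.
exists (fun n x => a n x +i* b n x) => [n|e e0].
  exact: (simple_op (fun p q : R => p +i* q)).
have e20 : 0 < e / 2 by rewrite divr_gt0.
exists (Num.truncn (e / 2)^-1) => // n /= Nn x.
have ne : n.+1%:R^-1 < e / 2.
  rewrite -[ltRHS]invrK ltf_pV2 ?posrE ?invr_gt0//.
  by apply: (lt_le_trans (truncnS_gt _)); rewrite ler_nat.
apply: (le_lt_trans (nrm_le_ReIm _)); rewrite !raddfB/= (splitr e).
by apply: ltrD; [apply: le_lt_trans (ha _ _) ne|apply: le_lt_trans (hb _ _) ne].
Qed.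

End uniform_approximation.

Section characters.
Context {R : realType} {G : topologicalZmodType}.

Lemma continuous_ReIm_open (r : R[i] -> R) (f : G -> R[i]^o) (b : R) :
  (forall x y, r (x - y) = r x - r y) -> (forall x, `|r x| <= nrm x) ->
  continuous f -> measurable ([set x | r (f x) < b] : set (borel G)).
Proof.
move=> rB rle fc; apply: sub_sigma_algebra.
apply: (@open_comp _ _ f [set z | r z < b]) => [x _|]; first exact: fc.
rewrite openE => z /= zb; apply/nbhs_ballP; exists (b - r z)%:C => /=.
  by rewrite ltcR subr_gt0.
move=> w; rewrite -ball_normE /= -nrmE ltcR => zw.
have := le_lt_trans (rle _) zw; rewrite rB ltr_norml => /andP[+ _].
by rewrite ltrNl opprB ltrBlDr subrK.
Qed.

Lemma nrm_conj (a : R[i]) : nrm a^* = nrm a.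
Proof. by rewrite /nrm normcJ. Qed.

Lemma character_uniform_approx (gamma : character R G) :
  exists2 s : nat -> borel G -> R[i], (forall n, simple_fun (s n)) &
    forall e : R, 0 < e -> \forall n \near \oo,
      forall x, nrm ((gamma x)^* - s n x) < e.
Proof.
apply: (@complex_uniform_approx _ (borel G) R (fun x => (gamma x)^*) 1) => [b|b|x].
- rewrite (_ : [set x | _] = [set x : borel G | complex.Re (gamma x) < b]); last first.
    by apply/seteqP; split=> x /=; case: (gamma x).
  apply: (@continuous_ReIm_open (@complex.Re R) gamma) => [x y|x|].
  + by rewrite raddfB.
  + exact: nrm_ge_Re.
  + exact: char_continuous.
- rewrite (_ : [set x | _] = [set x : borel G | - complex.Im (gamma x) < b]); last first.
    by apply/seteqP; split=> x /=; case: (gamma x).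
  apply: (@continuous_ReIm_open (fun z => - complex.Im z) gamma) => [x y|x|].
  + by rewrite raddfB opprD.
  + by rewrite normrN nrm_ge_Im.
  + exact: char_continuous.
- by rewrite nrm_conj /nrm char_norm.
Qed.

End characters.

Section spectra.
Context {R : realType} {G : topologicalZmodType}.
Variable lam : probability (borel G) R.
Implicit Types (Lam : set (character R G)) (gamma : character R G).

(** Without completeness of E the coefficient of mu might not exist while the one
of its image does. *)
Lemma fourier_vm_bop (E F : normedModType R[i]) (L : bounded_op E F)
    (mu : set (borel G) -> E) gamma : seq_complete E -> bv_measures mu ->
  fourier_vm (fun A => L (mu A)) gamma = L (fourier_vm mu gamma).
Proof.
move=> cE bv; have [s ss sp] := character_uniform_approx gamma.
have [v muv] := integral_vm_exists cE bv ss sp.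
rewrite /fourier_vm (integral_vmE bv muv).
by apply: integral_vmE (is_integral_vm_bop L muv); exact: bv_measures_bop.
Qed.

Lemma bv_measures_spec_bop (E F : normedModType R[i]) (L : bounded_op E F)
    (mu : set (borel G) -> E) Lam : seq_complete E ->
  bv_measures_spec Lam mu -> bv_measures_spec Lam (fun A => L (mu A)).
Proof.
move=> cE [bv h]; split; first exact: bv_measures_bop.
by move=> gamma /h mu0; rewrite fourier_vm_bop// mu0 bop_linear0.
Qed.

Lemma bv_measures_ac_spec_bop (E F : normedModType R[i]) (L : bounded_op E F)
    (mu : set (borel G) -> E) Lam : seq_complete E ->
  bv_measures_ac_spec lam Lam mu -> bv_measures_ac_spec lam Lam (fun A => L (mu A)).
Proof.
move=> cE [sp ac]; split; first exact: bv_measures_spec_bop.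
by move=> A mA A0; rewrite ac// bop_linear0.
Qed.

Lemma bv_measures_infty_spec_bop (E F : normedModType R[i]) (L : bounded_op E F)
    (mu : set (borel G) -> E) Lam : seq_complete E ->
  bv_measures_infty_spec lam Lam mu ->
  bv_measures_infty_spec lam Lam (fun A => L (mu A)).
Proof.
move=> cE [[bv [C C0 muC]] h].
have [_ h'] := bv_measures_spec_bop L cE (conj bv h).
split=> //; split; first exact: bv_measures_bop.
have L1 : 0 < opnorm L + 1 by rewrite ltr_wpDl// opnorm_ge0.
exists ((opnorm L + 1) * C) => [|A mA]; first exact: mulr_gt0.
apply: (le_trans (variation_bop L mu mA)).
apply: (@le_trans _ _ ((opnorm L + 1)%:E * variation mu A)%E).
  by apply: lee_wpmul2r; [exact: variation_ge0|rewrite lee_fin lerDl].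
by rewrite EFinM -muleA; apply: lee_wpmul2l; [rewrite lee_fin ltW|exact: muC].
Qed.

Lemma fourier_density (E : normedModType R[i]) (f g : borel G -> E)
    (mu : set (borel G) -> E) gamma : seq_complete E -> bint lam f ->
  {ae lam, forall x, g x = f x} ->
  (forall A, measurable A -> mu A = bochner_integral lam A f) ->
  fourier lam g gamma = fourier_vm mu gamma.
Proof.
move=> cE fi gf muE; have [s ss sp] := character_uniform_approx gamma.
have gle x : nrm ((gamma x)^*) <= 1 by rewrite nrm_conj /nrm char_norm.
have [v fv muv] := density_integral_vm cE fi muE gle ss sp.
rewrite /fourier_vm (integral_vmE (density_bv cE fi muE) muv).
rewrite /fourier (@bochner_integral_ae _ _ _ lam _ setT _ (fun x => (gamma x)^* *: f x)); last first.
  by apply: filterS gf => x ->.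
have bphi : bmeas (fun x : borel G => (gamma x)^* : R[i]^o).
  exists s => // x; apply/cvg_nrmP/cvgr0Pnorm_lt => e e0.
  apply: filterS (sp _ e0) => n /(_ x).
  by rewrite nrm_distC ger0_norm.
apply: bochner_integralE => //; first by apply: bmeasZ => //; case: fi.
by rewrite patch_setT.
Qed.

End spectra.

Section bochner_spaces.
Context {d : measure_display} {T : measurableType d} {R : realType}.
Variables (P : probability T R) (E : normedModType R[i]).

Lemma bochner_space1P (f : T -> E) : bochner_space P 1 f <->
  exists2 f', bint P f' & {ae P, forall x, f x = f' x}.
Proof.
have N1 (g : T -> E) : Lnorm P 1 (fun x => (nrm (g x))%:E) = L1norm P g.
  by rewrite Lnorm1; apply: eq_integral => x _; rewrite gee0_abs ?lee_fin.
split.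
  move=> [/strongly_measurable_bmeas [f' bf' ff']]; rewrite N1 => fi.
  by exists f' => //; split=> //; rewrite -(L1norm_ae ff').
move=> [f' [bf' fi'] ff'].
have f'f : {ae P, forall x, f' x = f x} by apply: filterS ff' => x ->.
split; last by rewrite N1 (L1norm_ae ff').
exact: strongly_measurable_ae f'f (bmeas_strongly_measurable _ bf').
Qed.

Lemma bint_bounded (f : T -> E) (C : R) : bmeas f ->
  {ae P, forall x, nrm (f x) <= C} -> bint P f.
Proof.
move=> bf fC; split=> //.
apply: (@le_lt_trans _ _ (\int[P]_(x in setT) cst (`|C|)%:E x)%E).
  apply: ae_ge0_le_integral => //.
  - by move=> x _; rewrite lee_fin.
  - by apply/measurable_EFinP; exact: bmeas_nrm.
  - by move=> x _; rewrite lee_fin.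
  - by apply: filterS fC => x fC _; rewrite lee_fin (le_trans fC)// ler_norm.
rewrite integral_cst; last exact: measurableT.
apply: lte_mul_pinfty; rewrite ?lee_fin//.
by apply: le_lt_trans (probability_le1 P measurableT) _; exact: ltry.
Qed.

Lemma bochner_spaceyP (f : T -> E) : bochner_space P +oo f <->
  exists2 f', bmeas f' & {ae P, forall x, f x = f' x} /\
    exists2 C : R, 0 < C & {ae P, forall x, nrm (f' x) <= C}.
Proof.
have P0 : (0 < P setT)%E by rewrite probability_setT.
have NE (g : T -> E) : Lnorm P +oo (fun x => (nrm (g x))%:E) =
    ess_sup P (fun x => (nrm (g x))%:E).
  rewrite unlock P0; apply: eq_ess_sup; apply: nearW => x.
  by rewrite /= ger0_norm.
split.
  move=> [/strongly_measurable_bmeas [f' bf' ff']]; rewrite NE => fi.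
  exists f' => //; split=> //.
  have [C C0 fC] : exists2 C : R, 0 < C & (ess_sup P (fun x => (nrm (f x))%:E) <= C%:E)%E.
    case: (ess_sup _ _) fi => [r| |]// _; last by exists 1; rewrite ?leNye.
    exists (`|r| + 1); first by rewrite ltr_wpDl.
    by rewrite lee_fin (le_trans (ler_norm r))// lerDl.
  exists C => //; move/ess_supP : fC => fC.
  by apply: filterS2 ff' fC => x ->; rewrite lee_fin.
move=> [f' bf' [ff' [C C0 fC]]].
have f'f : {ae P, forall x, f' x = f x} by apply: filterS ff' => x ->.
split; first exact: strongly_measurable_ae f'f (bmeas_strongly_measurable _ bf').
rewrite NE; apply: (@le_lt_trans _ _ C%:E); last exact: ltry.
by apply/ess_supP; apply: filterS2 ff' fC => x ->; rewrite lee_fin.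
Qed.

End bochner_spaces.

Section densities_are_measures.
Context {R : realType} {G : topologicalZmodType}.
Variables (lam : probability (borel G) R) (Lam : set (character R G)).
Variables (E : normedModType R[i]) (cE : seq_complete E).

Lemma densities1_bint (mu : set (borel G) -> E) :
  densities lam (bochner_space_spec lam Lam 1%E) mu ->
  exists2 f, bint lam f & forall A, measurable A -> mu A = bochner_integral lam A f.
Proof.
move=> [f [/bochner_space1P [f' fi ff'] _] muE]; exists f' => // A mA.
by rewrite muE//; exact: bochner_integral_ae.
Qed.

Lemma densitiesy_bint (mu : set (borel G) -> E) :
  densities lam (bochner_space_spec lam Lam +oo%E) mu ->
  exists2 f, bint lam f & forall A, measurable A -> mu A = bochner_integral lam A f.
Proof.
move=> [f [/bochner_spaceyP [f' bf' [ff' [C C0 fC]]] _] muE]; exists f' => [|A mA].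
  exact: bint_bounded bf' fC.
by rewrite muE//; exact: bochner_integral_ae.
Qed.

(** Conversely, indefinite integrals have the required properties over every
complete space. *)
Lemma densities1_sub :
  densities lam (bochner_space_spec lam Lam 1%E) `<=` (@bv_measures_ac_spec _ _ lam E Lam).
Proof.
move=> mu [f [/bochner_space1P [f' fi ff'] f0] muE].
have muE' A : measurable A -> mu A = bochner_integral lam A f'.
  by move=> mA; rewrite muE//; exact: bochner_integral_ae.
split; last exact: (density_ac cE fi muE').
split; first exact: (density_bv cE fi muE').
by move=> gamma /f0; rewrite (fourier_density gamma cE fi ff' muE').
Qed.

Lemma densitiesy_sub :
  densities lam (bochner_space_spec lam Lam +oo%E) `<=` (@bv_measures_infty_spec _ _ lam E Lam).
Proof.
move=> mu [f [/bochner_spaceyP [f' bf' [ff' [C C0 fC]]] f0] muE].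
have fi := bint_bounded bf' fC.
have muE' A : measurable A -> mu A = bochner_integral lam A f'.
  by move=> mA; rewrite muE//; exact: bochner_integral_ae.
split; last by move=> gamma /f0; rewrite (fourier_density gamma cE fi ff' muE').
split; first exact: (density_bv cE fi muE').
exists C => // A mA; apply: (le_trans (density_variation_le cE fi muE' _)).
rewrite -integral_cst//; apply: ae_ge0_le_integral => //.
- by move=> x _; rewrite lee_fin.
- by apply/measurable_EFinP; apply: measurable_funTS; exact: bmeas_nrm.
- by move=> x _; rewrite lee_fin ltW.
- by apply: filterS fC => x h _; rewrite lee_fin.
Qed.

Lemma densities1_intro (mu : set (borel G) -> E) (f : borel G -> E) :
  bv_measures_ac_spec lam Lam mu -> bint lam f ->
  (forall A, measurable A -> mu A = bochner_integral lam A f) ->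
  densities lam (bochner_space_spec lam Lam 1%E) mu.
Proof.
move=> [[_ mu0] _] fi muE; exists f => //; split.
  by apply/bochner_space1P; exists f => //; exact: aeW.
have ff : {ae lam, forall x, f x = f x} by exact: aeW.
by move=> gamma /mu0; rewrite (fourier_density gamma cE fi ff muE).
Qed.

(** A density of a measure dominated by C times lam is bounded by C, because the
integral of its norm over any set is at most the variation there. *)
Lemma densitiesy_intro (mu : set (borel G) -> E) (f : borel G -> E) :
  bv_measures_infty_spec lam Lam mu -> bint lam f ->
  (forall A, measurable A -> mu A = bochner_integral lam A f) ->
  densities lam (bochner_space_spec lam Lam +oo%E) mu.
Proof.
move=> [[_ [C C0 muC]] mu0] fi muE; exists f => //.
have ff : {ae lam, forall x, f x = f x} by exact: aeW.
split; last by move=> gamma /mu0; rewrite (fourier_density gamma cE fi ff muE).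
have [bf _] := fi.
apply/bochner_spaceyP; exists f => //; split=> //; exists C => //.
have : {ae lam, forall x, ((nrm (f x))%:E <= C%:E)%E}.
  apply: ae_le_of_integral_le => //.
  - by apply/measurable_EFinP; exact: bmeas_nrm.
  - by move=> x; rewrite lee_fin.
  - exact: ltW.
  - move=> A mA; apply: le_trans (muC _ mA).
    exact: density_integral_le_variation.
by apply: filterS => x; rewrite lee_fin.
Qed.

End densities_are_measures.

(** * Norming functionals *)

Section hahn_banach.
Context {R : realType} {Y : normedModType R[i]}.

Definition sublinear (q : Y -> R) : Prop :=
  (forall x y, q (x + y) <= q x + q y) /\
  (forall (t : R) x, 0 <= t -> q (t%:C *: x) <= t * q x).

Lemma sublinear_le0 q : sublinear q -> q 0 <= 0.
Proof. by move=> [_ qZ]; have := qZ 0 0 (lexx _); rewrite scaler0 mul0r. Qed.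

Lemma sublinear_oppr q x : sublinear q -> - q (- x) <= q x.
Proof.
move=> [qD qZ]; have h := qD x (- x); have h0 := qD 0 0.
rewrite subrr in h; rewrite addr0 lerDl in h0.
by rewrite -subr_ge0 opprK (le_trans h0).
Qed.

Lemma sublinearZ q (t : R) x : sublinear q -> 0 <= t -> q (t%:C *: x) = t * q x.
Proof.
move=> sq t0; have [qD qZ] := sq; apply/eqP; rewrite eq_le qZ//=.
have [->|tn0] := eqVneq t 0.
  rewrite mul0r scale0r; have := sublinear_oppr 0 sq; rewrite oppr0.
  by have := qD 0 0; rewrite addr0 lerDl.
have t1 : 0 < t by rewrite lt_neqAle eq_sym tn0.
have := qZ t^-1 (t%:C *: x); rewrite scalerA -rmorphM mulVf// scale1r invr_ge0.
by move=> /(_ t0); rewrite ler_pdivlMl.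
Qed.

(** Lowering a sublinear functional as much as possible in the direction [- y];
a minimal sublinear functional is unchanged by this, hence additive. *)
Definition lower_towards (q : Y -> R) (y x : Y) : R :=
  inf [set q (x + t%:C *: y) - t * q y | t in [set t : R | 0 <= t]].

Lemma lower_has_inf q y x : sublinear q ->
  has_inf [set q (x + t%:C *: y) - t * q y | t in [set t : R | 0 <= t]].
Proof.
move=> sq; have [qD qZ] := sq; split; first by exists (q (x + 0%:C *: y) - 0 * q y), 0 => /=.
exists (- q (- x)) => _ [t /= t0 <-].
rewrite -(sublinearZ _ sq t0) lerBrDl -lerBrDr opprK.
by have := qD (x + t%:C *: y) (- x); rewrite addrAC subrr add0r.
Qed.

Lemma lower_le q y x (t : R) : sublinear q -> 0 <= t ->
  lower_towards q y x <= q (x + t%:C *: y) - t * q y.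
Proof.
by move=> sq t0; apply: ge_inf; [case: (lower_has_inf y x sq)|exists t].
Qed.

Lemma lower_ge q y x (c : R) :
  (forall t : R, 0 <= t -> c <= q (x + t%:C *: y) - t * q y) -> c <= lower_towards q y x.
Proof.
move=> h; apply: lb_le_inf; first by exists (q (x + 0%:C *: y) - 0 * q y), 0 => /=.
by move=> _ [t /= t0 <-]; exact: h.
Qed.

Lemma lower_sublinear q y : sublinear q -> sublinear (lower_towards q y).
Proof.
move=> sq; have [qD qZ] := sq; split=> [a b|c x c0].
  rewrite -lerBlDl; apply: lower_ge => t t0.
  rewrite lerBlDl -lerBlDr; apply: lower_ge => s s0.
  rewrite lerBlDr; apply: (le_trans (lower_le y (a + b) sq (addr_ge0 s0 t0))).
  rewrite rmorphD/= scalerDl addrACA mulrDl opprD [leRHS]addrACA lerD2r.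
  exact: qD.
have [->|cn0] := eqVneq c 0.
  rewrite mul0r; apply: (le_trans (lower_le y _ sq (lexx 0))).
  by rewrite mul0r subr0 !scale0r addr0; exact: sublinear_le0.
have c1 : 0 < c by rewrite lt_neqAle eq_sym cn0.
rewrite -ler_pdivrMl//; apply: lower_ge => t t0; rewrite ler_pdivrMl//.
apply: (le_trans (lower_le y _ sq (mulr_ge0 c0 t0))).
by rewrite mulrBr mulrA lerD2r rmorphM/= -scalerA -scalerDr; exact: qZ.
Qed.

Lemma lower_towards_le q y x : sublinear q -> lower_towards q y x <= q x.
Proof.
move=> sq; apply: (le_trans (lower_le y x sq (lexx 0))).
by rewrite scale0r addr0 mul0r subr0.
Qed.

(** Zorn's lemma for the pointwise order: the infimum of a chain of sublinear
functionals is finite because they are all bounded below by - p (- x), and it is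
subadditive because two members of a chain are comparable. *)
Lemma minimal_sublinear_exists p : sublinear p ->
  exists q, [/\ sublinear q, forall x, q x <= p x &
    forall q', sublinear q' -> (forall x, q' x <= q x) -> q' = q].
Proof.
move=> sp.
pose S := {q : Y -> R | sublinear q /\ forall x, q x <= p x}.
pose below (q q' : S) := `[< forall x, proj1_sig q' x <= proj1_sig q x >].
have Seq (q q' : S) : proj1_sig q = proj1_sig q' -> q = q'.
  by case: q q' => [a pa] [b pb] /= ab; subst b; congr exist; exact: Prop_irrelevance.
have [[q [sq qp]] /= qmin] : exists q : S, forall q', below q q' -> q' = q.
  apply: Zorn => [q|q1 q2 q3 /asboolP h1 /asboolP h2|q1 q2 /asboolP h1 /asboolP h2|A Atot].
  - by apply/asboolP.
  - by apply/asboolP => x; exact: le_trans (h2 x) (h1 x).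
  - by apply/Seq/funext => x; apply/eqP; rewrite eq_le h1 h2.
  have [[q0 Aq0]|noA] := pselect (exists q, A q); last first.
    exists (exist _ p (conj sp (fun x => lexx _))) => s As.
    by case: noA; exists s.
  pose V x := [set proj1_sig q x | q in A].
  have Vinf x : has_inf (V x).
    split; first by exists (proj1_sig q0 x), q0.
    exists (- p (- x)) => _ [[q [sq qp]] /= _ <-].
    by apply: le_trans (sublinear_oppr x sq); rewrite lerN2.
  pose m x := inf (V x).
  have mle q x : A q -> m x <= proj1_sig q x.
    by move=> Aq; apply: ge_inf; [case: (Vinf x)|exists q].
  have mge x c : (forall q, A q -> c <= proj1_sig q x) -> c <= m x.
    move=> h; apply: lb_le_inf; first by case: (Vinf x).
    by move=> _ [q Aq <-]; exact: h.
  have sm : sublinear m.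
    split=> [a b|c x c0].
      rewrite -lerBlDl; apply: (mge) => q1 Aq1.
      rewrite lerBlDl -lerBlDr; apply: (mge) => q2 Aq2; rewrite lerBlDr.
      have [/asboolP h|/asboolP h] := Atot _ _ Aq1 Aq2.
        apply: (le_trans (mle _ _ Aq2)).
        by apply: (le_trans ((proj2_sig q2).1.1 a b)); rewrite lerD2l h.
      apply: (le_trans (mle _ _ Aq1)).
      by apply: (le_trans ((proj2_sig q1).1.1 a b)); rewrite lerD2r h.
    have [->|cn0] := eqVneq c 0.
      rewrite mul0r scale0r; apply: (le_trans (mle _ _ Aq0)).
      exact: sublinear_le0 (proj2_sig q0).1.
    have c1 : 0 < c by rewrite lt_neqAle eq_sym cn0.
    rewrite -ler_pdivrMl//; apply: (mge) => q Aq; rewrite ler_pdivrMl//.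
    by apply: (le_trans (mle _ _ Aq)); exact: (proj2_sig q).1.2.
  have mp x : m x <= p x by apply: (le_trans (mle _ _ Aq0)); exact: (proj2_sig q0).2.
  exists (exist _ m (conj sm mp)) => s As; apply/asboolP => x /=; exact: mle.
exists q; split=> // q' sq' q'q.
have q'p x : q' x <= p x by exact: le_trans (q'q x) (qp x).
have := qmin (exist _ q' (conj sq' q'p)).
by move=> /(_ (introT (asboolP _) q'q)) [].
Qed.

(** A minimal functional below the norm lowered towards y0 takes at - y0 a value
at most - nrm y0. *)
Lemma real_norming_functional (y0 : Y) : exists u : Y -> R,
  [/\ forall x y, u (x + y) = u x + u y, forall (t : R) x, u (t%:C *: x) = t * u x,
      forall x, u x <= nrm x & nrm y0 <= u y0].
Proof.
have sn : sublinear (fun x : Y => nrm x).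
  split=> [x y|t x t0]; first exact: nrmD.
  by rewrite nrmZ nrm_real ger0_norm.
have [u [su up umin]] := minimal_sublinear_exists (lower_sublinear y0 sn).
have uD x y : u (x + y) = u x + u y.
  have ue : lower_towards u y = u.
    by apply: umin; [exact: lower_sublinear|move=> z; exact: lower_towards_le].
  apply/eqP; rewrite eq_le (proj1 su)/= -lerBrDr.
  by have := lower_le y x su ler01; rewrite ue scale1r mul1r.
have u0 : u 0 = 0 by have /eqP := uD 0 0; rewrite addr0 -subr_eq0 opprD addrA subrr sub0r oppr_eq0 => /eqP.
have uN x : u (- x) = - u x.
  by apply/eqP; rewrite -subr_eq0 opprK -uD addNr u0.
exists u; split=> // [t x|x|].
- have [t0|t0] := leP 0 t; first exact: sublinearZ.
  have nt0 : 0 <= - t by rewrite oppr_ge0 ltW.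
  apply: oppr_inj; rewrite -uN -scaleNr -rmorphN/= (sublinearZ _ su nt0).
  by rewrite mulNr.
- by apply: (le_trans (up x)); exact: lower_towards_le.
- rewrite -lerN2 -uN; apply: (le_trans (up _)).
  apply: (le_trans (lower_le _ _ sn ler01)).
  by rewrite scale1r addNr nrm0 sub0r mul1r.
Qed.

(** Hahn-Banach: the complex functional is recovered from its real part [u]
as [u x - i u (i x)]. *)
Lemma norming_functional (y0 : Y) : exists w : bounded_op Y R[i]^o,
  (forall y, nrm (w y) <= nrm y) /\ nrm y0 <= nrm (w y0).
Proof.
have [u [uD uZ ule uy0]] := real_norming_functional y0.
pose phi (x : Y) : R[i]^o := u x -i* u ('i *: x).
have phiD x y : phi (x + y) = phi x + phi y.
  by rewrite /phi scalerDr !uD opprD.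
have phiZ (a : R[i]) x : phi (a *: x) = a * phi x.
  have aE : a *: x = (complex.Re a)%:C *: x + (complex.Im a)%:C *: ('i *: x).
    by rewrite {1}(complexE a) scalerDl [_ * _%:C]mulrC !scalerA.
  have iaE : 'i *: (a *: x) = (complex.Re a)%:C *: ('i *: x) + (- complex.Im a)%:C *: x.
    rewrite {1}(complexE a) !scalerA mulrDr mulrA -expr2 sqr_i mulN1r scalerDl.
    by rewrite [_ * _%:C]mulrC rmorphN.
  rewrite /phi aE -aE iaE aE !uD !uZ.
  case: a {aE iaE} => a b /=; apply/eqP; rewrite eq_complex /=.
  apply/andP; split; apply/eqP; first by rewrite mulrN opprK.
  by rewrite opprD mulNr opprK mulrN addrC.
have phi_linear : linear phi by move=> a x y; rewrite phiD phiZ.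
have phile x : nrm (phi x) <= nrm x.
  have [z0|z0] := eqVneq (phi x) 0; first by rewrite z0 nrm0.
  pose c : R[i] := `|phi x| / phi x.
  have nc : nrm c = 1.
    apply: complexI; rewrite nrmE normrM normr_id normfV mulfV//.
    by rewrite normr_eq0.
  have : phi (c *: x) = (nrm (phi x))%:C by rewrite phiZ /c divfK// nrmE.
  move=> /(congr1 (@complex.Re R)) /= uc.
  by rewrite -uc (le_trans (ule _))// nrmZ nc mul1r.
have phile' x : nrm (phi x) <= 1 * nrm x by rewrite mul1r.
have [w wE] := mk_bop phi_linear phile'.
exists w; split=> [y|]; first by rewrite wE.
rewrite wE (le_trans uy0)//.
exact: le_trans (ler_norm _) (nrm_ge_Re (phi y0)).
Qed.

End hahn_banach.

(** * Separability of a set of compact operators *)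

Section finite_classification.
Context {I : choiceType}.

(** Total boundedness of a family, in a form stable under finite conjunctions of
closeness relations. *)
Definition finitely_classified (D : I -> I -> Prop) : Prop :=
  exists (V : finType) (r : I -> V), forall k j, r k = r j -> D k j.

Lemma finitely_classified_all (J : eqType) (s : seq J) (D : J -> I -> I -> Prop) :
  (forall j, finitely_classified (D j)) ->
  finitely_classified (fun k l => forall j, j \in s -> D j k l).
Proof.
move=> hD; elim: s => [|j s [V [r hr]]].
  by exists unit, (fun=> tt) => k l _ j; rewrite in_nil.
have [W [q hq]] := hD j.
exists (V * W)%type, (fun k => (r k, q k)) => k l [rkl qkl] i.
by rewrite inE => /predU1P[->|/hr]; [exact: hq|apply].
Qed.

Lemma finitely_classified_representatives (D : I -> I -> Prop) (i0 : I) :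
  finitely_classified D -> exists s : seq I, forall k, exists2 j, j \in s & D k j.
Proof.
move=> [V [r hr]].
pose get v := xget i0 [set j | r j = v].
exists [seq get v | v <- enum V] => k; exists (get (r k)).
  by apply: map_f; rewrite mem_enum.
apply: hr; rewrite /get; case: xgetP => [j _ /= ->//|h]; by have := h k erefl.
Qed.

(** Rounding a + c to a multiple of e; adding the bound c makes the quotients
nonnegative, hence natural numbers after truncation. *)
Lemma finitely_classified_real (R : realType) (a : I -> R) (c e : R) : 0 < e ->
  (forall k, `|a k| <= c) -> finitely_classified (fun k l => `|a k - a l| <= e).
Proof.
move=> e0 ac.
pose y k := (a k + c) / e.
have y0 k : 0 <= y k.
  by rewrite divr_ge0 ?(ltW e0)// -lerBlDr sub0r; have := ac k; rewrite ler_norml => /andP[].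
have ylt k : (Num.truncn (y k) < (Num.truncn ((c + c) / e)).+1)%N.
  rewrite ltnS; apply: le_truncn; rewrite ler_pM2r ?invr_gt0// lerD2r.
  by have := ac k; rewrite ler_norml => /andP[].
exists 'I_(Num.truncn ((c + c) / e)).+1, (fun k => Ordinal (ylt k)) => k l [] E.
have /andP[h1 h2] := truncn_itv (y0 k); have /andP[h3 h4] := truncn_itv (y0 l).
have : `|y k - y l| <= 1.
  rewrite ler_norml; move: h1 h2 h3 h4; rewrite E -natr1 => *.
  by apply/andP; split; lra.
have -> : y k - y l = (a k - a l) / e by rewrite /y -mulrBl; congr (_ / _); lra.
by rewrite normrM normfV (gtr0_norm e0) ler_pdivrMr// mul1r.
Qed.

Lemma finitely_classified_complex (R : realType) (a : I -> R[i]) (c e : R) : 0 < e ->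
  (forall k, nrm (a k) <= c) -> finitely_classified (fun k l => nrm (a k - a l) <= e).
Proof.
move=> e0 ac; have e20 : 0 < e / 2 by rewrite divr_gt0.
have [V [r hr]] := finitely_classified_real e20 (fun k => le_trans (nrm_ge_Re _) (ac k)).
have [W [q hq]] := finitely_classified_real e20 (fun k => le_trans (nrm_ge_Im _) (ac k)).
exists (V * W)%type, (fun k => (r k, q k)) => k l [/hr h1 /hq h2].
by apply: (le_trans (nrm_le_ReIm _)); rewrite !raddfB/= (splitr e) lerD.
Qed.

End finite_classification.

Section compact_operators.
Context {R : realType} {X Y : normedModType R[i]}.

Lemma open_nrm_ball (V : normedModType R[i]) (y : V) (e : R) :
  open [set a | nrm (a - y) < e].
Proof.
rewrite openE => a /= ae; apply/nbhs_ballP; exists (e - nrm (a - y))%:C => /=.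
  by rewrite ltcR subr_gt0.
move=> b; rewrite -ball_normE /= -nrmE ltcR ltrBrDr => ab.
by apply: le_lt_trans ab; rewrite (le_trans (nrm_triangle a _ _))// nrm_distC.
Qed.

Lemma bop_dense_approx (T : bounded_op X Y) (q : nat -> X) :
  (forall x (e : R), 0 < e -> exists k, nrm (x - q k) < e) ->
  forall x (r : R), 0 < r -> exists k, nrm (T x - T (q k)) < r.
Proof.
move=> qd x r r0; have L0 := opnorm_ge0 T.
have r1 : 0 < r / (opnorm T + 1) by rewrite divr_gt0// ltr_wpDl.
have [k hk] := qd x _ r1; exists k; rewrite -bop_linearB.
apply: (le_lt_trans (bop_nrm_le _ _)).
move: hk; rewrite ltr_pdivlMr ?ltr_wpDl//; apply: le_lt_trans.
by rewrite mulrC ler_wpM2l// lerDl.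
Qed.

(** The centers are images of terms of q, not only of those in the unit ball: the
closure of the image of the ball is covered all the same. *)
Lemma compact_op_net (T : bounded_op X Y) (q : nat -> X) (e : R) :
  T \in is_compact_op -> (forall x (e : R), 0 < e -> exists k, nrm (x - q k) < e) ->
  0 < e -> exists s : seq nat, forall x, nrm x <= 1 ->
    exists2 k, k \in s & nrm (T x - T (q k)) < e.
Proof.
rewrite inE /= precompactE => cK qd e0.
have e20 : 0 < e / 2 by rewrite divr_gt0.
have : cover_compact (closure (T @` [set x | `|x| <= 1])) by rewrite -compact_cover.
move=> /(_ nat setT (fun k => [set a | nrm (a - T (q k)) < e])) [k _|a Ka|D _ KD].
- exact: open_nrm_ball.
- have : nbhs a [set b | nrm (b - a) < e / 2].
    by apply: open_nbhs_nbhs; split; [exact: open_nrm_ball|rewrite /= subrr nrm0].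
  move=> /(Ka _)[_ [[x _ <-] /= h1]].
  have [k hk] := bop_dense_approx T qd x e20.
  exists k => //=; rewrite (le_lt_trans (nrm_triangle (T x) _ _))//.
  by rewrite (splitr e) ltrD// nrm_distC.
- exists (enum_fset D) => x x1.
  have /KD[k /= kD Tk] : closure (T @` [set x | `|x| <= 1]) (T x).
    by apply: subset_closure; exists x => //=; rewrite -nrmE lecR.
  by exists k.
Qed.

(** Up to a multiple of e, a compact operator T is determined by finitely many
natural numbers: a finite net of points for the image of the unit ball,
approximations of the images of these points, finitely many functionals that
represent all the functionals of the sequence on these images, and approximations
of the compositions of these functionals with T. That the composition of a
functional with T depends, up to e, only on its values on a finite set is the
argument of Schauder's theorem. Countably many such descriptions exist, whence
the separability of S. *)
Section separability.
Variables (S : set (bounded_op X Y)) (q : nat -> X) (dY : nat -> Y).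
Variables (w : nat -> bounded_op Y R[i]^o) (z : nat -> bounded_op X R[i]^o).
Hypothesis S_compact : forall T, S T -> T \in is_compact_op.
Hypothesis q_dense : forall x (e : R), 0 < e -> exists k, nrm (x - q k) < e.
Hypothesis dY_dense : forall T x (e : R), S T -> 0 < e -> exists k, nrm (T x - dY k) < e.
Hypothesis w_le1 : forall k y, nrm (w k y) <= nrm y.
Hypothesis w_norming : forall T T' x (c : R), S T -> S T' ->
  (forall k, nrm (w k (T x - T' x)) <= c) -> nrm (T x - T' x) <= c.
Hypothesis z_dense : forall T k (e : R), S T -> 0 < e ->
  exists j, forall x, nrm x <= 1 -> nrm (w k (T x) - z j x) < e.

(** In the list l1 the second entry is the index of an approximation of the image
of the point indexed by the first; in l2 it is the index of an approximation of
the composition of T with the functional indexed by the first. *)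
Definition describes (e : R) (l1 l2 : seq (nat * nat)) (T : bounded_op X Y) : Prop :=
  [/\ forall x, nrm x <= 1 -> exists2 p, p \in l1 & nrm (T x - T (q p.1)) <= e,
      forall p, p \in l1 -> nrm (T (q p.1) - dY p.2) <= e,
      forall k, exists2 p, p \in l2 & forall p', p' \in l1 ->
        nrm (w k (T (q p'.1)) - w p.1 (T (q p'.1))) <= e &
      forall p, p \in l2 -> forall x, nrm x <= 1 -> nrm (w p.1 (T x) - z p.2 x) <= e].

Lemma describes_exists (e : R) T : S T -> 0 < e ->
  exists l1 l2, describes e l1 l2 T.
Proof.
move=> ST e0; have [s hs] := compact_op_net (S_compact ST) q_dense e0.
have /choice [dl hdl] k := dY_dense (q k) ST e0.
have /choice [zt hzt] k := z_dense k ST e0.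
have fc : finitely_classified (fun k l => forall j, j \in s ->
    nrm (w k (T (q j)) - w l (T (q j))) <= e).
  apply: finitely_classified_all => j.
  exact: (finitely_classified_complex (c := nrm (T (q j)))).
have [ws hws] := finitely_classified_representatives 0%N fc.
exists [seq (k, dl k) | k <- s], [seq (k, zt k) | k <- ws]; split.
- move=> x /hs[k ks hk]; exists (k, dl k); last exact: ltW.
  by apply/mapP; exists k.
- by move=> _ /mapP[k ks ->] /=; exact/ltW/hdl.
- move=> k; have [j jws hj] := hws k; exists (j, zt j).
    by apply/mapP; exists j.
  by move=> _ /mapP[i si ->] /=; exact: hj.
- by move=> _ /mapP[k ks ->] x x1 /=; exact/ltW/hzt.
Qed.

(** A functional w k and its representative w p are 3e apart on T x and 7e apart
on T' x; the extra 4e comes from comparing T and T' at the net. The common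
approximation z p costs another e for each of the two operators. *)
Lemma describes_close (e : R) l1 l2 T T' : S T -> S T' ->
  describes e l1 l2 T -> describes e l1 l2 T' ->
  forall x, nrm x <= 1 -> nrm (T x - T' x) <= e *+ 12.
Proof.
move=> ST ST' [T1 T2 T3 T4] [U1 U2 U3 U4] x x1; apply: w_norming => // k.
have [p pl hp] := T3 k.
have wB j a b : nrm (w j a - w j b) <= nrm (a - b) by rewrite -bop_linearB w_le1.
have TT' p' : p' \in l1 -> nrm (T (q p'.1) - T' (q p'.1)) <= e *+ 2.
  move=> pl'; rewrite (le_trans (nrm_triangle (dY p'.2) _ _))// mulr2n lerD ?T2//.
  by rewrite nrm_distC U2.
have hp' p' : p' \in l1 -> nrm (w k (T' (q p'.1)) - w p.1 (T' (q p'.1))) <= e *+ 5.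
  move=> pl'.
  apply: (le_trans (nrm_triangle (w k (T (q p'.1))) _ _)).
  rewrite (mulrnDr e 2 3) lerD//.
    by rewrite (le_trans (wB _ _ _))// nrm_distC TT'.
  apply: (le_trans (nrm_triangle (w p.1 (T (q p'.1))) _ _)).
  rewrite (mulrnDr e 1 2) lerD//; first by rewrite mulr1n hp.
  by rewrite (le_trans (wB _ _ _))// TT'.
have key (V : bounded_op X Y) (n : nat) :
    (forall y, nrm y <= 1 -> exists2 p', p' \in l1 & nrm (V y - V (q p'.1)) <= e) ->
    (forall p', p' \in l1 -> nrm (w k (V (q p'.1)) - w p.1 (V (q p'.1))) <= e *+ n) ->
    (forall y, nrm y <= 1 -> nrm (w p.1 (V y) - z p.2 y) <= e) ->
    nrm (w k (V x) - z p.2 x) <= e *+ (n + 3).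
  move=> h1 h2 h3; have [p' pl' hx] := h1 _ x1.
  apply: (le_trans (nrm_triangle (w p.1 (V x)) _ _)).
  rewrite (_ : (n + 3 = (n + 2) + 1)%N); last by rewrite -addnA.
  rewrite mulrnDr lerD//; last by rewrite mulr1n h3.
  apply: (le_trans (nrm_triangle (w k (V (q p'.1))) _ _)).
  rewrite (_ : (n + 2 = 1 + (n + 1))%N); last by rewrite addnA add1n addn1 addn2.
  rewrite mulrnDr lerD//; first by rewrite mulr1n (le_trans (wB _ _ _)).
  apply: (le_trans (nrm_triangle (w p.1 (V (q p'.1))) _ _)).
  by rewrite mulrnDr lerD// ?h2// mulr1n (le_trans (wB _ _ _))// nrm_distC.
have kT : nrm (w k (T x) - z p.2 x) <= e *+ (1 + 3).
  exact: (key T 1%N T1 hp (T4 _ pl)).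
have kT' : nrm (w k (T' x) - z p.2 x) <= e *+ (5 + 3).
  exact: (key T' 5%N U1 hp' (U4 _ pl)).
rewrite bop_linearB (le_trans (nrm_triangle (z p.2 x) _ _))//.
by rewrite (mulrnDr e 4 8) lerD// nrm_distC.
Qed.

Lemma compact_ops_separable : exists c : nat -> bounded_op X Y,
  forall T (e : R), S T -> 0 < e -> exists n, opnorm (T - c n) < e.
Proof.
pose C := (nat * seq (nat * nat) * seq (nat * nat))%type.
pose pick (a : C) : bounded_op X Y :=
  xget 0 [set T | S T /\ describes a.1.1.+1%:R^-1 a.1.2 a.2 T].
pose c n := if @choice.unpickle C n is Some a then pick a else 0.
exists c => T e ST e0.
(* Descriptions at precision less than e / 13 put T within 12 e / 13. *)
pose m := Num.truncn (e / 13)^-1.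
have e13 : 0 < e / 13 by rewrite divr_gt0.
have me : m.+1%:R^-1 < e / 13.
  by rewrite -[ltRHS]invrK ltf_pV2 ?posrE ?invr_gt0// truncnS_gt.
have m0 : 0 < m.+1%:R^-1 :> R by rewrite invr_gt0.
have [l1 [l2 dT]] := describes_exists ST m0.
exists (@choice.pickle C (m, l1, l2)); rewrite /c choice.pickleK.
have [SU dU] : [set T | S T /\ describes m.+1%:R^-1 l1 l2 T] (pick (m, l1, l2)).
  by apply: xgetPex; exists T.
apply: (@le_lt_trans _ _ (m.+1%:R^-1 *+ 12)).
  by apply: opnorm_le => x x1; exact: (describes_close ST SU dT dU).
apply: (@lt_trans _ _ ((e / 13) *+ 12)); first by rewrite ltrMn2r.
by rewrite -mulr_natr; lra.
Qed.

End separability.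

End compact_operators.

(** * Dense sequences and measurability *)

Section dense_sequences.
Context {R : realType}.

Definition dense_seq (V : normedModType R[i]) (q : nat -> V) : Prop :=
  forall x (e : R), 0 < e -> exists k, nrm (x - q k) < e.

Lemma separable_dense_seq (X : normedModType R[i]) : separable X ->
  exists q : nat -> X, dense_seq q.
Proof.
move=> [D /countable_injP [f finj] dD].
exists (fun n => xget 0 [set x | D x /\ f x = n]) => x e e0.
have [] := dD [set a | nrm (a - x) < e].
- by exists x; rewrite /= subrr nrm0.
- exact: open_nrm_ball.
move=> d [dx Dd]; exists (f d).
case: xgetP => [y _ [Dy fy]|/(_ d)[]//].
by rewrite (finj _ _ _ _ fy) ?inE// nrm_distC.
Qed.

Lemma bop_eq_dense (X Y : normedModType R[i]) (q : nat -> X) (S T : bounded_op X Y) :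
  dense_seq q -> (forall k, S (q k) = T (q k)) -> S = T.
Proof.
move=> qd ST; suff : S - T = 0 by move/eqP; rewrite subr_eq0 => /eqP.
apply: opnorm_eq0; apply/eqP; rewrite eq_le opnorm_ge0 andbT.
apply: opnorm_le => x _; apply/ler_addgt0Pr => e e0; rewrite add0r.
have [k hk] := bop_dense_approx (S - T) qd x e0.
move: hk; have -> : (S - T) (q k) = S (q k) - T (q k) by [].
by rewrite ST subrr subr0 => /ltW.
Qed.

Section rational_combinations.

(** A list of triples encodes a combination of terms of a sequence with
coefficients in Q[i]; there are only countably many lists, so that countably many
almost everywhere relations hold simultaneously. *)
Definition coef (p : rat * rat * nat) : R[i] := ratr p.1.1 +i* ratr p.1.2.

Definition comb (V : normedModType R[i]) (v : nat -> V) (l : seq (rat * rat * nat)) : V :=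
  \sum_(p <- l) coef p *: v p.2.

Definition scale_comb (a b : rat) (l : seq (rat * rat * nat)) :=
  [seq (a * p.1.1 - b * p.1.2, a * p.1.2 + b * p.1.1, p.2) | p <- l].

Lemma comb_cat (V : normedModType R[i]) (v : nat -> V) l l' :
  comb v (l ++ l') = comb v l + comb v l'.
Proof. by rewrite /comb big_cat. Qed.

Lemma comb_scale (V : normedModType R[i]) (v : nat -> V) a b l :
  comb v (scale_comb a b l) = (ratr a +i* ratr b) *: comb v l.
Proof.
rewrite /comb big_map scaler_sumr; apply: eq_bigr => p _; rewrite scalerA.
by congr (_ *: _); rewrite /coef /= rmorphB rmorphD !rmorphM.
Qed.

Lemma comb1 (V : normedModType R[i]) (v : nat -> V) n : comb v [:: (1, 0, n)] = v n.
Proof.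
by rewrite /comb big_seq1 /coef/= rmorph1 rmorph0 -[RHS]scale1r.
Qed.

Lemma rational_complex_dense (a : R[i]) (e : R) : 0 < e ->
  exists p r : rat, nrm (a - (ratr p +i* ratr r)) < e.
Proof.
move=> e0; have e20 : 0 < e / 2 by rewrite divr_gt0.
have dq (x : R) : exists p : rat, `|x - ratr p| < e / 2.
  have : x < x + e / 2 by rewrite ltrDl.
  move=> /rat_in_itvoo[p]; rewrite in_itv/= => /andP[h1 h2]; exists p.
  by rewrite distrC ger0_norm ?subr_ge0 ?ltW// ltrBlDl.
have [p hp] := dq (complex.Re a); have [r hr] := dq (complex.Im a).
exists p, r; apply: (le_lt_trans (nrm_le_ReIm _)).
by rewrite !raddfB/= (splitr e) ltrD.
Qed.

Section extension.
Variables (X Y : normedModType R[i]) (q : nat -> X) (v : nat -> Y) (c : R).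
Hypothesis cY : seq_complete Y.
Hypothesis qd : dense_seq q.
Hypothesis c0 : 0 <= c.
Hypothesis vc : forall l, nrm (comb v l) <= c * nrm (comb q l).

(** For a in Q[i] the left-hand side is the norm of a single combination, to which
the hypothesis applies; the general case follows by approximation of a. This is
the linearity of the extension before passing to the limit. *)
Lemma comb_linear_bound (a : R[i]) l1 l2 l3 :
  nrm (a *: comb v l1 + comb v l2 - comb v l3) <=
  c * nrm (a *: comb q l1 + comb q l2 - comb q l3).
Proof.
apply/ler_addgt0Pr => e e0.
set K := nrm (comb v l1) + c * nrm (comb q l1) + 1.
have K0 : 0 < K by rewrite ltr_wpDl// addr_ge0// mulr_ge0.
have eK : 0 < e / K by rewrite divr_gt0.
have [p [r]] := rational_complex_dense a eK; set b := (ratr p +i* ratr r) => ab.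
have split_b (V : normedModType R[i]) (u : nat -> V) :
    a *: comb u l1 + comb u l2 - comb u l3 =
    (a - b) *: comb u l1 + comb u (scale_comb p r l1 ++ l2 ++ scale_comb (-1) 0 l3).
  rewrite !comb_cat !comb_scale -/b rmorphN1 rmorph0.
  rewrite (_ : (-1 +i* 0) = -1 :> R[i]); last by apply/eqP; rewrite eq_complex/= oppr0 !eqxx.
  by rewrite scaleN1r !addrA -scalerDl subrK.
have hq : nrm (comb q (scale_comb p r l1 ++ l2 ++ scale_comb (-1) 0 l3)) <=
    nrm (a *: comb q l1 + comb q l2 - comb q l3) + nrm (a - b) * nrm (comb q l1).
  rewrite split_b -nrmZ (addrC (_ *: _)).
  by have := nrmB (comb q (scale_comb p r l1 ++ l2 ++ scale_comb (-1) 0 l3) + (a - b) *: comb q l1)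
    ((a - b) *: comb q l1); rewrite addrK.
rewrite split_b (le_trans (nrmD _ _))// nrmZ.
apply: (@le_trans _ _ (nrm (a - b) * nrm (comb v l1) +
  c * (nrm (a *: comb q l1 + comb q l2 - comb q l3) + nrm (a - b) * nrm (comb q l1)))).
  by rewrite lerD2l (le_trans (vc _))// ler_wpM2l.
rewrite split_b mulrDr addrCA lerD2l.
apply: (@le_trans _ _ (nrm (a - b) * K)); last first.
  by rewrite -ler_pdivlMr// ltW.
rewrite /K !mulrDr mulr1 mulrCA -addrA lerD2l lerDl//.
Qed.

Lemma comb_extension : exists T : bounded_op X Y,
  (forall l, T (comb q l) = comb v l) /\ opnorm T <= c.
Proof.
have /choice [L LP] : forall x : X, exists L : nat -> seq (rat * rat * nat),
    comb q (L n) @[n --> \oo] --> x.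
  move=> x.
  have /choice [k hk] : forall n, exists k, nrm (x - q k) < n.+1%:R^-1.
    by move=> n; apply: qd; rewrite invr_gt0.
  exists (fun n => [:: (1, 0, k n)]); under eq_fun do rewrite comb1.
  apply: (@nrm_squeeze _ _ _ _ (fun n => n.+1%:R^-1)); last exact: cvg_harmonic.
  by move=> n; rewrite nrm_distC ltW.
have vdist l l' : nrm (comb v l - comb v l') <= c * nrm (comb q l - comb q l').
  by have := comb_linear_bound 1 l [::] l'; rewrite /comb !big_nil !addr0 !scale1r.
have cvx x : exists y : Y, comb v (L x n) @[n --> \oo] --> y.
  apply: cY => e e0; have c1 : 0 < c + 1 by rewrite ltr_wpDl.
  have e1 : 0 < e / (c + 1) / 2 by rewrite !divr_gt0.
  have /cvg_nrmP/cvgrPdist_lt/(_ _ e1)[N _ hN] := LP x.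
  exists N => m n Nm Nn; apply: (le_lt_trans (vdist _ _)).
  have := hN _ Nm; have := hN _ Nn; rewrite /= !sub0r !normrN !ger0_norm// => h1 h2.
  have h3 : nrm (comb q (L x m) - comb q (L x n)) < e / (c + 1).
    rewrite (splitr (e / (c + 1))) (le_lt_trans (nrm_triangle x _ _))//.
    by rewrite ltrD// nrm_distC.
  apply: (@le_lt_trans _ _ ((c + 1) * nrm (comb q (L x m) - comb q (L x n)))).
    by rewrite ler_wpM2r// lerDl.
  by rewrite mulrC -ltr_pdivlMr.
have /choice [T TP] := cvx.
have T_linear : linear T.
  move=> a x y; apply/eqP; rewrite eq_sym -subr_eq0; apply/eqP/nrm_eq0/eqP.
  rewrite eq_le nrm_ge0 andbT.
  have h1 : a *: comb v (L x n) + comb v (L y n) - comb v (L (a *: x + y) n) @[n --> \oo]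
      --> a *: T x + T y - T (a *: x + y).
    by apply: cvgB => //; apply: cvgD => //; apply: cvg_scaler => //; exact: cvg_cst.
  have h2 : a *: comb q (L x n) + comb q (L y n) - comb q (L (a *: x + y) n) @[n --> \oo]
      --> a *: x + y - (a *: x + y).
    by apply: cvgB => //; apply: cvgD => //; apply: cvg_scaler => //; exact: cvg_cst.
  rewrite subrr in h2; have := cvg_nrm h2; rewrite nrm0 => /(cvg0_mull c) h3.
  apply/ler_addgt0Pr => e e0; rewrite add0r.
  apply: (cvgn_le_nrm h1); move/cvgr0Pnorm_lt : h3 => /(_ _ e0).
  apply: filterS => n; rewrite ger0_norm ?mulr_ge0// => /ltW; apply: le_trans.
  exact: comb_linear_bound.
have Tle x : nrm (T x) <= c * nrm x.
  have h1 := cvg_nrm (TP x).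
  have h2 : c * nrm (comb q (L x n)) @[n --> \oo] --> c * nrm x.
    by apply: cvgM; [exact: cvg_cst|exact: cvg_nrm].
  rewrite -(cvg_lim _ h1)// -(cvg_lim _ h2)//; apply: ler_lim.
  - by apply/cvg_ex; exists (nrm (T x)).
  - by apply/cvg_ex; exists (c * nrm x).
  - exact: nearW.
have [B BT] := mk_bop T_linear Tle.
exists B; split; last by apply: opnorm_le_bound => // x; rewrite BT.
move=> l; rewrite BT; apply: (nrm_lim_unique (TP _)).
have /cvg_nrmP/(cvg0_mull c) h := LP (comb q l).
by apply: nrm_squeeze h => n; exact: vdist.
Qed.

End extension.

End rational_combinations.

End dense_sequences.

Section measurability.
Context {d : measure_display} {T : measurableType d} {R : realType}.
Variable E : normedModType R[i].

Lemma bmeas_separable_range (f : T -> E) : bmeas f ->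
  exists c : nat -> E, forall x (e : R), 0 < e -> exists k, nrm (f x - c k) < e.
Proof.
move=> [s ss sf].
pose c n := if @choice.unpickle (nat * nat)%type n is Some (m, k)
  then nth 0 (fset_set (range (s m))) k else 0.
exists c => x e e0.
have /cvg_nrmP/cvgrPdist_lt/(_ _ e0)[N _ hN] := sf x.
have := hN N (leqnn N); rewrite /= sub0r normrN ger0_norm// nrm_distC => h.
have sx : s N x \in fset_set (range (s N)).
  by rewrite in_fset_set; [rewrite mem_set//; exists x|exact: (proj1 (ss N))].
exists (choice.pickle (N, index (s N x) (fset_set (range (s N))))).
by rewrite /c choice.pickleK nth_index.
Qed.

Lemma measurable_fun_of_le (h : T -> R) :
  (forall r, measurable [set x | h x <= r]) -> measurable_fun setT h.
Proof.
move=> mh _; apply: (measurability _ (RGenOInfty.measurableE R)) => //.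
move=> /= _ [_ [r ->] <-]; rewrite setTI.
rewrite (_ : h @^-1` _ = ~` [set x | h x <= r]); first exact: measurableC.
apply/seteqP; split=> x /=; rewrite in_itv/= andbT.
  by move=> h1; apply/negP; rewrite -ltNge.
by move=> /negP; rewrite -ltNge.
Qed.

(** Choosing at stage n the best of the first n + 1 candidates gives simple
functions that converge everywhere. *)
Lemma bmeas_of_separable (f : T -> E) (c : nat -> E) :
  (forall n r, measurable [set x | nrm (f x - c n) <= r]) ->
  (forall x (e : R), 0 < e -> exists k, nrm (f x - c k) < e) -> bmeas f.
Proof.
move=> mf cf.
have md n : measurable_fun setT (fun x => nrm (f x - c n)).
  by apply: measurable_fun_of_le => r; exact: mf.
pose best := fix best n x : nat := if n is n'.+1 then
  if nrm (f x - c n) < nrm (f x - c (best n' x)) then n else best n' x else 0%N.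
have sbest n : simple_fun (best n).
  elim: n => [|n IH]; first exact: simple_cst.
  pose A := [set x | nrm (f x - c n.+1) < nrm (f x - c (best n x))].
  have mA : measurable A.
    rewrite (_ : A = \bigcup_k (best n @^-1` [set k] `&`
        [set x | nrm (f x - c n.+1) < nrm (f x - c k)])).
      apply: bigcup_measurable => k _; apply: measurableI; first exact: (proj2 IH).
      rewrite (_ : [set x | _] = ~` (setT `&` [set x | nrm (f x - c k) <= nrm (f x - c n.+1)])).
        by apply: measurableC; exact: measurable_fun_le.
      by rewrite setTI; apply/seteqP; split=> x /=; rewrite ltNge => /negP.
    apply/seteqP; split=> x /=; first by move=> Ax; exists (best n x).
    by move=> [k _ [/= bk fk]]; rewrite /A /= bk.
  have := simple_op (fun (b : bool) k => if b then n.+1 else k) (simple_bool mA) IH.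
  congr simple_fun; apply/funext => x /=.
  by case: ifPn => [/asboolP -> //|/asboolP/negP/negbTE ->].
have best_le n k x : (k <= n)%N -> nrm (f x - c (best n x)) <= nrm (f x - c k).
  elim: n => [|n IH]; first by rewrite leqn0 => /eqP ->.
  rewrite leq_eqVlt => /predU1P[->/=|].
    by case: ltP => // /ltW.
  by rewrite ltnS => /IH h /=; case: ltP => // /ltW h'; exact: le_trans h.
exists (fun n x => c (best n x)) => [n|x]; first exact: (simple_comp c (sbest n)).
apply/cvg_nrmP/cvgr0Pnorm_lt => e e0; have [k hk] := cf x _ e0.
exists k => // n /= kn; rewrite ger0_norm// nrm_distC.
exact: le_lt_trans (best_le _ _ _ kn) hk.
Qed.

End measurability.

(** * Densities of operator-valued measures *)

Section pointwise_bound.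
Context {d : measure_display} {T : measurableType d} {R : realType}.
Variable P : probability T R.

Lemma bochner_integral_comb (E : normedModType R[i]) (a : R[i]) (f g : T -> E) A :
  seq_complete E -> bint P f -> bint P g -> measurable A ->
  bochner_integral P A (fun t => a *: f t + g t) =
  a *: bochner_integral P A f + bochner_integral P A g.
Proof.
move=> cE fi gi mA.
have [bf _] := bint_patch mA fi; have [bg _] := bint_patch mA gi.
apply: bochner_integralE => //; first by case: (bintD (bintZ a fi) gi).
have [baf _] := bintZ a (bint_patch mA fi).
have := is_bochnerD baf bg (is_bochnerZ a bf (is_bochner_integralP cE mA fi))
  (is_bochner_integralP cE mA gi).
congr (is_bochner_integral P _ _); apply/funext => t; rewrite /patch.
by case: ifP => //; rewrite scaler0 addr0.
Qed.

Variables (X Y : normedModType R[i]) (cY : seq_complete Y) (q : nat -> X).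
Variable mu : set T -> compact_op X Y.
Hypothesis mu_bv : bv_measures mu.
Variable f : nat -> T -> Y.
Hypothesis fi : forall n, bint P (f n).
Hypothesis fE : forall n A, measurable A -> mu A (q n) = bochner_integral P A (f n).

Let F l t := comb (fun n => f n t) l.

Lemma bint_density_comb l : bint P (F l) /\
  forall A, measurable A -> mu A (comb q l) = bochner_integral P A (F l).
Proof.
have consE (V : normedModType R[i]) (v : nat -> V) p l' :
    comb v (p :: l') = coef p *: v p.2 + comb v l' by rewrite /comb big_cons.
elim: l => [|p l [IH1 IH2]].
  have F0 : F [::] = fun=> 0 by apply/funext => t; rewrite /F /comb big_nil.
  have i0 : bint P (fun _ : T => 0 : Y).
    have := bintZ 0 (fi 0); congr (bint P _).
    by apply/funext => t; rewrite scale0r.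
  rewrite F0; split=> // A mA; rewrite /comb big_nil bop_linear0.
  have := bochner_integral_comb (-1) cY i0 i0 mA.
  rewrite [in RHS]scaleN1r addNr => h; apply: etrans (esym h) _; congr bochner_integral.
  by apply/funext => t; rewrite scaler0 addr0.
have FE : F (p :: l) = fun t => coef p *: f p.2 t + F l t.
  by apply/funext => t; rewrite /F consE.
rewrite FE; split=> [|A mA]; first exact: bintD (bintZ _ (fi _)) IH1.
by rewrite consE bop_linearD bop_linearZ (bochner_integral_comb (coef p) cY (fi _) IH1 mA) IH2// fE.
Qed.

Lemma variation_eval x A :
  (variation (fun B => mu B x) A <= (nrm x)%:E * variation mu A)%E.
Proof.
apply: variation_le => n G pG.
apply: (@le_trans _ _ ((nrm x)%:E * (\sum_(0 <= i < n) nrm (mu (G i)))%:E)%E).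
  rewrite -EFinM lee_fin big_distrr/=; apply: ler_sum => i _.
  by rewrite mulrC; exact: bop_nrm_le.
by apply: lee_wpmul2l; [rewrite lee_fin|exact: variation_ge].
Qed.

(** Real functions whose integrals are dominated by the variation. They are
closed under maxima because the variation is superadditive, so that the supremum
of the countably many quotients below still has a finite integral: this is how a
single integrable function bounds all these quotients at once. *)
Definition variation_dominated (h : T -> R) : Prop :=
  [/\ measurable_fun setT h, forall t, 0 <= h t &
    forall A, measurable A -> (\int[P]_(t in A) (h t)%:E <= variation mu A)%E].

Lemma variation_dominated_max h1 h2 :
  variation_dominated h1 -> variation_dominated h2 ->
  variation_dominated (fun t => Num.max (h1 t) (h2 t)).
Proof.
move=> [m1 p1 d1] [m2 p2 d2]; split => [|t|A mA]; first exact: measurable_maxr.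
  by rewrite le_max p1.
pose B := [set t | h1 t <= h2 t].
have mB : measurable B by rewrite -[B]setTI; exact: measurable_fun_le.
have mAB := measurableI _ _ mA mB; have mADB := measurableD mA mB.
have AE : A = (A `&` B) `|` (A `\` B) by rewrite setUIDK.
have dAB : (A `&` B) `&` (A `\` B) = set0.
  by apply/seteqP; split=> t //= [[_ Bt] [_ nBt]].
rewrite {1 2}AE; apply: le_trans (variationU mu mAB mADB dAB).
rewrite ge0_integral_setU//; first last.
- by apply/disj_setPS; rewrite dAB.
- by move=> t _; rewrite lee_fin le_max p1.
- by apply: measurable_funTS; apply/measurable_EFinP; exact: measurable_maxr.
apply: leeD.
- rewrite (eq_integral (fun t => (h2 t)%:E)); first exact: d2.
  by move=> t /[!inE] -[_ Bt]; rewrite max_r.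
- rewrite (eq_integral (fun t => (h1 t)%:E)); first exact: d1.
  by move=> t /[!inE] -[_ /= /negP]; rewrite -ltNge => h; rewrite max_l// ltW.
Qed.

Let r l t := nrm (F l t) / nrm (comb q l).

Lemma variation_dominated_ratio l : variation_dominated (r l).
Proof.
have [[bF iF] FE] := bint_density_comb l.
split => [|t|A mA].
- by apply: measurable_funM => //; exact: bmeas_nrm.
- by rewrite divr_ge0.
have [c0|cn0] := eqVneq (nrm (comb q l)) 0.
  rewrite (eq_integral (fun=> 0%E)); last by move=> t _; rewrite /r c0 invr0 mulr0.
  by rewrite integral0; exact: variation_ge0.
have c1 : 0 < nrm (comb q l) by rewrite lt_neqAle eq_sym cn0/=.
under eq_integral do rewrite /r mulrC EFinM.
rewrite ge0_integralZl_EFin//; first last.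
- by rewrite invr_ge0.
- by apply: measurable_funTS; apply/measurable_EFinP; exact: bmeas_nrm.
- by move=> t _; rewrite lee_fin.
have := density_integral_le_variation cY (conj bF iF) FE mA.
move=> /le_trans /(_ (variation_eval _ _)) h.
have c2 : (0 <= ((nrm (comb q l))^-1)%:E)%E by rewrite lee_fin invr_ge0.
apply: (le_trans (lee_wpmul2l c2 h)).
by rewrite muleA -EFinM mulVf// mul1e.
Qed.

Let code k : seq (rat * rat * nat) := odflt [::] (choice.unpickle k).

Let maxr_upto := fix maxr_upto n t : R :=
  if n is n'.+1 then Num.max (maxr_upto n' t) (r (code n') t) else 0.

(** The quotients at combinations of norm 0 carry no information; there the
densities vanish almost everywhere by uniqueness. *)
Lemma pointwise_bound_exists : exists g : T -> \bar R,
  [/\ measurable_fun setT g, forall t, (0 <= g t)%E,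
      (\int[P]_t g t < +oo)%E &
      {ae P, forall t, g t \is a fin_num /\
         forall l, nrm (comb (fun n => f n t) l) <= fine (g t) * nrm (comb q l)}].
Proof.
have dom n : variation_dominated (maxr_upto n).
  elim: n => [|n IH] /=.
    split => [|//|A mA]; first exact: measurable_cst.
    by rewrite integral0; exact: variation_ge0.
  by apply: variation_dominated_max IH _; exact: variation_dominated_ratio.
pose g t := limn (fun n => (maxr_upto n t)%:E).
have nd t : {homo (fun n => (maxr_upto n t)%:E) : n m / (n <= m)%N >-> (n <= m)%E}.
  by apply/nondecreasing_seqP => n; rewrite lee_fin /= le_max lexx.
have g_cvg t : (maxr_upto n t)%:E @[n --> \oo] --> g t.
  exact: ereal_nondecreasing_is_cvgn.
have le_g n t : ((maxr_upto n t)%:E <= g t)%E.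
  rewrite /g (cvg_lim _ (ereal_nondecreasing_cvgn (nd t)))//.
  by apply: ereal_sup_ubound; exists n.
have mM n : measurable_fun setT (fun t => (maxr_upto n t)%:E).
  by apply/measurable_EFinP; case: (dom n).
have M0 n t : (0 <= (maxr_upto n t)%:E)%E by rewrite lee_fin; case: (dom n).
have mg : measurable_fun setT g.
  by apply: (emeasurable_fun_cvg (fun n t => (maxr_upto n t)%:E)) => // t _; exact: g_cvg.
have g0 t : (0 <= g t)%E by apply: le_trans (le_g 0%N t); exact: M0.
have ig : (\int[P]_t g t < +oo)%E.
  have [_ bv] := mu_bv; apply: le_lt_trans bv.
  have h := @cvg_monotone_convergence _ _ _ P setT measurableT
    (fun n t => (maxr_upto n t)%:E) mM (fun n t _ => M0 n t) (fun t _ => nd t).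
  rewrite -(cvg_lim _ h)//; apply: lime_le.
    by apply/cvg_ex; eexists; exact: h.
  by apply: nearW => n; case: (dom n) => _ _; apply.
exists g; split => //.
have gfin : {ae P, forall t, g t \is a fin_num}.
  have : P.-integrable setT g.
    apply/integrableP; split=> //.
    by rewrite (eq_integral g)// => t _; rewrite gee0_abs.
  by move=> /(integrable_ae measurableT); apply: filterS => t; apply.
have Fnull k : {ae P, forall t, comb q (code k) = 0 -> F (code k) t = 0}.
  have [q0|q0] := eqVneq (comb q (code k)) 0; last by apply: aeW => t /eqP; rewrite (negbTE q0).
  have [iF FE] := bint_density_comb (code k).
  have i0 : bint P (fun _ : T => 0 : Y).
    have := bintZ 0 (fi 0); congr (bint P _).
    by apply/funext => t; rewrite scale0r.
  have [_ F0] := bint_density_comb [::].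
  have : {ae P, forall t, F (code k) t = (fun=> 0) t}.
    apply: (density_unique cY iF i0) => B mB.
    rewrite -FE// q0 bop_linear0.
    have := F0 B mB; rewrite {1}/comb big_nil bop_linear0 => h.
    apply: (etrans h); congr bochner_integral.
    by apply/funext => t; rewrite /F /comb big_nil.
  by apply: filterS => t.
apply: filterS2 gfin (ae_foralln Fnull) => t gt Ft; split=> // l.
have lE : code (choice.pickle l) = l by rewrite /code choice.pickleK.
have [q0|q0] := eqVneq (nrm (comb q l)) 0.
  rewrite q0 mulr0; have := Ft (choice.pickle l); rewrite lE => /(_ (nrm_eq0 q0)).
  by rewrite /F => ->; rewrite nrm0.
have c1 : 0 < nrm (comb q l) by rewrite lt_neqAle eq_sym q0/=.
rewrite -ler_pdivrMr// -lee_fin fineK//.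
apply: le_trans (le_g (choice.pickle l).+1 t); rewrite lee_fin /=.
by rewrite le_max lE lexx orbT.
Qed.

End pointwise_bound.

Section compact_op_maps.
Context {R : realType} {X Y : normedModType R[i]}.

Lemma eval_op (x : X) : exists L : bounded_op (compact_op X Y) Y, forall S, L S = S x.
Proof.
apply: (@mk_bop _ _ _ (fun S : compact_op X Y => S x) (nrm x)) => // S.
by rewrite mulrC; exact: bop_nrm_le.
Qed.

Lemma eval_functional (x : X) :
  exists L : bounded_op (bounded_op X R[i]^o) R[i]^o, forall S, L S = S x.
Proof.
apply: (@mk_bop _ _ _ (fun S : bounded_op X R[i]^o => S x) (nrm x)) => // S.
by rewrite mulrC; exact: bop_nrm_le.
Qed.

Lemma compose_functional (w : bounded_op Y R[i]^o) :
  exists L : bounded_op (compact_op X Y) (bounded_op X R[i]^o),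
    forall S x, L S x = w (S x).
Proof.
have wS (S : compact_op X Y) : exists B : bounded_op X R[i]^o, forall x, B x = w (S x).
  apply: (@mk_bop _ _ _ _ (opnorm w * opnorm S)) => [a x y|x].
    by rewrite bop_linear bop_linear.
  apply: (le_trans (bop_nrm_le _ _)); rewrite -mulrA ler_wpM2l ?opnorm_ge0//.
  exact: bop_nrm_le.
have /choice [L LE] := wS.
have L_linear : linear L.
  move=> a S S'; apply/val_inj/funext => x.
  by rewrite -[LHS]/(L (a *: S + S') x) -[RHS]/(a *: L S x + L S' x) !LE -bop_linear.
have Lle S : nrm (L S) <= opnorm w * nrm S.
  apply: opnorm_le_bound => [|x]; first by rewrite mulr_ge0 ?opnorm_ge0.
  rewrite LE (le_trans (bop_nrm_le _ _))// -mulrA ler_wpM2l ?opnorm_ge0//.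
  exact: bop_nrm_le.
have [B BL] := mk_bop L_linear Lle.
by exists B => S x; rewrite BL LE.
Qed.

End compact_op_maps.

Section op_density.
Context {d : measure_display} {T : measurableType d} {R : realType}.
Variable P : probability T R.
Variables (X Y : normedModType R[i]) (cY : seq_complete Y).
Variables (q : nat -> X) (qd : dense_seq q).
Hypothesis LK : forall S : bounded_op X Y, S \in is_compact_op.
Variable mu : set T -> compact_op X Y.
Hypothesis mu_bv : bv_measures mu.
Hypothesis eval_density : forall x, exists2 f : T -> Y, bint P f &
  forall A, measurable A -> mu A x = bochner_integral P A f.
Hypothesis functional_density : forall w : bounded_op Y R[i]^o,
  exists2 h : T -> bounded_op X R[i]^o, bint P h &
  forall A, measurable A -> forall x, w (mu A x) = bochner_integral P A h x.

(** The density of mu is assembled pointwise from the densities of its evaluations at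
the terms of a dense sequence. Its composition with a functional w agrees
almost everywhere with the density of the composed measure, hence has almost all
its values in the closure of a countable set; compactness of the values then
gives separability, and with it measurability in the operator norm. *)
Lemma op_density : exists2 f : T -> compact_op X Y, bint P f &
  forall A, measurable A -> mu A = bochner_integral P A f.
Proof.
have cC := @seq_complete_C R.
have cK : seq_complete (compact_op X Y).
  apply: seq_complete_cop cY; apply/seteqP; split=> // S _; exact: LK.
have cX' : seq_complete (bounded_op X R[i]^o) by exact: seq_complete_bop.
have /choice [f fP] : forall n, exists f : T -> Y, bint P f /\
    forall A, measurable A -> mu A (q n) = bochner_integral P A f.
  by move=> n; have [f fi fE] := eval_density (q n); exists f.
have fi n := (fP n).1; have fE n := (fP n).2.
pose F l t := comb (fun n => f n t) l.
have bF l : bmeas (F l) by case: (bint_density_comb cY fi fE l) => [[]].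
have [g [mg g0 ig gae]] := pointwise_bound_exists cY mu_bv fi fE.
(* The values of the operators to be built, and hence the differences of two such
   values, are limits of terms of the following sequences; functionals norming
   these terms therefore determine the norms of all differences. *)
have /choice [y yP] := fun l => bmeas_separable_range (bF l).
pose dY k := if @choice.unpickle (seq (rat * rat * nat) * nat)%type k is Some (l, j)
  then y l j else 0.
have dYP l t (e : R) : 0 < e -> exists k, nrm (F l t - dY k) < e.
  move=> /(yP l t)[j hj]; exists (choice.pickle (l, j)).
  by rewrite /dY choice.pickleK.
pose diff k := if @choice.unpickle (nat * nat)%type k is Some (i, j)
  then dY i - dY j else 0.
have /choice [w wP] := fun k => norming_functional (diff k).
have w_le1 k := (wP k).1; have w_norm k := (wP k).2.
have /choice [h hP] : forall k, exists h : T -> bounded_op X R[i]^o, bint P h /\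
    forall A, measurable A -> forall x, w k (mu A x) = bochner_integral P A h x.
  by move=> k; have [h hi hE] := functional_density (w k); exists h.
have hi k := (hP k).1; have hE k := (hP k).2.
have hae k n : {ae P, forall t, h k t (q n) = w k (f n t)}.
  have [L LE] := eval_functional (q n).
  have Lhi := bint_bop L (hi k); have wfi := bint_bop (w k) (fi n).
  have : {ae P, forall t, L (h k t) = w k (f n t)}.
    apply: (density_unique cC Lhi wfi) => B mB.
    rewrite (bochner_integral_bop (w k) cY (fi n) mB) -fE// hE//.
    by rewrite (bochner_integral_bop L cX' (hi k) mB) LE.
  by apply: filterS => t; rewrite LE.
have good_ae : {ae P, forall t, (g t \is a fin_num /\
    forall l, nrm (F l t) <= fine (g t) * nrm (comb q l)) /\
    forall k n, h k t (q n) = w k (f n t)}.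
  have hae' := ae_foralln (fun k => ae_foralln (hae k)).
  by apply: filterS2 gae hae' => t.
have [N [mN PN Ngood]] := good_ae.
have good t : ~ N t -> (g t \is a fin_num /\
    forall l, nrm (F l t) <= fine (g t) * nrm (comb q l)) /\
    forall k n, h k t (q n) = w k (f n t).
  by move=> Nt; apply: contrapT => bad; apply: Nt; exact: Ngood.
(* On the null set N there may be no extension; K is set to 0 there. *)
have /choice [K KP] : forall t, exists S : compact_op X Y,
    (N t -> S = 0) /\
    (~ N t -> (forall l, S (comb q l) = F l t) /\ opnorm S <= fine (g t)).
  move=> t; have [Nt|Nt] := pselect (N t); first by exists 0.
  have [[gt Fg] _] := good t Nt.
  have gt0 : 0 <= fine (g t) by rewrite fine_ge0.
  have [S [SF Sg]] := comb_extension cY qd gt0 Fg.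
  by exists (CompactOp (LK S)).
have KF t l : ~ N t -> K t (comb q l) = F l t by move=> /(KP t).2[].
have Kq t n : ~ N t -> K t (q n) = f n t.
  by move=> Nt; rewrite -(comb1 q n) KF// /F comb1.
pose S := [set cop_bop (K t) | t in ~` N].
have dY_dense V x (e : R) : S V -> 0 < e -> exists k, nrm (V x - dY k) < e.
  move=> [t Nt <-] e0; have e20 : 0 < e / 2 by rewrite divr_gt0.
  have [n hn] := bop_dense_approx (K t) qd x e20.
  have [k hk] := dYP [:: (1, 0, n)] t _ e20.
  exists k; rewrite (le_lt_trans (nrm_triangle (K t (q n)) _ _))// (splitr e) ltrD//.
  by rewrite Kq//; move: hk; rewrite /F comb1.
have wB k a b : nrm (w k a - w k b) <= nrm (a - b) by rewrite -bop_linearB w_le1.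
have w_norming V V' x (c : R) : S V -> S V' ->
    (forall k, nrm (w k (V x - V' x)) <= c) -> nrm (V x - V' x) <= c.
  move=> SV SV' hc; apply/ler_addgt0Pr => e e0.
  have e40 : 0 < e / 4 by rewrite divr_gt0.
  have [i hi'] := dY_dense V x _ SV e40; have [j hj] := dY_dense V' x _ SV' e40.
  pose k := choice.pickle (i, j).
  have kE : diff k = dY i - dY j by rewrite /diff choice.pickleK.
  have close : nrm (V x - V' x - diff k) <= e / 4 + e / 4.
    rewrite (_ : _ - diff k = (V x - dY i) - (V' x - dY j)); last first.
      by rewrite kE !opprD !opprK addrACA.
    by rewrite (le_trans (nrmB _ _))// lerD// ltW.
  have h1 : nrm (V x - V' x) <= nrm (diff k) + nrm (V x - V' x - diff k) by exact: nrmB_le.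
  have h2 : nrm (w k (diff k)) <= nrm (w k (V x - V' x)) + nrm (diff k - (V x - V' x)).
    apply: (le_trans (nrmB_le _ (w k (V x - V' x)))).
    by rewrite lerD2l wB.
  rewrite nrm_distC in h2; have h3 := hc k; have h4 := w_norm k.
  lra.
have hKE t k x : ~ N t -> h k t x = w k (K t x).
  move=> Nt; have [L LE] := compose_functional (X := X) (w k).
  suff -> : h k t = L (K t) by rewrite LE.
  apply: (bop_eq_dense qd) => n; rewrite LE Kq//.
  by have [_] := good t Nt; apply.
have /choice [zz zP] := fun k => bmeas_separable_range (proj1 (hi k)).
pose z m := if @choice.unpickle (nat * nat)%type m is Some (k, j) then zz k j else 0.
have z_dense V k (e : R) : S V -> 0 < e ->
    exists j, forall x, nrm x <= 1 -> nrm (w k (V x) - z j x) < e.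
  move=> [t Nt <-] e0; have [j hj] := zP k t e e0.
  exists (choice.pickle (k, j)) => x x1; rewrite /z choice.pickleK -hKE//.
  by apply: le_lt_trans hj; exact: (opnorm_ge (h k t - zz k j)).
have SK V : S V -> V \in is_compact_op by move=> _; exact: LK.
have [c cP] := compact_ops_separable SK qd dY_dense w_le1 w_norming z_dense.
(* The candidate 0 is added to the approximants because K vanishes on N. *)
pose c' n : compact_op X Y := if n is n'.+1 then CompactOp (LK (c n')) else 0.
have bK : bmeas K.
  apply: (@bmeas_of_separable _ _ _ _ _ c').
    move=> n s; have [s0|s0] := leP 0 s; last first.
      rewrite (_ : [set t | _] = set0)//; apply/seteqP; split=> t //=.
      by move=> h1; have := lt_le_trans s0 (le_trans (nrm_ge0 _) h1); rewrite ltxx.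
    rewrite (_ : [set t | _] = (N `&` [set t | nrm (0 - c' n) <= s]) `|`
        (~` N `&` \bigcap_m [set t | nrm (F [:: (1, 0, m)] t - c' n (q m)) <= s * nrm (q m)])).
      apply: measurableU; apply: measurableI => //.
      - have [hs|hs] := pselect (nrm (0 - c' n) <= s).
          by rewrite (_ : [set t | _] = setT)//; apply/seteqP; split.
        by rewrite (_ : [set t | _] = set0)//; apply/seteqP; split.
      - exact: measurableC.
      - apply: bigcap_measurable => // m _.
        rewrite -[X in measurable X]setTI; apply: measurable_fun_le => //.
        by apply: bmeas_nrm; apply: bmeasB => //; exact: bmeas_cst.
    apply/seteqP; split=> t /=.
      move=> hs; have [Nt|Nt] := pselect (N t).
        by left; split; [exact: Nt|move: hs; rewrite ((KP t).1 Nt)].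
      right; split; first exact: Nt.
      move=> m _; rewrite /= /F comb1 -Kq; last exact: Nt.
      apply: (le_trans (bop_nrm_le (val (K t - c' n)) (q m))).
      by apply: ler_wpM2r; [exact: nrm_ge0|exact: hs].
    move=> [[Nt]|[Nt hs]]; first by rewrite ((KP t).1 Nt).
    apply: opnorm_le_bound => // x; apply/ler_addgt0Pr => e e0.
    set D := val (K t - c' n).
    have D0 := opnorm_ge0 D.
    have D1 : 0 < opnorm D + s + 1 by lra.
    have [m hm] := qd x (divr_gt0 e0 D1).
    have Dm : nrm (D (q m)) <= s * nrm (q m).
      by have := hs m I; rewrite /= /F comb1 -Kq.
    have h1 : nrm (D x) <= nrm (D (q m)) + nrm (D x - D (q m)) by exact: nrmB_le.
    have h2 : nrm (D x - D (q m)) <= opnorm D * nrm (x - q m).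
      by rewrite -bop_linearB; exact: bop_nrm_le.
    have h3 : nrm (q m) <= nrm x + nrm (x - q m) by rewrite nrm_distC nrmB_le.
    have h4 : s * nrm (q m) <= s * nrm x + s * nrm (x - q m) by rewrite -mulrDr ler_wpM2l.
    have h5 : nrm (x - q m) * (opnorm D + s + 1) <= e.
      by rewrite -ler_pdivlMr// ltW.
    have h6 := nrm_ge0 (x - q m).
    nra.
  move=> t e e0; have [Nt|Nt] := pselect (N t).
    by exists 0%N; rewrite ((KP t).1 Nt) subrr nrm0.
  have [n hn] := cP (K t) e (ex_intro2 _ _ t Nt erefl) e0.
  by exists n.+1.
have iK : bint P K.
  split=> //; apply: le_lt_trans ig; apply: ge0_le_integral => //.
  - by move=> t _; rewrite lee_fin.
  - by apply/measurable_EFinP; exact: bmeas_nrm.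
  - move=> t _; have [Nt|Nt] := pselect (N t).
      by rewrite ((KP t).1 Nt) nrm0.
    have [[gt _] _] := good t Nt; rewrite -(fineK gt) lee_fin.
    by have [_] := (KP t).2 Nt.
exists K => // A mA; apply/val_inj; apply: (bop_eq_dense qd) => n /=.
have [L LE] := eval_op (Y := Y) (q n).
rewrite -LE -(LE (bochner_integral P A K)) LE fE//.
rewrite -(bochner_integral_bop L cK iK mA); apply: bochner_integral_ae.
exists N; split=> // t /= tN; apply: contrapT => Nt; apply: tN.
by rewrite LE Kq.
Qed.

End op_density.

Theorem theorem3 (R : realType) (G : topologicalZmodType)
    (Gcompact : compact [set: G]) (Gmetrizable : metrizable R G)
    (lam : probability (borel G) R) (lam_haar : is_haar lam)
    (Lam : set (character R G)) (X Y : completeNormedModType R[i])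
    (X_separable : separable X)
    (L_eq_K : [set: bounded_op X Y] =
              [set T : bounded_op X Y | T \in is_compact_op]) :
  (typeI_RNP lam Lam (bounded_op X R[i]^o) -> typeI_RNP lam Lam Y ->
   typeI_RNP lam Lam (compact_op X Y)) /\
  (typeII_RNP lam Lam (bounded_op X R[i]^o) -> typeII_RNP lam Lam Y ->
   typeII_RNP lam Lam (compact_op X Y)).
Proof.
have cY := complete_seq_complete (Y := Y).
have LK (S : bounded_op X Y) : S \in is_compact_op.
  by have : [set: bounded_op X Y] S by []; rewrite L_eq_K.
have cK := seq_complete_cop L_eq_K cY.
have cX' := seq_complete_bop (X := X) (@seq_complete_C R).
have [q qd] := separable_dense_seq X_separable.
have K_density (mu : set (borel G) -> compact_op X Y) : bv_measures mu ->
    (forall L : bounded_op (compact_op X Y) Y, exists2 f, bint lam f &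
      forall A, measurable A -> L (mu A) = bochner_integral lam A f) ->
    (forall L : bounded_op (compact_op X Y) (bounded_op X R[i]^o), exists2 f, bint lam f &
      forall A, measurable A -> L (mu A) = bochner_integral lam A f) ->
    exists2 f, bint lam f & forall A, measurable A -> mu A = bochner_integral lam A f.
  move=> bv muY muX; apply: (op_density cY qd LK bv) => [x|w].
    have [L LE] := eval_op (Y := Y) x; have [f fi fE] := muY L.
    by exists f => // A mA; rewrite -LE fE.
  have [L LE] := compose_functional (X := X) w; have [f fi fE] := muX L.
  by exists f => // A mA x; rewrite -LE fE.
split=> hX hY; apply/seteqP; split.
- move=> mu muK.
  have [] := K_density mu (proj1 (proj1 muK)) => [L|L|f fi fE].
  + apply: (@densitiesy_bint _ _ lam Lam); rewrite -hY.
    exact: bv_measures_infty_spec_bop.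
  + apply: (@densitiesy_bint _ _ lam Lam); rewrite -hX.
    exact: bv_measures_infty_spec_bop.
  + exact: densitiesy_intro fi fE.
- exact: densitiesy_sub.
- move=> mu muK.
  have [] := K_density mu (proj1 (proj1 muK)) => [L|L|f fi fE].
  + apply: (@densities1_bint _ _ lam Lam); rewrite -hY.
    exact: bv_measures_ac_spec_bop.
  + apply: (@densities1_bint _ _ lam Lam); rewrite -hX.
    exact: bv_measures_ac_spec_bop.
  + exact: densities1_intro fi fE.
- exact: densities1_sub.
Qed.
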